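(* Let $0<\beta<\alpha<\mu\le1$, let $k$ satisfy the kernel regularity assumption with exponent $\mu$ given in the context, and let $\lambda\in\mathbb C$ satisfy $\ker(I-\lambda K)=\{0\}$ in $X_\beta$. Fix the spline order $m\in\{2,3,4\}$, and let $A=I-\lambda K$, $A_h:=I-\lambda P_hK$. Then there exist $h_0=h_0(\lambda)>0$ and a constant $C_\lambda$ independent of $h$ (both of which may deteriorate as $\lambda$ approaches a characteristic value of $K$) such that, for $0<h\le h_0$, $A_h$ is invertible on $X_\beta$ and $$\|A_h^{-1}\|_{X_\beta\to X_\beta}\le C_\lambda .$$ For every $s_h\in S_h$ the solution $v\in X_\beta$ of $A_hv=s_h$ belongs to $S_h$; hence, for $f\in X_\alpha$ and $g=f_C+\lambda KJ_f$, the projected equation $A_hu_h=P_hg$ and the nodal collocation system $$(Au_h)(t_i^B)=g(t_i^B),\qquad i=1,\ldots,n_B,\quad u_h\in S_h,$$ have a unique solution.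
   Context: **Contour.** $\Gamma\subset\mathbb C$ is a simple, closed, positively oriented contour of class $C^2$ with a regular $C^2$, $2\pi$-periodic parametrization $\gamma:\mathbb R\to\Gamma$ (so $\gamma(\theta+2\pi)=\gamma(\theta)$, $\gamma'(\theta)\ne0$, $\gamma$ injective on $[0,2\pi)$). $\mathcal D=\{t_1^d,\ldots,t_{n_d}^d\}\subset\Gamma$, $n_d\ge1$, is a set of distinct points, $t_j^d=\gamma(\theta_j^d)$ with $0<\theta_1^d<\cdots<\theta_{n_d}^d<2\pi$; the point $t_*=\gamma(0)=\gamma(2\pi)\notin\mathcal D$ is the cut. The continuity arcs are the $n_d$ open arcs of $\Gamma\setminus\mathcal D$. For a function $v$ with one-sided limits, $v(t_j^d\pm0)$ denote the limits along the orientation ($-$: incoming, $+$: outgoing), $[v]_{t_j^d}:=v(t_j^d+0)-v(t_j^d-0)$, and functions are represented by incoming values $v(t_j^d)=v(t_j^d-0)$. **Spaces.** For $0<\sigma<1$, $X_\sigma=PH_\sigma(\Gamma,\mathcal D)$ is the space of complex functions that are $\sigma$-Hölder on every continuity arc and have finite lateral limits at all points of $\mathcal D$, with norm $\|v\|_{X_\sigma}=\max_I(\|v\|_{\infty,I}+[v]_{\sigma,I})$, the maximum over the continuity arcs $I$; here $\overline I^{\,\ell}$ is $I$ completed by its two endpoints carrying the lateral values, $\|v\|_{\infty,I}=\sup_{\overline I^{\,\ell}}|v|$ and $[v]_{\sigma,I}=\sup_{t\ne s\in\overline I^{\,\ell}}|v(t)-v(s)|/|t-s|^\sigma$. If $n_d=1$,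 the distance $|t-s|$ in this seminorm is understood as the distance along the (single) completed arc. $H_\sigma(\Gamma)$ ($0<\sigma\le1$) is the space of globally $\sigma$-Hölder (Lipschitz if $\sigma=1$) functions on $\Gamma$ with norm $\sup_\Gamma|v|+\sup_{t\ne s\in\Gamma}|v(t)-v(s)|/|t-s|^\sigma$. **Kernel regularity assumption.** There are constants $M_0,M_\mu$ with $|k(t,\tau)|\le M_0$ and $|k(t,\tau)-k(s,\tau)|\le M_\mu|t-s|^\mu$ for all $t,s,\tau\in\Gamma$, and a modulus of continuity $\omega_k$ with $\omega_k(r)\to0$ as $r\downarrow0$ such that $|k(t,\tau)-k(t,\zeta)|\le\omega_k(|\tau-\zeta|)$ for all $t,\tau,\zeta\in\Gamma$. **Operator.** $(Kv)(t)=\int_\Gamma k(t,\tau)v(\tau)\,d\tau$ (complex contour integral). A characteristic value of $K$ is $\nu^{-1}$ with $0\ne\nu\in\sigma(K:X_\beta\to X_\beta)$. **Generators and decomposition of the data.** For $0\le\theta<2\pi$: $H_j(\gamma(\theta))=0$ if $0\le\theta\le\theta_j^d$ and $=1$ if $\theta_j^d<\theta<2\pi$; $R(\gamma(\theta))=\theta/(2\pi)$; $G_j:=H_j-R$. For $f\in X_\alpha$: $J_f=\sum_{j=1}^{n_d}[f]_{t_j^d}G_j$ and $f_C=f-J_f\in H_\alpha(\Gamma)$. **Splines.** For an integer $n_B\ge4$ put $h=2\pi/n_B$ and choose a phase $\rho_h\in[0,h)$ with $\operatorname{dist}(\theta_j^d-\rho_h,h\mathbb Z)\ge\eta h$ for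 $j=1,\ldots,n_d$, where $0<\eta<1/(2n_d)$ is fixed. Put $\theta_i^B=\rho_h+(i-1)h\ (\mathrm{mod}\ 2\pi)$, $t_i^B=\gamma(\theta_i^B)$, $i=1,\ldots,n_B$. Let $N_m$ be the centered cardinal B-spline of order $m$ (degree $m-1$, support $[-m/2,m/2]$, $\sum_{r\in\mathbb Z}N_m(x-r)=1$), $B_j(\gamma(\theta))=\sum_{\ell\in\mathbb Z}N_m\big((\theta-\theta_j^B)/h-\ell n_B\big)$, and $S_h=\operatorname{span}\{B_1,\ldots,B_{n_B}\}$. For a continuous function $v$ on $\Gamma$, $P_hv\in S_h$ is the unique spline with $(P_hv)(t_i^B)=v(t_i^B)$, $i=1,\ldots,n_B$. The parameter $h$ ranges over the values $2\pi/n_B$. *)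

(* Defs.v *)
From Stdlib Require Import Reals ZArith Arith List ClassicalEpsilon.
From Coquelicot Require Import Coquelicot.
Open Scope R_scope.

(* Functions of a real variable with values in [C] are differentiated and
   integrated in the real normed module [C_R_NormedModule]. *)
Definition derivC (f : R -> C) (x : R) (l : C) : Prop :=
  @is_derive R_AbsRing C_R_NormedModule f x l.

Definition intC (f : R -> C) (a b : R) : C :=
  @RInt C_R_CompleteNormedModule f a b.

(* [enclosed g z]: [z] lies off the image of [g], in a bounded path component
   of the complement. *)
Definition off (g : R -> C) (z : C) : Prop := forall x, g x <> z.

Definition joined_off (g : R -> C) (z w : C) : Prop :=
  exists p : R -> C,
    (forall x, 0 <= x <= 1 -> continuous p x) /\ p 0 = z /\ p 1 = w /\
    (forall x, 0 <= x <= 1 -> off g (p x)).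

Definition enclosed (g : R -> C) (z : C) : Prop :=
  off g z /\ exists M, forall w, joined_off g z w -> Cmod w <= M.

Record contour := Contour {
  gam : R -> C;
  dgam : R -> C;
  d2gam : R -> C;
  gam_deriv : forall x, derivC gam x (dgam x);
  dgam_deriv : forall x, derivC dgam x (d2gam x);
  d2gam_cont : forall x, continuous d2gam x;
  gam_per : forall x, gam (x + 2 * PI) = gam x;
  gam_reg : forall x, dgam x <> RtoC 0;
  gam_inj : forall x y, 0 <= x < 2 * PI -> 0 <= y < 2 * PI ->
    gam x = gam y -> x = y;
  (* positive orientation: winding number +1 around the interior *)
  gam_pos : forall z, enclosed gam z ->
    intC (fun x => Cdiv (dgam x) (Cminus (gam x) z)) 0 (2 * PI)
      = Cmult (RtoC (2 * PI)) Ci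
}.

Definition Gamma (G : contour) : Type := {z : C | exists x, gam G x = z}.

Definition pt (G : contour) (x : R) : Gamma G :=
  exist _ (gam G x) (ex_intro _ x eq_refl).

Definition dist (G : contour) (t s : Gamma G) : R :=
  Cmod (Cminus (proj1_sig t) (proj1_sig s)).

Definition angle (G : contour) (t : Gamma G) : R :=
  epsilon (inhabits 0) (fun x => 0 <= x < 2 * PI /\ pt G x = t).

(* Discontinuity points [gam (thd j)], [1 <= j <= nd]; the values of [thd]
   outside this range are never used. *)
Record nodes := Nodes {
  nd : nat;
  thd : nat -> R;
  nd_pos : (1 <= nd)%nat;
  thd_range : forall j, (1 <= j <= nd)%nat -> 0 < thd j < 2 * PI;
  thd_incr : forall i j, (1 <= i)%nat -> (i < j)%nat -> (j <= nd)%nat ->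
    thd i < thd j
}.

(* The [j]-th continuity arc is the image of the open interval
   [(thd D j, arc_end D j)]; the last one runs through the cut. *)
Definition arc_end (D : nodes) (j : nat) : R :=
  if Nat.eqb j (nd D) then thd D 1%nat + 2 * PI else thd D (S j).

Definition lim_minus (G : contour) (v : Gamma G -> C) (x : R) (l : C) : Prop :=
  filterlim (fun y => v (pt G y)) (at_left x) (locally l).

Definition lim_plus (G : contour) (v : Gamma G -> C) (x : R) (l : C) : Prop :=
  filterlim (fun y => v (pt G y)) (at_right x) (locally l).

Definition val_minus (G : contour) (v : Gamma G -> C) (x : R) : C :=
  epsilon (inhabits (RtoC 0)) (lim_minus G v x).

Definition val_plus (G : contour) (v : Gamma G -> C) (x : R) : C :=
  epsilon (inhabits (RtoC 0)) (lim_plus G v x).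

Definition jump (G : contour) (D : nodes) (v : Gamma G -> C) (j : nat) : C :=
  Cminus (val_plus G v (thd D j)) (val_minus G v (thd D j)).

(* [x ^ s] for [x >= 0] and [s > 0]; [Rpower 0 s] would be [1]. *)
Definition hpow (x s : R) : R := if Rlt_dec 0 x then Rpower x s else 0.

(* The distance used in the Hoelder seminorm on a completed arc, in terms of
   the parameters of the two points. With a single discontinuity point the two
   ends of the completed arc lie over the same point of the plane, and arc
   length replaces the distance of the plane. *)
Definition arc_dist (G : contour) (D : nodes) (x y : R) : R :=
  if Nat.eqb (nd D) 1
  then RInt (fun z => Cmod (dgam G z)) (Rmin x y) (Rmax x y)
  else dist G (pt G x) (pt G y).

Definition in_X (G : contour) (D : nodes) (s : R) (v : Gamma G -> C) : Prop :=
  (forall j, (1 <= j <= nd D)%nat ->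
     lim_minus G v (thd D j) (v (pt G (thd D j))) /\
     exists l, lim_plus G v (thd D j) l) /\
  (forall j, (1 <= j <= nd D)%nat ->
     exists M, forall x y,
       thd D j < x < arc_end D j -> thd D j < y < arc_end D j ->
       Cmod (Cminus (v (pt G x)) (v (pt G y)))
         <= M * hpow (arc_dist G D x y) s).

(* [v] on the [j]-th arc completed by its two ends with the lateral values. *)
Definition arc_val (G : contour) (D : nodes) (v : Gamma G -> C) (j : nat)
    (x : R) : C :=
  if Req_EM_T x (thd D j) then val_plus G v x
  else if Req_EM_T x (arc_end D j) then val_minus G v x
  else v (pt G x).

Definition in_arc (D : nodes) (j : nat) (x : R) : Prop :=
  thd D j <= x <= arc_end D j.

Definition arc_sup (G : contour) (D : nodes) (v : Gamma G -> C) (j : nat)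
    : Rbar :=
  Lub_Rbar (fun r => exists x, in_arc D j x /\ r = Cmod (arc_val G D v j x)).

Definition arc_semi (G : contour) (D : nodes) (s : R) (v : Gamma G -> C)
    (j : nat) : Rbar :=
  Lub_Rbar (fun r => exists x y, in_arc D j x /\ in_arc D j y /\ x <> y /\
    r = Cmod (Cminus (arc_val G D v j x) (arc_val G D v j y))
        / hpow (arc_dist G D x y) s).

(* Both suprema are finite when [in_X G D s v], the only case in which
   [X_norm] is meaningful. *)
Definition X_norm (G : contour) (D : nodes) (s : R) (v : Gamma G -> C) : R :=
  fold_right Rmax 0
    (map (fun j => real (arc_sup G D v j) + real (arc_semi G D s v j))
         (seq 1 (nd D))).

Definition bounded_linear (G : contour) (D : nodes) (s : R)
    (T : (Gamma G -> C) -> (Gamma G -> C)) : Prop :=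
  (forall v, in_X G D s v -> in_X G D s (T v)) /\
  (forall v w, in_X G D s v -> in_X G D s w ->
     T (fun t => Cplus (v t) (w t)) = (fun t => Cplus (T v t) (T w t))) /\
  (forall a v, in_X G D s v ->
     T (fun t => Cmult a (v t)) = (fun t => Cmult a (T v t))) /\
  (exists M, forall v, in_X G D s v ->
     X_norm G D s (T v) <= M * X_norm G D s v).

Definition op_norm (G : contour) (D : nodes) (s : R)
    (T : (Gamma G -> C) -> (Gamma G -> C)) : Rbar :=
  Lub_Rbar (fun r => exists v, in_X G D s v /\ X_norm G D s v <= 1 /\
    r = X_norm G D s (T v)).

Definition inverse_on (G : contour) (D : nodes) (s : R)
    (T Tinv : (Gamma G -> C) -> (Gamma G -> C)) : Prop :=
  bounded_linear G D s T /\ bounded_linear G D s Tinv /\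
  (forall v, in_X G D s v -> Tinv (T v) = v) /\
  (forall v, in_X G D s v -> T (Tinv v) = v).

Definition kernel_regular (G : contour) (mu : R)
    (k : Gamma G -> Gamma G -> C) : Prop :=
  exists (M0 Mmu : R) (omega : R -> R),
    filterlim omega (at_right 0) (locally 0) /\
    (forall t tau, Cmod (k t tau) <= M0) /\
    (forall t s tau,
       Cmod (Cminus (k t tau) (k s tau)) <= Mmu * hpow (dist G t s) mu) /\
    (forall t tau zeta,
       Cmod (Cminus (k t tau) (k t zeta)) <= omega (dist G tau zeta)).

Definition K_op (G : contour) (k : Gamma G -> Gamma G -> C)
    (v : Gamma G -> C) : Gamma G -> C :=
  fun t => intC (fun x => Cmult (Cmult (k t (pt G x)) (v (pt G x))) (dgam G x))
                0 (2 * PI).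

Definition A_op (G : contour) (k : Gamma G -> Gamma G -> C) (lam : C)
    (v : Gamma G -> C) : Gamma G -> C :=
  fun t => Cminus (v t) (Cmult lam (K_op G k v t)).

Definition H_gen (G : contour) (D : nodes) (j : nat) (t : Gamma G) : R :=
  if Rle_dec (angle G t) (thd D j) then 0 else 1.

Definition R_gen (G : contour) (t : Gamma G) : R := angle G t / (2 * PI).

Definition G_gen (G : contour) (D : nodes) (j : nat) (t : Gamma G) : R :=
  H_gen G D j t - R_gen G t.

Definition J_part (G : contour) (D : nodes) (f : Gamma G -> C)
    : Gamma G -> C :=
  fun t => sum_n_m (fun j => Cmult (jump G D f j) (RtoC (G_gen G D j t)))
                   1 (nd D).

Definition C_part (G : contour) (D : nodes) (f : Gamma G -> C)
    : Gamma G -> C :=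
  fun t => Cminus (f t) (J_part G D f t).

Definition g_data (G : contour) (D : nodes) (k : Gamma G -> Gamma G -> C)
    (lam : C) (f : Gamma G -> C) : Gamma G -> C :=
  fun t => Cplus (C_part G D f t) (Cmult lam (K_op G k (J_part G D f) t)).

(* Centered cardinal B-spline of order [m], by the Cox-de Boor recurrence. *)
Fixpoint Bspline (m : nat) (x : R) : R :=
  match m with
  | O => 0
  | S O => if Rle_dec (- (1 / 2)) x then (if Rlt_dec x (1 / 2) then 1 else 0)
           else 0
  | S (S _ as p) =>
      ((INR m / 2 + x) * Bspline p (x + 1 / 2)
       + (INR m / 2 - x) * Bspline p (x - 1 / 2)) / INR p
  end.

Definition sumZ (a : Z -> R) : R :=
  Series (fun n => a (Z.of_nat n)) + Series (fun n => a (- Z.of_nat (S n))%Z).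

Definition step (nB : nat) : R := 2 * PI / INR nB.

(* For [0 <= rho < step nB] and [1 <= i <= nB] this already lies in
   [[0, 2 PI)], so no reduction modulo [2 PI] is needed. *)
Definition theta_B (nB : nat) (rho : R) (i : nat) : R :=
  rho + (INR i - 1) * step nB.

Definition t_B (G : contour) (nB : nat) (rho : R) (i : nat) : Gamma G :=
  pt G (theta_B nB rho i).

Definition B_fun (G : contour) (m nB : nat) (rho : R) (j : nat)
    (t : Gamma G) : R :=
  sumZ (fun l => Bspline m ((angle G t - theta_B nB rho j) / step nB
                            - IZR l * INR nB)).

Definition in_S (G : contour) (m nB : nat) (rho : R) (s : Gamma G -> C)
    : Prop :=
  exists c : nat -> C, forall t,
    s t = sum_n_m (fun j => Cmult (c j) (RtoC (B_fun G m nB rho j t))) 1 nB.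

Definition P_op (G : contour) (m nB : nat) (rho : R) (v : Gamma G -> C)
    : Gamma G -> C :=
  epsilon (inhabits v) (fun s => in_S G m nB rho s /\
    forall i, (1 <= i <= nB)%nat -> s (t_B G nB rho i) = v (t_B G nB rho i)).

Definition Ah_op (G : contour) (k : Gamma G -> Gamma G -> C) (lam : C)
    (m nB : nat) (rho : R) (v : Gamma G -> C) : Gamma G -> C :=
  fun t => Cminus (v t) (Cmult lam (P_op G m nB rho (K_op G k v) t)).

(* The second clause says that [thd j - rho] is at distance at least [eta * h]
   from the lattice [h Z], with [h = step nB]. *)
Definition admissible_phase (D : nodes) (eta : R) (nB : nat) (rho : R)
    : Prop :=
  0 <= rho < step nB /\
  forall j (z : Z), (1 <= j <= nd D)%nat ->
    eta * step nB <= Rabs (thd D j - rho - IZR z * step nB).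

(* Main.v *)
Require Import Defs.
From Stdlib Require Import Reals ZArith Arith List ClassicalEpsilon.
From Stdlib Require Import Lra Lia FunctionalExtensionality.
From Coquelicot Require Import Coquelicot.
Open Scope R_scope.

(** Fredholm theory is replaced by a stability estimate in the supremum norm.
    [K] maps functions bounded by [1] into a bounded set of [mu]-Hoelder
    functions, on which [P_h] is uniformly bounded with error [O(h^mu)].  If the
    estimate [sup |v| <= C sup |A_h v|] failed as [h -> 0], there would be
    [v_n] with [|v_n| <= 1], [sup |v_n| > 1/2] and [A_{h_n} v_n -> 0]; by
    Arzela-Ascoli a subsequence of [K v_n] converges uniformly to some [w], so
    [v_n = A_{h_n} v_n + lam P_{h_n} K v_n -> lam w] uniformly, and [lam w] is a
    Hoelder function killed by [I - lam K], hence [0]: a contradiction.  The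
    identity [v = A_h v + lam P_h K v] lifts the estimate to [X_beta].  In
    particular [A_h] is injective on the finite-dimensional space [S_h], hence
    onto, and [A_h (w + lam u) = w] when [A_h u = P_h K w] with [u] in [S_h]. *)

(** The supremum norm suits the compactness argument because [K] gains Hoelder regularity from a
    bound on [|v|] alone; the [v_n] may jump and need not be equicontinuous. Failure of the estimate
    is used in a normalised form: some [d] is such that [|v| <= 1] and [|A_h v| <= d] force
    [|v| <= 1/2] for small [h], and homogeneity turns this into [sup |v| <= (2/d) sup |A_h v|]. The
    constant is therefore not explicit. Uniformity in [h] of all bounds on [P_h] has one source: at
    the nodes a spline is given by the circulant tridiagonal matrix with entries [a], [1 - 2a], [a],
    where [a] is 0, 1/8, 1/6 for the orders 2, 3, 4. Since [2a <= 1/3] and [1 - 2a >= 2/3], its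
    inverse is bounded by 3 in the maximum norm for every number of nodes. The same bound applied to
    differences of coefficients makes [P_h] preserve Hoelder continuity. The numerical constants are
    crude; only their independence of [h] counts. To avoid cases at the cut, coefficients are
    extended periodically to [Z] and points are parametrised by all of [R]. *)

Fixpoint csum (f : nat -> C) (n : nat) : C :=
  match n with
  | O => RtoC 0
  | S p => Cplus (csum f p) (f p)
  end.

Lemma csum_S (f : nat -> C) (n : nat) : csum f (S n) = Cplus (csum f n) (f n).
Proof. reflexivity. Qed.

Lemma sum_n_m_csum (f : nat -> C) (n : nat) :
  sum_n_m f 1 n = csum (fun j => f (S j)) n.
Proof.
  induction n as [|n IH]; [now rewrite sum_n_m_zero by lia|].
  rewrite sum_n_Sm by lia. rewrite IH. reflexivity.
Qed.

Lemma csum_ext (f g : nat -> C) (n : nat) :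
  (forall j, (j < n)%nat -> f j = g j) -> csum f n = csum g n.
Proof.
  induction n as [|n IH]; intros H; simpl; [reflexivity|].
  rewrite IH by (intros; apply H; lia). now rewrite H by lia.
Qed.

Lemma csum_zero (f : nat -> C) (n : nat) :
  (forall j, (j < n)%nat -> f j = RtoC 0) -> csum f n = RtoC 0.
Proof.
  induction n as [|n IH]; intros H; simpl; [reflexivity|].
  rewrite IH by (intros; apply H; lia). rewrite H by lia. ring.
Qed.

Lemma csum_plus (f g : nat -> C) (n : nat) :
  csum (fun j => Cplus (f j) (g j)) n = Cplus (csum f n) (csum g n).
Proof. induction n as [|n IH]; simpl; [|rewrite IH]; ring. Qed.

Lemma csum_scal (a : C) (f : nat -> C) (n : nat) :
  csum (fun j => Cmult a (f j)) n = Cmult a (csum f n).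
Proof. induction n as [|n IH]; simpl; [|rewrite IH]; ring. Qed.

Lemma csum_add (f : nat -> C) (n p : nat) :
  csum f (n + p) = Cplus (csum f n) (csum (fun j => f (n + j)%nat) p).
Proof.
  induction p as [|p IH]; simpl; [rewrite Nat.add_0_r; ring|].
  rewrite Nat.add_succ_r. simpl. rewrite IH. ring.
Qed.

Lemma csum_window4 (f : nat -> C) (n r : nat) :
  (r + 4 <= n)%nat ->
  (forall j, (j < n)%nat -> ~ (r <= j < r + 4)%nat -> f j = RtoC 0) ->
  csum f n = Cplus (Cplus (Cplus (f r) (f (r + 1)%nat)) (f (r + 2)%nat))
               (f (r + 3)%nat).
Proof.
  intros Hn H. replace n with (r + 4 + (n - (r + 4)))%nat by lia.
  rewrite csum_add, csum_add.
  rewrite (csum_zero f r) by (intros; apply H; lia).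
  rewrite (csum_zero (fun j => f (r + 4 + j)%nat)) by (intros; apply H; lia).
  simpl. rewrite Nat.add_0_r. ring.
Qed.

(** * Linear systems over the complex numbers, and a contraction principle *)

Definition swap_rows (i n : nat) (a : nat -> nat -> C) : nat -> nat -> C :=
  fun r => if Nat.eq_dec r i then a n else if Nat.eq_dec r n then a i else a r.

(** Gaussian elimination by induction on the number of equations. If the last column vanishes, the
    last unit vector is a solution. Otherwise a row with nonzero last entry is moved to the bottom
    and clears that column in the other rows; the last unknown is then found from it by back
    substitution. *)
Lemma underdetermined_system (n : nat) (a : nat -> nat -> C) :
  exists c : nat -> C,
    (exists j, (j <= n)%nat /\ c j <> RtoC 0) /\
    forall i, (i < n)%nat -> csum (fun j => Cmult (a i j) (c j)) (S n) = RtoC 0.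
Proof.
  revert a. induction n as [|n IH]; intros a.
  { exists (fun _ => RtoC 1). split; [|lia]. exists O. split; [lia|].
    intros E. apply RtoC_inj in E. lra. }
  destruct (classic (exists i, (i <= n)%nat /\ a i (S n) <> RtoC 0))
    as [[i [Hi Ha]]|Hno].
  2: { exists (fun j => if Nat.eq_dec j (S n) then RtoC 1 else RtoC 0). split.
       - exists (S n). split; [lia|]. destruct (Nat.eq_dec (S n) (S n)); [|lia].
         intros E. apply RtoC_inj in E. lra.
       - intros i Hi. apply csum_zero. intros j Hj.
         destruct (Nat.eq_dec j (S n)) as [->|]; [|ring].
         destruct (Ceq_dec (a i (S n)) (RtoC 0)) as [->|E]; [ring|].
         exfalso. apply Hno. exists i. split; [lia|exact E]. }
  set (b := swap_rows i n a).
  assert (Hb : b n (S n) <> RtoC 0).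
  { unfold b, swap_rows. destruct (Nat.eq_dec n i) as [->|]; [exact Ha|].
    destruct (Nat.eq_dec n n); [exact Ha|lia]. }
  destruct (IH (fun r j => Cminus (b r j)
                  (Cmult (Cdiv (b r (S n)) (b n (S n))) (b n j))))
    as [c [[j [Hj Hcj]] Hc]].
  set (last := Copp (Cdiv (csum (fun j => Cmult (b n j) (c j)) (S n)) (b n (S n)))).
  set (d := fun j => if Nat.eq_dec j (S n) then last else c j).
  assert (Hd : forall r, csum (fun j => Cmult (b r j) (d j)) (S (S n)) =
     Cplus (csum (fun j => Cmult (b r j) (c j)) (S n)) (Cmult (b r (S n)) last)).
  { intros r. rewrite (csum_S _ (S n)). f_equal.
    - apply csum_ext. intros l Hl. unfold d. destruct (Nat.eq_dec l (S n)); [lia|easy].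
    - unfold d. destruct (Nat.eq_dec (S n) (S n)); [easy|lia]. }
  assert (Hall : forall r, (r <= n)%nat ->
     csum (fun j => Cmult (b r j) (d j)) (S (S n)) = RtoC 0).
  { intros r Hr. rewrite Hd. destruct (Nat.eq_dec r n) as [->|Hrn].
    - unfold last. field. exact Hb.
    - assert (E := Hc r ltac:(lia)).
      rewrite (csum_ext _ (fun j => Cplus (Cmult (b r j) (c j))
         (Cmult (Copp (Cdiv (b r (S n)) (b n (S n)))) (Cmult (b n j) (c j))))) in E
        by (intros; ring).
      rewrite csum_plus, csum_scal in E. rewrite <- E. unfold last. field. exact Hb. }
  exists d. split.
  - exists j. split; [lia|]. unfold d. destruct (Nat.eq_dec j (S n)); [lia|exact Hcj].
  - intros r Hr. destruct (Nat.eq_dec r i) as [->|Hri].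
    + assert (E := Hall n ltac:(lia)). unfold b, swap_rows in E.
      destruct (Nat.eq_dec n i) as [->|]; [exact E|].
      destruct (Nat.eq_dec n n); [exact E|lia].
    + destruct (Nat.eq_dec r n) as [->|Hrn].
      * assert (E := Hall i Hi). unfold b, swap_rows in E.
        destruct (Nat.eq_dec i i); [exact E|lia].
      * assert (E := Hall r ltac:(lia)). unfold b, swap_rows in E.
        destruct (Nat.eq_dec r i); [lia|]. destruct (Nat.eq_dec r n); [lia|exact E].
Qed.

(** The right-hand side becomes one more column, [- p], which leaves more unknowns than equations. A
    nonzero solution has [c n <> 0], since otherwise injectivity would make all other components
    vanish; dividing by [c n] gives the answer. *)
Lemma injective_system_solvable (n : nat) (a : nat -> nat -> C) (p : nat -> C) :
  (forall c, (forall i, (i < n)%nat ->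
       csum (fun j => Cmult (a i j) (c j)) n = RtoC 0) ->
     forall j, (j < n)%nat -> c j = RtoC 0) ->
  exists c, forall i, (i < n)%nat -> csum (fun j => Cmult (a i j) (c j)) n = p i.
Proof.
  intros Hinj.
  destruct (underdetermined_system n
     (fun i j => if Nat.eq_dec j n then Copp (p i) else a i j))
    as [c [[j [Hj Hcj]] Hc]].
  assert (E : forall i, (i < n)%nat ->
     csum (fun j => Cmult (a i j) (c j)) n = Cmult (p i) (c n)).
  { intros i Hi. assert (E := Hc i Hi). simpl in E.
    destruct (Nat.eq_dec n n); [|lia].
    rewrite (csum_ext _ (fun j => Cmult (a i j) (c j))) in E.
    - rewrite <- (Cplus_0_r (csum _ n)).
      replace (RtoC 0) with (Cplus (Cmult (Copp (p i)) (c n)) (Cmult (p i) (c n)))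
        by ring. rewrite Cplus_assoc, E. ring.
    - intros l Hl. destruct (Nat.eq_dec l n); [lia|easy]. }
  destruct (Ceq_dec (c n) (RtoC 0)) as [H0|H0].
  - exfalso. apply Hcj. destruct (Nat.eq_dec j n) as [->|]; [exact H0|].
    apply (Hinj c); [|lia]. intros i Hi. rewrite (E i Hi), H0. ring.
  - exists (fun j => Cmult (Cinv (c n)) (c j)). intros i Hi.
    rewrite (csum_ext _ (fun j => Cmult (Cinv (c n)) (Cmult (a i j) (c j))))
      by (intros; ring).
    rewrite csum_scal, (E i Hi). field. exact H0.
Qed.

(** Apply the hypothesis to the least upper bound [M] of [|f|]: then [M <= q * M + d]. The a priori
    bound [B] only makes [M] finite and leaves no trace in the result. Both the tridiagonal systems
    and the stability estimate are closed in this way. *)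
Lemma bounded_contraction {T : Type} (f : T -> C) (B q d : R) :
  0 <= q < 1 -> (forall t, Cmod (f t) <= B) ->
  (forall M, (forall t, Cmod (f t) <= M) -> forall t, Cmod (f t) <= q * M + d) ->
  forall t, Cmod (f t) <= d / (1 - q).
Proof.
  intros Hq HB H t0.
  destruct (completeness (fun r => exists t, r = Cmod (f t))) as [M [HM1 HM2]].
  - exists B. intros r [t ->]. apply HB.
  - exists (Cmod (f t0)), t0. reflexivity.
  - assert (HM : forall t, Cmod (f t) <= M) by (intros t; apply HM1; now exists t).
    assert (HM' : M <= q * M + d).
    { apply HM2. intros r [t ->]. apply H, HM. }
    apply Rle_trans with M; [apply HM|].
    apply Rmult_le_reg_r with (1 - q); [lra|].
    unfold Rdiv. rewrite Rmult_assoc, Rinv_l by lra. lra.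
Qed.

(** * Arzela-Ascoli *)

Definition infinite (P : nat -> Prop) : Prop :=
  forall N, exists n, (N <= n)%nat /\ P n.

Lemma infinite_split (P Q : nat -> Prop) :
  infinite P -> infinite (fun n => P n /\ Q n) \/ infinite (fun n => P n /\ ~ Q n).
Proof.
  intros H. destruct (classic (infinite (fun n => P n /\ Q n))) as [|Hn]; [now left|].
  right. apply not_all_ex_not in Hn. destruct Hn as [N0 HN0]. intros N.
  destruct (H (Nat.max N N0)) as [n [Hn HP]]. exists n. split; [lia|].
  split; [exact HP|]. intros HQ. apply HN0. exists n. split; [lia|easy].
Qed.

(** Repeated bisection of [[-B, B]]: one half of the current interval always contains infinitely
    many terms. *)
Lemma infinite_small_osc_real (u : nat -> R) (P : nat -> Prop) (B e : R) :
  infinite P -> (forall n, Rabs (u n) <= B) -> 0 < e ->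
  exists Q, infinite Q /\ (forall n, Q n -> P n) /\
    forall n p, Q n -> Q p -> Rabs (u n - u p) <= e.
Proof.
  intros HP HB He.
  assert (Hk : forall k, exists Q a, infinite Q /\ (forall n, Q n -> P n) /\
            forall n, Q n -> a <= u n <= a + 2 * B / 2 ^ k).
  { induction k as [|k (Q & a & HQ & HQP & Ha)].
    - exists P, (- B). split; [exact HP|]. split; [easy|]. intros n _.
      specialize (HB n). apply Rabs_le_between in HB. simpl. lra.
    - destruct (infinite_split Q (fun n => u n <= a + 2 * B / 2 ^ (S k)) HQ) as [H|H].
      + eexists _, a. split; [exact H|]. split; [intros n []; auto|].
        intros n [Hn1 Hn2]. specialize (Ha n Hn1). lra.
      + eexists _, (a + 2 * B / 2 ^ S k). split; [exact H|].
        split; [intros n []; auto|].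
        intros n [Hn1 Hn2]. specialize (Ha n Hn1).
        replace (a + 2 * B / 2 ^ S k + 2 * B / 2 ^ S k) with (a + 2 * B / 2 ^ k).
        2: { simpl. field. apply pow_nonzero. lra. }
        lra. }
  (* The [+ 1] keeps the quotient positive and finite when [B = 0]. *)
  destruct (pow_lt_1_zero (1 / 2)) with (y := e / (2 * B + 1)) as [N HN].
  { rewrite Rabs_pos_eq; lra. }
  { apply Rdiv_lt_0_compat; [lra|]. specialize (HB O).
    pose proof (Rabs_pos (u O)). lra. }
  destruct (Hk N) as (Q & a & HQ & HQP & Ha).
  exists Q. split; [exact HQ|]. split; [exact HQP|]. intros n p Hn Hp.
  assert (HB0 : 0 <= B) by (specialize (HB O); pose proof (Rabs_pos (u O)); lra).
  assert (2 * B / 2 ^ N <= e).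
  { specialize (HN N (Nat.le_refl N)).
    unfold Rdiv at 1 in HN. rewrite Rmult_1_l, pow_inv in HN.
    assert (0 < 2 ^ N) by (apply pow_lt; lra).
    rewrite Rabs_pos_eq in HN by (left; now apply Rinv_0_lt_compat).
    apply Rle_trans with ((2 * B + 1) * (e / (2 * B + 1))).
    - unfold Rdiv at 1. apply Rmult_le_compat; try lra.
      left; now apply Rinv_0_lt_compat.
    - right. field. lra. }
  specialize (Ha n Hn) as H1. specialize (Ha p Hp) as H2.
  apply Rabs_le. lra.
Qed.

Lemma Cmod_le_components (z : C) : Cmod z <= Rabs (fst z) + Rabs (snd z).
Proof.
  unfold Cmod. apply Rsqr_incr_0_var.
  - rewrite Rsqr_sqrt by nra.
    pose proof (Rabs_pos (fst z)). pose proof (Rabs_pos (snd z)).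
    unfold Rsqr. rewrite <- (pow2_abs (fst z)), <- (pow2_abs (snd z)). nra.
  - pose proof (Rabs_pos (fst z)). pose proof (Rabs_pos (snd z)). lra.
Qed.

Lemma components_le_Cmod (z : C) : Rabs (fst z) <= Cmod z /\ Rabs (snd z) <= Cmod z.
Proof.
  pose proof (Rmax_Cmod z). pose proof (Rmax_l (Rabs (fst z)) (Rabs (snd z))).
  pose proof (Rmax_r (Rabs (fst z)) (Rabs (snd z))). lra.
Qed.

Lemma infinite_small_osc (T : Type) (F : nat -> T -> C) (l : list T)
    (P : nat -> Prop) (B e : R) :
  infinite P -> (forall n t, Cmod (F n t) <= B) -> 0 < e ->
  exists Q, infinite Q /\ (forall n, Q n -> P n) /\
    forall n p t, Q n -> Q p -> In t l -> Cmod (Cminus (F n t) (F p t)) <= e.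
Proof.
  intros HP HB He. induction l as [|t l (Q & HQ & HQP & Hosc)].
  { exists P. split; [exact HP|]. split; [easy|]. intros n p t _ _ []. }
  destruct (infinite_small_osc_real (fun n => fst (F n t)) Q B (e / 2) HQ)
    as (Q1 & H1 & HQ1 & Ho1); [|lra|].
  { intros n. eapply Rle_trans; [apply components_le_Cmod|apply HB]. }
  destruct (infinite_small_osc_real (fun n => snd (F n t)) Q1 B (e / 2) H1)
    as (Q2 & H2 & HQ2 & Ho2); [|lra|].
  { intros n. eapply Rle_trans; [apply components_le_Cmod|apply HB]. }
  exists Q2. split; [exact H2|]. split; [auto|].
  intros n p t' Hn Hp [<-|Ht']; [|auto].
  eapply Rle_trans; [apply Cmod_le_components|].
  specialize (Ho1 n p (HQ2 _ Hn) (HQ2 _ Hp)). specialize (Ho2 n p Hn Hp).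
  simpl. unfold Rminus in *. lra.
Qed.

Lemma complex_cauchy_limit (u : nat -> C) :
  (forall e, 0 < e -> exists N, forall n p, (N <= n)%nat -> (N <= p)%nat ->
     Cmod (Cminus (u n) (u p)) <= e) ->
  exists w, forall e, 0 < e -> exists N, forall n, (N <= n)%nat ->
     Cmod (Cminus (u n) w) <= e.
Proof.
  intros H.
  assert (Hre : ex_finite_lim_seq (fun n => fst (u n))).
  { apply ex_lim_seq_cauchy_corr. intros e.
    destruct (H (e / 2)) as [N HN]; [destruct e; simpl; lra|].
    exists N. intros n p Hn Hp. specialize (HN n p Hn Hp).
    destruct (components_le_Cmod (Cminus (u n) (u p))) as [h _].
    simpl in h. unfold Rminus. destruct e as [e He]. simpl in *. lra. }
  assert (Him : ex_finite_lim_seq (fun n => snd (u n))).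
  { apply ex_lim_seq_cauchy_corr. intros e.
    destruct (H (e / 2)) as [N HN]; [destruct e; simpl; lra|].
    exists N. intros n p Hn Hp. specialize (HN n p Hn Hp).
    destruct (components_le_Cmod (Cminus (u n) (u p))) as [_ h].
    simpl in h. unfold Rminus. destruct e as [e He]. simpl in *. lra. }
  destruct Hre as [x Hx], Him as [y Hy].
  exists (x, y). intros e He.
  apply is_lim_seq_spec in Hx. apply is_lim_seq_spec in Hy.
  assert (He2 : 0 < e / 2) by lra.
  destruct (Hx (mkposreal _ He2)) as [N1 H1]. destruct (Hy (mkposreal _ He2)) as [N2 H2].
  exists (Nat.max N1 N2). intros n Hn.
  specialize (H1 n ltac:(lia)). specialize (H2 n ltac:(lia)). simpl in H1, H2.
  eapply Rle_trans; [apply Cmod_le_components|]. simpl. unfold Rminus in *. lra.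
Qed.

Lemma Cmod_minus_sym (z w : C) : Cmod (Cminus z w) = Cmod (Cminus w z).
Proof. rewrite <- Cmod_opp. f_equal. ring. Qed.

Lemma Cmod_minus_triangle (x y z : C) :
  Cmod (Cminus x z) <= Cmod (Cminus x y) + Cmod (Cminus y z).
Proof.
  replace (Cminus x z) with (Cplus (Cminus x y) (Cminus y z)) by ring.
  apply Cmod_triangle.
Qed.

Lemma inv_succ_small (e : R) : 0 < e ->
  exists N : nat, forall n, (N <= n)%nat -> / (INR n + 1) <= e.
Proof.
  intros He. destruct (INR_archimed 1 (/ e)) as [N HN]; [lra|].
  exists N. intros n Hn. apply le_INR in Hn.
  rewrite <- (Rinv_inv e). apply Rinv_le_contravar; [now apply Rinv_0_lt_compat|lra].
Qed.

(** The second hypothesis merges total boundedness of [T] with equicontinuity, so that [T] carries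
    no topology. Index sets are thinned so that the oscillation at stage [n] is at most [1/(n+1)]
    uniformly in [t], and [phi] is a diagonal choice. [n <= phi n] suffices to carry over whatever
    holds for all large indices. *)
Lemma arzela_ascoli (T : Type) (F : nat -> T -> C) (B : R) :
  (forall n t, Cmod (F n t) <= B) ->
  (forall e, 0 < e -> exists l : list T, forall t, exists t', In t' l /\
     forall n, Cmod (Cminus (F n t) (F n t')) <= e) ->
  exists (phi : nat -> nat) (w : T -> C),
    (forall n, (n <= phi n)%nat) /\
    forall e, 0 < e -> exists N, forall n, (N <= n)%nat ->
      forall t, Cmod (Cminus (F (phi n) t) (w t)) <= e.
Proof.
  intros HB Hnet.
  assert (Hpos : forall n, 0 < / (INR n + 1)).
  { intros n. apply Rinv_0_lt_compat. pose proof (pos_INR n). lra. }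
  (* Index sets travel together with the proof that they are infinite, which lets the recursion
     [seq] thin them again and again. *)
  assert (Hstep : forall (n : nat) (P : {P | infinite P}), exists Q : {Q | infinite Q},
     (forall i, proj1_sig Q i -> proj1_sig P i) /\
     forall i j t, proj1_sig Q i -> proj1_sig Q j ->
       Cmod (Cminus (F i t) (F j t)) <= / (INR n + 1)).
  { intros n [P HP]. specialize (Hpos n) as He. set (e := / (INR n + 1)) in *.
    destruct (Hnet (e / 3)) as [l Hl]; [lra|].
    destruct (infinite_small_osc T F l P B (e / 3) HP HB) as (Q & HQ & HQP & Ho); [lra|].
    exists (exist _ Q HQ). split; [exact HQP|]. simpl. intros i j t Hi Hj.
    destruct (Hl t) as (t' & Ht' & Hn).
    eapply Rle_trans; [apply (Cmod_minus_triangle _ (F i t'))|].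
    assert (Cmod (Cminus (F i t') (F j t)) <= e / 3 + e / 3); [|specialize (Hn i); lra].
    eapply Rle_trans; [apply (Cmod_minus_triangle _ (F j t'))|].
    apply Rplus_le_compat; [now apply Ho|]. rewrite Cmod_minus_sym. apply Hn. }
  assert (Hinf : infinite (fun _ => True)) by (intros N; exists N; split; [lia|easy]).
  set (next := fun n P => proj1_sig (constructive_indefinite_description _ (Hstep n P))).
  set (seq := fix seq n := match n with
                | O => exist infinite _ Hinf
                | S p => next p (seq p) end).
  assert (Hnext : forall n, (forall i, proj1_sig (seq (S n)) i -> proj1_sig (seq n) i) /\
     forall i j t, proj1_sig (seq (S n)) i -> proj1_sig (seq (S n)) j ->
       Cmod (Cminus (F i t) (F j t)) <= / (INR n + 1)).
  { intros n. exact (proj2_sig (constructive_indefinite_description _ (Hstep n (seq n)))). }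
  assert (Hdec : forall n p i, (n <= p)%nat -> proj1_sig (seq p) i -> proj1_sig (seq n) i).
  { intros n p i Hnp. induction Hnp as [|p Hnp IH]; [easy|].
    intros Hi. apply IH, Hnext, Hi. }
  assert (Hphi : forall n, exists i, (n <= i)%nat /\ proj1_sig (seq (S n)) i)
    by (intros n; apply (proj2_sig (seq (S n)))).
  set (phi := fun n => proj1_sig (constructive_indefinite_description _ (Hphi n))).
  assert (Hphi' : forall n, (n <= phi n)%nat /\ proj1_sig (seq (S n)) (phi n))
    by (intros n; exact (proj2_sig (constructive_indefinite_description _ (Hphi n)))).
  assert (Hcau : forall N n p t, (N <= n)%nat -> (N <= p)%nat ->
     Cmod (Cminus (F (phi n) t) (F (phi p) t)) <= / (INR N + 1)).
  { intros N n p t Hn Hp. apply Hnext; eapply Hdec;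
      [|apply Hphi'| |apply Hphi']; lia. }
  assert (Hw : forall t, exists w, forall e, 0 < e -> exists N, forall n, (N <= n)%nat ->
     Cmod (Cminus (F (phi n) t) w) <= e).
  { intros t. apply complex_cauchy_limit. intros e He.
    destruct (inv_succ_small e He) as [N HN]. exists N. intros n p Hn Hp.
    eapply Rle_trans; [apply (Hcau N); lia|]. apply HN. lia. }
  exists phi, (fun t => proj1_sig (constructive_indefinite_description _ (Hw t))).
  split; [intros n; apply Hphi'|].
  intros e He. destruct (inv_succ_small (e / 2)) as [N HN]; [lra|].
  exists N. intros n Hn t.
  destruct (constructive_indefinite_description _ (Hw t)) as [w Hwt]. simpl.
  destruct (Hwt (e / 2)) as [N' HN']; [lra|].
  eapply Rle_trans; [apply (Cmod_minus_triangle _ (F (phi (Nat.max N N')) t))|].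
  specialize (HN' (Nat.max N N') ltac:(lia)).
  specialize (Hcau N n (Nat.max N N') t Hn ltac:(lia)).
  specialize (HN N (Nat.le_refl N)). lra.
Qed.

(** * Cardinal B-splines *)

Lemma Bspline2_eq (x : R) : Bspline 2 x = Rmax 0 (1 - Rabs x).
Proof.
  simpl. unfold Rmax, Rabs. destruct (Rcase_abs x);
  repeat match goal with |- context [Rle_dec ?a ?b] => destruct (Rle_dec a b)
  | |- context [Rlt_dec ?a ?b] => destruct (Rlt_dec a b) end; lra.
Qed.

(** Each affine factor is written in the argument of its own lower-order spline, the form to which
    [lipschitz_mul_affine] applies. *)
Lemma Bspline3_eq (x : R) :
  Bspline 3 x = ((1 + (x + 1 / 2)) * Bspline 2 (x + 1 / 2)
                 + (1 - (x - 1 / 2)) * Bspline 2 (x - 1 / 2)) / 2.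
Proof.
  change (Bspline 3 x) with ((((1 + 1 + 1) / 2 + x) * Bspline 2 (x + 1 / 2)
                 + ((1 + 1 + 1) / 2 - x) * Bspline 2 (x - 1 / 2)) / (1 + 1)).
  lra.
Qed.

Lemma Bspline4_eq (x : R) :
  Bspline 4 x = ((3 / 2 + (x + 1 / 2)) * Bspline 3 (x + 1 / 2)
                 + (3 / 2 - (x - 1 / 2)) * Bspline 3 (x - 1 / 2)) / 3.
Proof.
  change (Bspline 4 x) with ((((1 + 1 + 1 + 1) / 2 + x) * Bspline 3 (x + 1 / 2)
                 + ((1 + 1 + 1 + 1) / 2 - x) * Bspline 3 (x - 1 / 2)) / (1 + 1 + 1)).
  lra.
Qed.

Lemma Bspline2_supp (x : R) : 1 <= Rabs x -> Bspline 2 x = 0.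
Proof. intros H. rewrite Bspline2_eq. apply Rmax_left. lra. Qed.

Lemma Bspline3_supp (x : R) : 3 / 2 <= Rabs x -> Bspline 3 x = 0.
Proof.
  intros H. rewrite Bspline3_eq, !Bspline2_supp; [lra| |];
    revert H; unfold Rabs; repeat destruct (Rcase_abs _); lra.
Qed.

Lemma Bspline4_supp (x : R) : 2 <= Rabs x -> Bspline 4 x = 0.
Proof.
  intros H. rewrite Bspline4_eq, !Bspline3_supp; [lra| |];
    revert H; unfold Rabs; repeat destruct (Rcase_abs _); lra.
Qed.

(** Product rule: on the support the affine factor is at most [2w], and [|N|] is at most [2wL]
    because [N] vanishes at [w]; the two contributions add up to [4wL]. If one point leaves the
    support, its value is zero and the first contribution suffices. *)
Lemma lipschitz_mul_affine (N : R -> R) (w L s : R) :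
  0 <= L -> 0 < w -> s = 1 \/ s = -1 ->
  (forall x, w <= Rabs x -> N x = 0) ->
  (forall x y, Rabs (N x - N y) <= L * Rabs (x - y)) ->
  forall x y, Rabs ((w + s * x) * N x - (w + s * y) * N y)
                <= 4 * w * L * Rabs (x - y).
Proof.
  intros HL Hw Hs Hsupp Hlip.
  assert (Hin : forall x y, Rabs x <= w -> Rabs ((w + s * x) * N x - (w + s * y) * N y)
                <= 4 * w * L * Rabs (x - y)).
  { intros x y Hx.
    destruct (Rle_lt_dec (Rabs y) w) as [Hy|Hy].
    - replace ((w + s * x) * N x - (w + s * y) * N y) with
        ((w + s * y) * (N x - N y) + s * (x - y) * N x) by ring.
      eapply Rle_trans; [apply Rabs_triang|]. rewrite !Rabs_mult.
      assert (H1 : Rabs (w + s * y) <= 2 * w).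
      { apply Rabs_le. apply Rabs_le_between in Hy. destruct Hs as [-> | ->]; lra. }
      assert (H2 : Rabs s = 1).
      { destruct Hs as [-> | ->]; unfold Rabs; destruct (Rcase_abs _); lra. }
      assert (H3 : Rabs (N x) <= L * (2 * w)).
      { replace (N x) with (N x - N w).
        2: { rewrite (Hsupp w); [lra|]. rewrite Rabs_pos_eq; lra. }
        eapply Rle_trans; [apply Hlip|]. apply Rmult_le_compat_l; [lra|].
        apply Rabs_le. apply Rabs_le_between in Hx. lra. }
      rewrite H2, Rmult_1_l.
      pose proof (Hlip x y) as H4. pose proof (Rabs_pos (N x - N y)).
      pose proof (Rabs_pos (x - y)). pose proof (Rabs_pos (w + s * y)).
      assert (Rabs (w + s * y) * Rabs (N x - N y) <= 2 * w * (L * Rabs (x - y)))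
        by (apply Rmult_le_compat; lra).
      assert (Rabs (x - y) * Rabs (N x) <= Rabs (x - y) * (L * (2 * w)))
        by (apply Rmult_le_compat_l; lra).
      lra.
    - rewrite (Hsupp y) in * by lra.
      replace ((w + s * x) * N x - (w + s * y) * 0) with ((w + s * x) * N x) by ring.
      rewrite Rabs_mult.
      assert (H1 : Rabs (w + s * x) <= 2 * w).
      { apply Rabs_le. apply Rabs_le_between in Hx. destruct Hs as [-> | ->]; lra. }
      pose proof (Hlip x y) as H4. rewrite (Hsupp y), Rminus_0_r in H4 by lra.
      pose proof (Rabs_pos (N x)). pose proof (Rabs_pos (w + s * x)).
      pose proof (Rabs_pos (x - y)).
      assert (Rabs (w + s * x) * Rabs (N x) <= 2 * w * (L * Rabs (x - y)))
        by (apply Rmult_le_compat; lra).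
      assert (0 <= w * L * Rabs (x - y)) by (repeat apply Rmult_le_pos; lra).
      lra. }
  intros x y. destruct (Rle_lt_dec (Rabs x) w) as [Hx|Hx]; [now apply Hin|].
  destruct (Rle_lt_dec (Rabs y) w) as [Hy|Hy].
  - rewrite Rabs_minus_sym, (Rabs_minus_sym x y). now apply Hin.
  - rewrite !Hsupp, !Rmult_0_r, Rminus_0_r, Rabs_R0 by lra.
    pose proof (Rabs_pos (x - y)). repeat apply Rmult_le_pos; lra.
Qed.

(** The denominator [d >= 2] of the recurrence absorbs the sum of the two terms, so the constant
    does not grow. *)
Lemma lipschitz_two_terms (f g : R -> R) (K d : R) :
  2 <= d ->
  (forall x y, Rabs (f x - f y) <= K * Rabs (x - y)) ->
  (forall x y, Rabs (g x - g y) <= K * Rabs (x - y)) ->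
  forall x y, Rabs ((f (x + 1 / 2) + g (x - 1 / 2)) / d
                    - (f (y + 1 / 2) + g (y - 1 / 2)) / d) <= K * Rabs (x - y).
Proof.
  intros Hd Hf Hg x y.
  specialize (Hf (x + 1 / 2) (y + 1 / 2)). specialize (Hg (x - 1 / 2) (y - 1 / 2)).
  replace (x + 1 / 2 - (y + 1 / 2)) with (x - y) in Hf by ring.
  replace (x - 1 / 2 - (y - 1 / 2)) with (x - y) in Hg by ring.
  replace ((f (x + 1 / 2) + g (x - 1 / 2)) / d - (f (y + 1 / 2) + g (y - 1 / 2)) / d)
    with (((f (x + 1 / 2) - f (y + 1 / 2)) + (g (x - 1 / 2) - g (y - 1 / 2))) * / d)
    by (field; lra).
  rewrite Rabs_mult, (Rabs_pos_eq (/ d)) by (left; apply Rinv_0_lt_compat; lra).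
  set (a := f (x + 1 / 2) - f (y + 1 / 2)) in *.
  set (b := g (x - 1 / 2) - g (y - 1 / 2)) in *.
  pose proof (Rabs_triang a b). pose proof (Rabs_pos (a + b)).
  assert (Hi : 0 < / d <= / 2).
  { split; [apply Rinv_0_lt_compat; lra|apply Rinv_le_contravar; lra]. }
  apply Rle_trans with (Rabs (a + b) * / 2); [apply Rmult_le_compat_l; lra|lra].
Qed.

Lemma Bspline2_lipschitz (x y : R) : Rabs (Bspline 2 x - Bspline 2 y) <= 1 * Rabs (x - y).
Proof.
  rewrite !Bspline2_eq. unfold Rmax.
  repeat destruct (Rle_dec _ _); unfold Rabs in *;
    repeat destruct (Rcase_abs _); lra.
Qed.

Lemma Bspline3_lipschitz (x y : R) : Rabs (Bspline 3 x - Bspline 3 y) <= 4 * Rabs (x - y).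
Proof.
  rewrite !Bspline3_eq.
  apply (lipschitz_two_terms (fun z => (1 + z) * Bspline 2 z)
           (fun z => (1 - z) * Bspline 2 z)); [lra| |].
  - intros u v. replace (1 + u) with (1 + 1 * u) by ring.
    replace (1 + v) with (1 + 1 * v) by ring.
    replace 4 with (4 * 1 * 1) by ring.
    apply lipschitz_mul_affine; auto using Bspline2_supp, Bspline2_lipschitz; lra.
  - intros u v. replace (1 - u) with (1 + -1 * u) by ring.
    replace (1 - v) with (1 + -1 * v) by ring.
    replace 4 with (4 * 1 * 1) by ring.
    apply lipschitz_mul_affine; auto using Bspline2_supp, Bspline2_lipschitz; lra.
Qed.

(** 24 is [4 w L] for the half-width [w = 3/2] and the Lipschitz constant [L = 4] of [Bspline 3]. *)
Lemma Bspline4_lipschitz (x y : R) : Rabs (Bspline 4 x - Bspline 4 y) <= 24 * Rabs (x - y).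
Proof.
  rewrite !Bspline4_eq.
  apply (lipschitz_two_terms (fun z => (3 / 2 + z) * Bspline 3 z)
           (fun z => (3 / 2 - z) * Bspline 3 z)); [lra| |].
  - intros u v. replace (3 / 2 + u) with (3 / 2 + 1 * u) by ring.
    replace (3 / 2 + v) with (3 / 2 + 1 * v) by ring.
    replace 24 with (4 * (3 / 2) * 4) by field.
    apply lipschitz_mul_affine; auto using Bspline3_supp, Bspline3_lipschitz; lra.
  - intros u v. replace (3 / 2 - u) with (3 / 2 + -1 * u) by ring.
    replace (3 / 2 - v) with (3 / 2 + -1 * v) by ring.
    replace 24 with (4 * (3 / 2) * 4) by field.
    apply lipschitz_mul_affine; auto using Bspline3_supp, Bspline3_lipschitz; lra.
Qed.

(** This is all that is used of the B-splines, with support and Lipschitz constant enlarged to those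
    of order 4, so that the three orders are treated at once. The translates in [kernel_unity] are
    the four that can meet a cell. [a] is the value at the neighbouring nodes, and [a <= 1/6] is
    what makes the interpolation matrix diagonally dominant. *)
Record spline_kernel (N : R -> R) (a : R) : Prop := {
  kernel_supp : forall x, 2 <= Rabs x -> N x = 0;
  kernel_unity : forall u, 0 <= u <= 1 -> N (u + 1) + N u + N (u - 1) + N (u - 2) = 1;
  kernel_lip : forall x y, Rabs (N x - N y) <= 24 * Rabs (x - y);
  kernel_pos1 : N 1 = a;
  kernel_neg1 : N (-1) = a;
  kernel_small : 0 <= a <= 1 / 6
}.

Lemma Bspline2_unity (u : R) : 0 <= u <= 1 -> Bspline 2 u + Bspline 2 (u - 1) = 1.
Proof.
  intros Hu. rewrite !Bspline2_eq. rewrite (Rabs_pos_eq u) by lra.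
  rewrite (Rabs_left1 (u - 1)) by lra. rewrite !Rmax_right by lra. lra.
Qed.

Lemma Bspline2_kernel : spline_kernel (Bspline 2) 0.
Proof.
  split.
  - intros x Hx. apply Bspline2_supp. lra.
  - intros u Hu. rewrite (Bspline2_supp (u + 1)), (Bspline2_supp (u - 2)).
    + pose proof (Bspline2_unity u Hu). lra.
    + rewrite Rabs_left1; lra.
    + rewrite Rabs_pos_eq; lra.
  - intros x y. pose proof (Bspline2_lipschitz x y). pose proof (Rabs_pos (x - y)). lra.
  - apply Bspline2_supp. rewrite Rabs_pos_eq; lra.
  - apply Bspline2_supp. rewrite Rabs_left1; lra.
  - lra.
Qed.

(** Each translate of [Bspline 2] occurs in two neighbouring terms of the sum, and its two affine
    factors add up to 2, the denominator of the recurrence. The sum thus reduces to the partition of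
    unity of the lower order. *)
Lemma Bspline3_unity (u : R) : 0 <= u <= 1 ->
  Bspline 3 (u + 1) + Bspline 3 u + Bspline 3 (u - 1) + Bspline 3 (u - 2) = 1.
Proof.
  intros Hu. rewrite !Bspline3_eq.
  replace (u + 1 - 1 / 2) with (u + 1 / 2) by field.
  replace (u - 1 + 1 / 2) with (u - 1 / 2) by field.
  replace (u - 1 - 1 / 2) with (u - 3 / 2) by field.
  replace (u - 2 + 1 / 2) with (u - 3 / 2) by field.
  rewrite (Bspline2_supp (u + 1 + 1 / 2)) by (rewrite Rabs_pos_eq; lra).
  rewrite (Bspline2_supp (u - 2 - 1 / 2)) by (rewrite Rabs_left1; lra).
  assert (Bspline 2 (u + 1 / 2) + Bspline 2 (u - 1 / 2) + Bspline 2 (u - 3 / 2) = 1);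
    [|lra].
  destruct (Rle_lt_dec u (1 / 2)) as [H|H].
  - rewrite (Bspline2_supp (u - 3 / 2)) by (rewrite Rabs_left1; lra).
    pose proof (Bspline2_unity (u + 1 / 2) ltac:(lra)) as E.
    replace (u + 1 / 2 - 1) with (u - 1 / 2) in E by field. lra.
  - rewrite (Bspline2_supp (u + 1 / 2)) by (rewrite Rabs_pos_eq; lra).
    pose proof (Bspline2_unity (u - 1 / 2) ltac:(lra)) as E.
    replace (u - 1 / 2 - 1) with (u - 3 / 2) in E by field. lra.
Qed.

Lemma Bspline2_at0 : Bspline 2 0 = 1.
Proof. rewrite Bspline2_eq, Rabs_R0, Rmax_right; lra. Qed.

Lemma Bspline2_at1 : Bspline 2 1 = 0.
Proof. apply Bspline2_supp. rewrite Rabs_pos_eq; lra. Qed.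

Lemma Bspline2_atm1 : Bspline 2 (-1) = 0.
Proof. apply Bspline2_supp. rewrite Rabs_left1; lra. Qed.

Lemma Bspline3_kernel : spline_kernel (Bspline 3) (1 / 8).
Proof.
  split.
  - intros x Hx. apply Bspline3_supp. lra.
  - apply Bspline3_unity.
  - intros x y. pose proof (Bspline3_lipschitz x y). pose proof (Rabs_pos (x - y)). lra.
  - rewrite Bspline3_eq, !Bspline2_eq.
    rewrite (Rabs_pos_eq (1 + 1 / 2)), (Rabs_pos_eq (1 - 1 / 2)) by lra.
    rewrite Rmax_left, Rmax_right by lra. field.
  - rewrite Bspline3_eq, !Bspline2_eq.
    rewrite (Rabs_left1 (-1 + 1 / 2)), (Rabs_left1 (-1 - 1 / 2)) by lra.
    rewrite Rmax_right, Rmax_left by lra. field.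
  - lra.
Qed.

Lemma Bspline4_kernel : spline_kernel (Bspline 4) (1 / 6).
Proof.
  split.
  - apply Bspline4_supp.
  - intros u Hu. rewrite !Bspline4_eq.
    replace (u + 1 - 1 / 2) with (u + 1 / 2) by field.
    replace (u - 1 + 1 / 2) with (u - 1 / 2) by field.
    replace (u - 1 - 1 / 2) with (u - 3 / 2) by field.
    replace (u - 2 + 1 / 2) with (u - 3 / 2) by field.
    rewrite (Bspline3_supp (u + 1 + 1 / 2)) by (rewrite Rabs_pos_eq; lra).
    rewrite (Bspline3_supp (u - 2 - 1 / 2)) by (rewrite Rabs_left1; lra).
    assert (Bspline 3 (u + 1 / 2) + Bspline 3 (u - 1 / 2) + Bspline 3 (u - 3 / 2) = 1);
      [|lra].
    rewrite !Bspline3_eq.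
    replace (u + 1 / 2 + 1 / 2) with (u + 1) by field.
    replace (u + 1 / 2 - 1 / 2) with u by field.
    replace (u - 1 / 2 + 1 / 2) with u by field.
    replace (u - 1 / 2 - 1 / 2) with (u - 1) by field.
    replace (u - 3 / 2 + 1 / 2) with (u - 1) by field.
    replace (u - 3 / 2 - 1 / 2) with (u - 2) by field.
    rewrite (Bspline2_supp (u + 1)) by (rewrite Rabs_pos_eq; lra).
    rewrite (Bspline2_supp (u - 2)) by (rewrite Rabs_left1; lra).
    pose proof (Bspline2_unity u Hu). lra.
  - intros x y. apply Bspline4_lipschitz.
  - rewrite Bspline4_eq, (Bspline3_supp (1 + 1 / 2)) by (rewrite Rabs_pos_eq; lra).
    rewrite Bspline3_eq.
    replace (1 - 1 / 2 + 1 / 2) with 1 by field.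
    replace (1 - 1 / 2 - 1 / 2) with 0 by field.
    rewrite Bspline2_at0, Bspline2_at1. field.
  - rewrite Bspline4_eq, (Bspline3_supp (-1 - 1 / 2)) by (rewrite Rabs_left1; lra).
    rewrite Bspline3_eq.
    replace (-1 + 1 / 2 + 1 / 2) with 0 by field.
    replace (-1 + 1 / 2 - 1 / 2) with (-1) by field.
    rewrite Bspline2_at0, Bspline2_atm1. field.
  - lra.
Qed.

Lemma Bspline_kernel (m : nat) :
  m = 2%nat \/ m = 3%nat \/ m = 4%nat -> exists a, spline_kernel (Bspline m) a.
Proof.
  intros [-> | [-> | ->]]; eexists;
    [apply Bspline2_kernel|apply Bspline3_kernel|apply Bspline4_kernel].
Qed.

Lemma kernel_at0 (N : R -> R) (a : R) : spline_kernel N a -> N 0 = 1 - 2 * a.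
Proof.
  intros H. pose proof (kernel_unity N a H 0 ltac:(lra)) as E.
  replace (0 + 1) with 1 in E by ring. replace (0 - 1) with (-1) in E by ring.
  rewrite (kernel_supp N a H (0 - 2)) in E by (rewrite Rabs_left1; lra).
  rewrite (kernel_pos1 N a H), (kernel_neg1 N a H) in E. lra.
Qed.

(** 96 is 24 times 4: inside the support [x] is compared with the point 2, where [N] vanishes. *)
Lemma kernel_bound (N : R -> R) (a x : R) : spline_kernel N a -> Rabs (N x) <= 96.
Proof.
  intros H. destruct (Rle_lt_dec 2 (Rabs x)) as [Hx|Hx].
  - rewrite (kernel_supp N a H x Hx), Rabs_R0. lra.
  - pose proof (kernel_lip N a H x 2) as E.
    rewrite (kernel_supp N a H 2), Rminus_0_r in E by (rewrite Rabs_pos_eq; lra).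
    assert (Rabs (x - 2) <= 4).
    { apply Rabs_le. apply Rabs_lt_between in Hx. lra. }
    lra.
Qed.

(** * Points of the contour *)

Lemma gam_period_Z (G : contour) (x : R) (k : Z) : gam G (x + IZR k * (2 * PI)) = gam G x.
Proof.
  assert (Hn : forall (n : nat) y, gam G (y + INR n * (2 * PI)) = gam G y).
  { induction n as [|n IH]; intros y; [f_equal; simpl; ring|].
    rewrite S_INR. replace (y + (INR n + 1) * (2 * PI))
      with (y + INR n * (2 * PI) + 2 * PI) by ring.
    rewrite gam_per. apply IH. }
  destruct (Z_le_gt_dec 0 k) as [Hk|Hk].
  - rewrite <- (Z2Nat.id k Hk), <- INR_IZR_INZ. apply Hn.
  - rewrite <- (Hn (Z.to_nat (- k)) (x + IZR k * (2 * PI))). f_equal.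
    rewrite INR_IZR_INZ, Z2Nat.id by lia. rewrite opp_IZR. ring.
Qed.

(** Points of the subtype over the same complex number differ only in their membership proofs. *)
Lemma pt_eq (G : contour) (x y : R) : gam G x = gam G y -> pt G x = pt G y.
Proof.
  intros E. unfold pt. generalize (ex_intro (fun z => gam G z = gam G x) x eq_refl).
  rewrite E. intros p. f_equal. apply Classical_Prop.proof_irrelevance.
Qed.

Lemma pt_period_Z (G : contour) (x : R) (k : Z) : pt G (x + IZR k * (2 * PI)) = pt G x.
Proof. apply pt_eq, gam_period_Z. Qed.

Lemma pt_period (G : contour) (x : R) : pt G (x + 2 * PI) = pt G x.
Proof. apply pt_eq, gam_per. Qed.

Lemma pt_surj (G : contour) (t : Gamma G) : exists x, pt G x = t.
Proof. destruct t as [z [x E]]. exists x. subst z. reflexivity. Qed.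

Lemma mod_2PI (x : R) : exists k : Z, 0 <= x - IZR k * (2 * PI) < 2 * PI.
Proof.
  pose proof PI_RGT_0 as HPI.
  destruct (archimed (x / (2 * PI))) as [H1 H2].
  exists (up (x / (2 * PI)) - 1)%Z. rewrite minus_IZR.
  set (u := IZR (up (x / (2 * PI)))) in *.
  assert (E : x = x / (2 * PI) * (2 * PI)) by (field; lra).
  set (q := x / (2 * PI)) in *. rewrite E. split; nra.
Qed.

Lemma pt_surj_range (G : contour) (t : Gamma G) : exists x, 0 <= x < 2 * PI /\ pt G x = t.
Proof.
  destruct (pt_surj G t) as [x <-]. destruct (mod_2PI x) as [k Hk].
  exists (x - IZR k * (2 * PI)). split; [exact Hk|].
  rewrite <- (pt_period_Z G _ k). f_equal. ring.
Qed.

Lemma pt_inj (G : contour) (x y : R) :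
  0 <= x < 2 * PI -> 0 <= y < 2 * PI -> pt G x = pt G y -> x = y.
Proof. intros Hx Hy E. apply (gam_inj G x y Hx Hy). now injection E. Qed.

Lemma angle_spec (G : contour) (t : Gamma G) :
  0 <= angle G t < 2 * PI /\ pt G (angle G t) = t.
Proof.
  unfold angle. apply epsilon_spec. destruct (pt_surj_range G t) as [x Hx].
  now exists x.
Qed.

Lemma angle_pt (G : contour) (x : R) : 0 <= x < 2 * PI -> angle G (pt G x) = x.
Proof.
  intros Hx. destruct (angle_spec G (pt G x)) as [H1 H2]. now apply (pt_inj G).
Qed.

(** * Periodic splines *)

Lemma step_pos (nB : nat) : (4 <= nB)%nat -> 0 < step nB.
Proof.
  intros H. unfold step. apply Rdiv_lt_0_compat; [pose proof PI_RGT_0; lra|].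
  apply lt_0_INR. lia.
Qed.

Lemma step_mul (nB : nat) : (4 <= nB)%nat -> INR nB * step nB = 2 * PI.
Proof. intros H. unfold step. field. apply not_0_INR. lia. Qed.

Lemma Series_finite (a : nat -> R) (n : nat) :
  (forall p, (n < p)%nat -> a p = 0) -> Series a = sum_n a n.
Proof.
  intros H. apply is_series_unique. unfold is_series.
  apply (filterlim_ext_loc (fun _ => sum_n a n)); [|apply filterlim_const].
  exists n. intros p Hp. induction Hp as [|p Hp IH]; [reflexivity|].
  rewrite sum_Sn, <- IH, H by lia. symmetry. exact (Rplus_0_r _).
Qed.

(** Only the periods -1, 0, 1 survive: [|y| < INR nB] and [nB >= 4], so any further period puts the
    argument at distance more than [nB] from 0, outside the support. *)
Lemma B_fun_pt (G : contour) (m nB : nat) (a r : R) (j : nat) (x : R) :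
  spline_kernel (Bspline m) a -> (4 <= nB)%nat -> 0 <= r < step nB ->
  (j < nB)%nat -> 0 <= x < 2 * PI ->
  let y := (x - r) / step nB - INR j in
  B_fun G m nB r (S j) (pt G x)
    = Bspline m (y + INR nB) + Bspline m y + Bspline m (y - INR nB).
Proof.
  intros HK HnB Hr Hj Hx y. pose proof (step_pos nB HnB) as Hh.
  pose proof (step_mul nB HnB) as Hm.
  assert (Hy : - INR nB < y < INR nB).
  { unfold y. set (q := (x - r) / step nB).
    assert (Eq : x - r = q * step nB) by (unfold q; field; lra).
    apply lt_INR in Hj as Hj'. pose proof (pos_INR j).
    assert (Hj2 : INR j <= INR nB - 1).
    { apply le_INR in Hj. rewrite S_INR in Hj. lra. }
    split; apply Rmult_lt_reg_r with (step nB); try lra; nra. }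
  assert (HnB' : 4 <= INR nB) by (apply le_INR in HnB; simpl in HnB; lra).
  unfold B_fun. rewrite angle_pt by exact Hx.
  assert (Ey : (x - theta_B nB r (S j)) / step nB = y).
  { unfold y, theta_B. rewrite S_INR. field. lra. }
  rewrite Ey. unfold sumZ.
  (* [sumZ] lists the negative periods from -1 on, so the first series keeps the indices 0 and 1 and
     the second only its index 0. *)
  rewrite (Series_finite _ 1), (Series_finite _ 0).
  - rewrite sum_Sn, !sum_O. unfold plus; simpl.
    replace (y - 0 * INR nB) with y by ring.
    replace (y - 1 * INR nB) with (y - INR nB) by ring.
    replace (y - -1 * INR nB) with (y + INR nB) by ring. ring.
  - intros p Hp. apply (kernel_supp _ _ HK).
    rewrite opp_IZR, <- INR_IZR_INZ.
    assert (2 <= INR (S p)) by (replace 2 with (INR 2) by reflexivity; apply le_INR; lia).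
    rewrite Rabs_pos_eq; nra.
  - intros p Hp. apply (kernel_supp _ _ HK). rewrite <- INR_IZR_INZ.
    assert (2 <= INR p) by (replace 2 with (INR 2) by reflexivity; apply le_INR; lia).
    rewrite Rabs_left1; nra.
Qed.

(** Coefficients are numbered from 1 to [nB] in [in_S], hence the successor. Extending them
    periodically to [Z] removes the case distinction at the cut. *)
Definition periodic_coef (nB : nat) (c : nat -> C) (z : Z) : C :=
  c (S (Z.to_nat (z mod Z.of_nat nB))).

Lemma periodic_coef_shift (nB : nat) (c : nat -> C) (z k : Z) :
  (4 <= nB)%nat -> periodic_coef nB c (z + k * Z.of_nat nB) = periodic_coef nB c z.
Proof. intros H. unfold periodic_coef. now rewrite Z_mod_plus_full. Qed.

Lemma periodic_coef_nat (nB : nat) (c : nat -> C) (j : nat) :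
  (j < nB)%nat -> periodic_coef nB c (Z.of_nat j) = c (S j).
Proof.
  intros H. unfold periodic_coef. rewrite Z.mod_small by lia. now rewrite Nat2Z.id.
Qed.

Definition spline (G : contour) (m nB : nat) (r : R) (c : nat -> C) (t : Gamma G) : C :=
  sum_n_m (fun j => Cmult (c j) (RtoC (B_fun G m nB r j t))) 1 nB.

(* [x] is unrestricted and the cell closed at both ends: adjacent cells share
   their node, also across the cut. *)
Lemma spline_local (G : contour) (m nB : nat) (a r : R) (c : nat -> C) (x : R) (i : Z) :
  spline_kernel (Bspline m) a -> (4 <= nB)%nat -> 0 <= r < step nB ->
  let u := (x - r) / step nB - IZR i in
  0 <= u <= 1 ->
  spline G m nB r c (pt G x) =
    Cplus (Cplus (Cplus
      (Cmult (periodic_coef nB c (i - 1)) (RtoC (Bspline m (u + 1))))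
      (Cmult (periodic_coef nB c i) (RtoC (Bspline m u))))
      (Cmult (periodic_coef nB c (i + 1)) (RtoC (Bspline m (u - 1)))))
      (Cmult (periodic_coef nB c (i + 2)) (RtoC (Bspline m (u - 2)))).
Proof.
  intros HK HnB Hr. pose proof (step_pos nB HnB) as Hh.
  pose proof (step_mul nB HnB) as Hm.
  assert (HnB' : 4 <= INR nB) by (apply le_INR in HnB; simpl in HnB; lra).
  assert (Hbase : forall (x : R) (i : Z), 0 <= x < 2 * PI ->
    let u := (x - r) / step nB - IZR i in 0 <= u <= 1 ->
    spline G m nB r c (pt G x) =
    Cplus (Cplus (Cplus
      (Cmult (periodic_coef nB c (i - 1)) (RtoC (Bspline m (u + 1))))
      (Cmult (periodic_coef nB c i) (RtoC (Bspline m u))))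
      (Cmult (periodic_coef nB c (i + 1)) (RtoC (Bspline m (u - 1)))))
      (Cmult (periodic_coef nB c (i + 2)) (RtoC (Bspline m (u - 2))))).
  { clear x i. intros x i Hx u Hu. unfold spline. rewrite sum_n_m_csum.
    set (q := (x - r) / step nB) in *.
    assert (Eq : x - r = q * step nB) by (unfold q; field; lra).
    assert (Hq : -1 < q < INR nB).
    { split; apply Rmult_lt_reg_r with (step nB); nra. }
    (* The cell -1 does occur: it contains the points between the cut and the first node. *)
    assert (Hi : (-1 <= i <= Z.of_nat nB - 1)%Z).
    { split.
      - assert (IZR (-2) < IZR i) by (unfold u in Hu; simpl; lra).
        apply lt_IZR in H. lia.
      - assert (IZR i < IZR (Z.of_nat nB)) by (rewrite <- INR_IZR_INZ; unfold u in Hu; lra).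
        apply lt_IZR in H. lia. }
    (* The three periods are merged into one sum over [3 * nB] consecutive integers [z], starting at
       [- nB]. In this sum only the four consecutive values from [i - 1] to [i + 2] can meet the
       support. *)
    set (g := fun p : nat => let z := (Z.of_nat p - Z.of_nat nB)%Z in
        Cmult (periodic_coef nB c z) (RtoC (Bspline m (q - IZR z)))).
    assert (Eg : forall p, periodic_coef nB c (Z.of_nat (nB + p) - Z.of_nat nB)
                           = periodic_coef nB c (Z.of_nat p)).
    { intros p. f_equal. lia. }
    rewrite (csum_ext _ (fun j => Cplus (Cplus (g j) (g (nB + j)%nat))
                                        (g (nB + (nB + j))%nat))).
    2: { intros j Hj. rewrite (B_fun_pt G m nB a r j x HK HnB Hr Hj Hx).
         fold q. unfold g.
         replace (Z.of_nat j - Z.of_nat nB)%Z with (Z.of_nat j + -1 * Z.of_nat nB)%Z by lia.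
         rewrite periodic_coef_shift by exact HnB.
         replace (Z.of_nat (nB + j) - Z.of_nat nB)%Z with (Z.of_nat j) by lia.
         replace (Z.of_nat (nB + (nB + j)) - Z.of_nat nB)%Z
           with (Z.of_nat j + 1 * Z.of_nat nB)%Z by lia.
         rewrite periodic_coef_shift by exact HnB.
         rewrite !periodic_coef_nat by exact Hj.
         rewrite !plus_IZR, !mult_IZR, <- !INR_IZR_INZ.
         replace (q - (INR j + -1 * INR nB)) with (q - INR j + INR nB) by ring.
         replace (q - (INR j + 1 * INR nB)) with (q - INR j - INR nB) by ring.
         rewrite !RtoC_plus. ring. }
    rewrite csum_plus, csum_plus.
    transitivity (csum g (nB + (nB + nB))).
    { rewrite csum_add, (csum_add _ nB nB). ring. }
    rewrite (csum_window4 _ _ (Z.to_nat (i - 1 + Z.of_nat nB))).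
    - unfold g.
      replace (Z.of_nat (Z.to_nat (i - 1 + Z.of_nat nB)) - Z.of_nat nB)%Z
        with (i - 1)%Z by lia.
      replace (Z.of_nat (Z.to_nat (i - 1 + Z.of_nat nB) + 1) - Z.of_nat nB)%Z
        with i by lia.
      replace (Z.of_nat (Z.to_nat (i - 1 + Z.of_nat nB) + 2) - Z.of_nat nB)%Z
        with (i + 1)%Z by lia.
      replace (Z.of_nat (Z.to_nat (i - 1 + Z.of_nat nB) + 3) - Z.of_nat nB)%Z
        with (i + 2)%Z by lia.
      rewrite minus_IZR, !plus_IZR. unfold u.
      replace (q - (IZR i - 1)) with (q - IZR i + 1) by ring.
      replace (q - (IZR i + 1)) with (q - IZR i - 1) by ring.
      replace (q - (IZR i + 2)) with (q - IZR i - 2) by ring. reflexivity.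
    - lia.
    - intros j Hj Hout. unfold g. rewrite (kernel_supp _ _ HK); [ring|].
      assert (Hz : (Z.of_nat j - Z.of_nat nB <= i - 2 \/
                    i + 3 <= Z.of_nat j - Z.of_nat nB)%Z) by lia.
      unfold u in Hu. destruct Hz as [Hz|Hz]; apply IZR_le in Hz.
      + rewrite (minus_IZR i 2) in Hz. rewrite Rabs_pos_eq; lra.
      + rewrite plus_IZR in Hz. rewrite Rabs_left1; lra. }
  (* Reduction to one period: shifting [x] by [k] turns shifts the cell index by [k * nB], which the
     periodic coefficients do not see. *)
  intros u Hu. destruct (mod_2PI x) as [k Hk].
  set (x0 := x - IZR k * (2 * PI)) in *.
  assert (Ex : x = x0 + IZR k * (2 * PI)) by (unfold x0; ring).
  assert (Eu : u = (x0 - r) / step nB - IZR (i - k * Z.of_nat nB)).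
  { unfold u. rewrite Ex, minus_IZR, mult_IZR, <- INR_IZR_INZ, <- Hm. field. lra. }
  rewrite Ex, pt_period_Z, (Hbase x0 (i - k * Z.of_nat nB)%Z Hk); rewrite <- Eu;
    [|exact Hu].
  rewrite <- (periodic_coef_shift nB c (i - 1) (- k)), <- (periodic_coef_shift nB c i (- k)),
    <- (periodic_coef_shift nB c (i + 1) (- k)), <- (periodic_coef_shift nB c (i + 2) (- k))
    by exact HnB.
  replace (i - k * Z.of_nat nB - 1)%Z with (i - 1 + - k * Z.of_nat nB)%Z by lia.
  replace (i - k * Z.of_nat nB + 1)%Z with (i + 1 + - k * Z.of_nat nB)%Z by lia.
  replace (i - k * Z.of_nat nB + 2)%Z with (i + 2 + - k * Z.of_nat nB)%Z by lia.
  replace (i - k * Z.of_nat nB)%Z with (i + - k * Z.of_nat nB)%Z by lia.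
  reflexivity.
Qed.

(** * Powers [hpow] *)

Lemma hpow_nonneg (x s : R) : 0 <= hpow x s.
Proof. unfold hpow. destruct (Rlt_dec 0 x); [left; apply exp_pos|lra]. Qed.

Lemma hpow_pos (x s : R) : 0 < x -> 0 < hpow x s.
Proof. intros H. unfold hpow. destruct (Rlt_dec 0 x); [apply exp_pos|lra]. Qed.

Lemma hpow_0 (s : R) : hpow 0 s = 0.
Proof. unfold hpow. destruct (Rlt_dec 0 0); lra. Qed.

Lemma hpow_1 (x : R) : 0 <= x -> hpow x 1 = x.
Proof. intros H. unfold hpow. destruct (Rlt_dec 0 x); [now apply Rpower_1|lra]. Qed.

Lemma hpow_le (x y s : R) : 0 <= s -> x <= y -> hpow x s <= hpow y s.
Proof.
  intros Hs Hxy. unfold hpow. destruct (Rlt_dec 0 x), (Rlt_dec 0 y); try lra.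
  - apply Rle_Rpower_l; lra.
  - left; apply exp_pos.
Qed.

Lemma hpow_mult (x y s : R) : 0 <= x -> 0 <= y -> hpow (x * y) s = hpow x s * hpow y s.
Proof.
  intros Hx Hy. unfold hpow.
  destruct (Rlt_dec 0 x), (Rlt_dec 0 y), (Rlt_dec 0 (x * y)); try nra.
  symmetry. now apply Rpower_mult_distr.
Qed.

Lemma hpow_lower_exponent (x B s r : R) :
  0 <= r -> r <= s -> x <= B -> hpow x s <= hpow B (s - r) * hpow x r.
Proof.
  intros Hr Hrs Hx. unfold hpow at 1 3. destruct (Rlt_dec 0 x); [|lra].
  replace s with ((s - r) + r) at 1 by ring. rewrite Rpower_plus.
  apply Rmult_le_compat_r; [left; apply exp_pos|].
  unfold hpow. destruct (Rlt_dec 0 B); [|lra]. apply Rle_Rpower_l; lra.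
Qed.

Lemma hpow_ge_id (x s : R) : 0 <= x <= 1 -> 0 <= s <= 1 -> x <= hpow x s.
Proof.
  intros Hx Hs. destruct (Req_dec x 0) as [-> | H0]; [rewrite hpow_0; lra|].
  unfold hpow. destruct (Rlt_dec 0 x); [|lra].
  rewrite <- (Rpower_1 x) at 1 by lra. unfold Rpower.
  assert (ln x <= 0) by (rewrite <- ln_1; apply ln_le; lra).
  assert (1 * ln x <= s * ln x) by nra.
  destruct (Req_dec (1 * ln x) (s * ln x)) as [-> | Hne]; [lra|].
  left. apply exp_increasing. lra.
Qed.

Lemma hpow_small (s e : R) : 0 < s -> 0 < e ->
  exists d, 0 < d /\ forall x, x <= d -> hpow x s <= e.
Proof.
  intros Hs He. exists (Rpower e (/ s)). split; [apply exp_pos|].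
  intros x Hx. eapply Rle_trans; [apply hpow_le; [lra|exact Hx]|].
  unfold hpow. destruct (Rlt_dec _ _) as [H|]; [|lra].
  rewrite Rpower_mult, Rinv_l, Rpower_1; lra.
Qed.

(** * Spline interpolation *)

Lemma finite_bound (c : nat -> C) (n : nat) :
  exists B, 0 <= B /\ forall j, (j <= n)%nat -> Cmod (c j) <= B.
Proof.
  induction n as [|n [B [H0 HB]]].
  - exists (Cmod (c O)). split; [apply Cmod_ge_0|]. intros j Hj.
    replace j with O by lia. lra.
  - exists (B + Cmod (c (S n))). pose proof (Cmod_ge_0 (c (S n))). split; [lra|].
    intros j Hj. destruct (Nat.eq_dec j (S n)) as [-> |]; [lra|].
    specialize (HB j ltac:(lia)). lra.
Qed.

Lemma periodic_coef_bound (nB : nat) (c : nat -> C) :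
  (4 <= nB)%nat -> exists B, 0 <= B /\ forall z, Cmod (periodic_coef nB c z) <= B.
Proof.
  intros H. destruct (finite_bound c nB) as [B [H0 HB]]. exists B. split; [exact H0|].
  intros z. apply HB. pose proof (Z.mod_pos_bound z (Z.of_nat nB)). lia.
Qed.

(** Solving for the middle term, a bound [M] for [d] improves to
    [(e + 2aM) / (1 - 2a) <= 3/2 e + M/2], because [2a <= 1/3]. The fixed point of this contraction
    is [3e]. *)
Lemma tridiagonal_bound (a B e : R) (d : Z -> C) :
  0 <= a <= 1 / 6 -> (forall z, Cmod (d z) <= B) ->
  (forall z, Cmod (Cplus (Cmult (RtoC a) (Cplus (d (z - 1)%Z) (d (z + 1)%Z)))
                         (Cmult (RtoC (1 - 2 * a)) (d z))) <= e) ->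
  forall z, Cmod (d z) <= 3 * e.
Proof.
  intros Ha HB He z.
  replace (3 * e) with ((3 / 2 * e) / (1 - 1 / 2)) by field.
  apply (bounded_contraction d B (1 / 2) (3 / 2 * e)); [lra|exact HB|].
  clear z. intros M HM z. specialize (He z).
  match type of He with Cmod ?z <= _ => set (w := z) in He end.
  assert (E : Cmult (RtoC (1 - 2 * a)) (d z)
     = Cplus w (Copp (Cmult (RtoC a) (Cplus (d (z - 1)%Z) (d (z + 1)%Z)))))
    by (unfold w; ring).
  apply (f_equal Cmod) in E.
  pose proof (Cmod_triangle w (Copp (Cmult (RtoC a) (Cplus (d (z - 1)%Z) (d (z + 1)%Z))))) as H1.
  rewrite <- E, Cmod_opp, !Cmod_mult, !Cmod_R, !Rabs_pos_eq in H1 by lra.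
  pose proof (Cmod_triangle (d (z - 1)%Z) (d (z + 1)%Z)) as H2.
  pose proof (HM (z - 1)%Z) as H3. pose proof (HM (z + 1)%Z) as H4.
  pose proof (Cmod_ge_0 (d z)) as H5. pose proof (HM z) as H6.
  pose proof (Cmod_ge_0 w) as H7.
  assert (H8 : a * Cmod (Cplus (d (z - 1)%Z) (d (z + 1)%Z)) <= a * (2 * M))
    by (apply Rmult_le_compat_l; lra).
  nra.
Qed.

(** At a node only three translates are nonzero, which makes the interpolation matrix tridiagonal up
    to periodicity. *)
Lemma spline_node (G : contour) (m nB : nat) (a r : R) (c : nat -> C) (z : Z) :
  spline_kernel (Bspline m) a -> (4 <= nB)%nat -> 0 <= r < step nB ->
  spline G m nB r c (pt G (r + IZR z * step nB)) =
    Cplus (Cmult (RtoC a) (Cplus (periodic_coef nB c (z - 1)) (periodic_coef nB c (z + 1))))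
          (Cmult (RtoC (1 - 2 * a)) (periodic_coef nB c z)).
Proof.
  intros HK HnB Hr. pose proof (step_pos nB HnB) as Hh.
  assert (Eu : (r + IZR z * step nB - r) / step nB - IZR z = 0) by (field; lra).
  rewrite (spline_local G m nB a r c _ z HK HnB Hr) by (rewrite Eu; lra).
  rewrite Eu. rewrite (kernel_supp _ _ HK (0 - 2)) by (rewrite Rabs_left1; lra).
  replace (0 + 1) with 1 by ring. replace (0 - 1) with (-1) by ring.
  rewrite (kernel_at0 _ _ HK), (kernel_pos1 _ _ HK), (kernel_neg1 _ _ HK). ring.
Qed.

Lemma node_mod (G : contour) (nB : nat) (r : R) (z : Z) :
  (4 <= nB)%nat ->
  pt G (r + IZR z * step nB) = t_B G nB r (S (Z.to_nat (z mod Z.of_nat nB))).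
Proof.
  intros HnB. unfold t_B, theta_B.
  set (w := r + (INR _ - 1) * _). rewrite <- (pt_period_Z G w (z / Z.of_nat nB)).
  f_equal. unfold w.
  rewrite S_INR, INR_IZR_INZ, Z2Nat.id.
  2: { apply Z.mod_pos_bound. lia. }
  rewrite (Z_div_mod_eq_full z (Z.of_nat nB)) at 1.
  rewrite plus_IZR, mult_IZR, <- INR_IZR_INZ, <- (step_mul nB HnB). ring.
Qed.

(** Diagonal dominance with right-hand side zero; this one fact gives both uniqueness and, the
    system being square, existence of interpolants. *)
Lemma spline_zero (G : contour) (m nB : nat) (a r : R) (c : nat -> C) :
  spline_kernel (Bspline m) a -> (4 <= nB)%nat -> 0 <= r < step nB ->
  (forall i, (i < nB)%nat -> spline G m nB r c (t_B G nB r (S i)) = RtoC 0) ->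
  forall j, (j < nB)%nat -> c (S j) = RtoC 0.
Proof.
  intros HK HnB Hr H j Hj.
  destruct (periodic_coef_bound nB c HnB) as [B [_ HB]].
  rewrite <- (periodic_coef_nat nB c j Hj). apply Cmod_eq_0.
  apply Rle_antisym; [|apply Cmod_ge_0].
  replace 0 with (3 * 0) by ring.
  apply (tridiagonal_bound a B); [apply (kernel_small _ _ HK)|exact HB|].
  intros z. rewrite <- (spline_node G m nB a r c z HK HnB Hr), node_mod by exact HnB.
  rewrite H; [rewrite Cmod_0; lra|].
  pose proof (Z.mod_pos_bound z (Z.of_nat nB)). lia.
Qed.

Lemma spline_csum (G : contour) (m nB : nat) (r : R) (c : nat -> C) (t : Gamma G) :
  spline G m nB r c t =
    csum (fun j => Cmult (RtoC (B_fun G m nB r (S j) t)) (c (S j))) nB.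
Proof.
  unfold spline. rewrite sum_n_m_csum. apply csum_ext. intros j _. ring.
Qed.

Lemma spline_plus (G : contour) (m nB : nat) (r : R) (c d : nat -> C) (t : Gamma G) :
  spline G m nB r (fun j => Cplus (c j) (d j)) t
    = Cplus (spline G m nB r c t) (spline G m nB r d t).
Proof.
  rewrite !spline_csum, <- csum_plus. apply csum_ext. intros j _. ring.
Qed.

Lemma spline_scal (G : contour) (m nB : nat) (r : R) (a : C) (c : nat -> C) (t : Gamma G) :
  spline G m nB r (fun j => Cmult a (c j)) t = Cmult a (spline G m nB r c t).
Proof.
  rewrite !spline_csum, <- csum_scal. apply csum_ext. intros j _. ring.
Qed.

Lemma in_S_iff (G : contour) (m nB : nat) (r : R) (s : Gamma G -> C) :
  in_S G m nB r s <-> exists c, s = spline G m nB r c.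
Proof.
  split; intros [c H]; exists c.
  - apply functional_extensionality, H.
  - intros t. now rewrite H.
Qed.

Lemma in_S_plus (G : contour) (m nB : nat) (r : R) (s s' : Gamma G -> C) :
  in_S G m nB r s -> in_S G m nB r s' -> in_S G m nB r (fun t => Cplus (s t) (s' t)).
Proof.
  rewrite !in_S_iff. intros [c ->] [d ->]. exists (fun j => Cplus (c j) (d j)).
  apply functional_extensionality. intros t. symmetry. apply spline_plus.
Qed.

Lemma in_S_scal (G : contour) (m nB : nat) (r : R) (a : C) (s : Gamma G -> C) :
  in_S G m nB r s -> in_S G m nB r (fun t => Cmult a (s t)).
Proof.
  rewrite !in_S_iff. intros [c ->]. exists (fun j => Cmult a (c j)).
  apply functional_extensionality. intros t. symmetry. apply spline_scal.
Qed.

Lemma in_S_unique (G : contour) (m nB : nat) (a r : R) (s s' : Gamma G -> C) :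
  spline_kernel (Bspline m) a -> (4 <= nB)%nat -> 0 <= r < step nB ->
  in_S G m nB r s -> in_S G m nB r s' ->
  (forall i, (1 <= i <= nB)%nat -> s (t_B G nB r i) = s' (t_B G nB r i)) -> s = s'.
Proof.
  intros HK HnB Hr Hs Hs' H.
  assert (Hd : in_S G m nB r (fun t => Cplus (s t) (Cmult (RtoC (-1)) (s' t))))
    by (apply in_S_plus; [exact Hs|]; now apply in_S_scal).
  apply in_S_iff in Hd. destruct Hd as [c Hc].
  assert (H0 : forall j, (j < nB)%nat -> c (S j) = RtoC 0).
  { apply (spline_zero G m nB a r c HK HnB Hr). intros i Hi.
    rewrite <- Hc, (H (S i)) by lia. ring. }
  apply functional_extensionality. intros t.
  apply (f_equal (fun f => f t)) in Hc. simpl in Hc.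
  rewrite spline_csum, csum_zero in Hc by (intros j Hj; rewrite H0 by exact Hj; ring).
  replace (s t) with (Cplus (Cplus (s t) (Cmult (RtoC (-1)) (s' t))) (s' t)) by ring.
  rewrite Hc. ring.
Qed.

Lemma P_op_spec (G : contour) (m nB : nat) (a r : R) (v : Gamma G -> C) :
  spline_kernel (Bspline m) a -> (4 <= nB)%nat -> 0 <= r < step nB ->
  in_S G m nB r (P_op G m nB r v) /\
  forall i, (1 <= i <= nB)%nat -> P_op G m nB r v (t_B G nB r i) = v (t_B G nB r i).
Proof.
  intros HK HnB Hr. unfold P_op. apply epsilon_spec.
  (* The linear system is indexed from 0 and spline coefficients from 1; [pred] and [S] translate
     between the two. *)
  destruct (injective_system_solvable nB
     (fun i j => RtoC (B_fun G m nB r (S j) (t_B G nB r (S i))))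
     (fun i => v (t_B G nB r (S i)))) as [c Hc].
  - intros c Hc j Hj.
    apply (spline_zero G m nB a r (fun j => c (pred j)) HK HnB Hr); [|exact Hj].
    intros i Hi. rewrite spline_csum. now apply Hc.
  - exists (spline G m nB r (fun j => c (pred j))). split.
    + apply in_S_iff. now eexists.
    + intros i Hi. destruct i as [|i]; [lia|]. rewrite spline_csum. apply Hc. lia.
Qed.

Lemma P_op_eq (G : contour) (m nB : nat) (a r : R) (s v : Gamma G -> C) :
  spline_kernel (Bspline m) a -> (4 <= nB)%nat -> 0 <= r < step nB ->
  in_S G m nB r s ->
  (forall i, (1 <= i <= nB)%nat -> s (t_B G nB r i) = v (t_B G nB r i)) ->
  P_op G m nB r v = s.
Proof.
  intros HK HnB Hr Hs H. destruct (P_op_spec G m nB a r v HK HnB Hr) as [H1 H2].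
  apply (in_S_unique G m nB a r _ _ HK HnB Hr H1 Hs). intros i Hi.
  now rewrite H2, H.
Qed.

Lemma P_op_plus (G : contour) (m nB : nat) (a r : R) (v w : Gamma G -> C) :
  spline_kernel (Bspline m) a -> (4 <= nB)%nat -> 0 <= r < step nB ->
  P_op G m nB r (fun t => Cplus (v t) (w t))
    = fun t => Cplus (P_op G m nB r v t) (P_op G m nB r w t).
Proof.
  intros HK HnB Hr.
  destruct (P_op_spec G m nB a r v HK HnB Hr) as [H1 H2].
  destruct (P_op_spec G m nB a r w HK HnB Hr) as [H3 H4].
  apply (P_op_eq G m nB a r _ _ HK HnB Hr); [now apply in_S_plus|].
  intros i Hi. now rewrite H2, H4.
Qed.

Lemma P_op_scal (G : contour) (m nB : nat) (a r : R) (b : C) (v : Gamma G -> C) :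
  spline_kernel (Bspline m) a -> (4 <= nB)%nat -> 0 <= r < step nB ->
  P_op G m nB r (fun t => Cmult b (v t)) = fun t => Cmult b (P_op G m nB r v t).
Proof.
  intros HK HnB Hr. destruct (P_op_spec G m nB a r v HK HnB Hr) as [H1 H2].
  apply (P_op_eq G m nB a r _ _ HK HnB Hr); [now apply in_S_scal|].
  intros i Hi. now rewrite H2.
Qed.

Lemma Cmod_sum4_le (z1 z2 z3 z4 : C) (M : R) :
  Cmod z1 <= M -> Cmod z2 <= M -> Cmod z3 <= M -> Cmod z4 <= M ->
  Cmod (Cplus (Cplus (Cplus z1 z2) z3) z4) <= 4 * M.
Proof.
  intros. pose proof (Cmod_triangle (Cplus (Cplus z1 z2) z3) z4).
  pose proof (Cmod_triangle (Cplus z1 z2) z3). pose proof (Cmod_triangle z1 z2). lra.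
Qed.

Lemma cell_exists (nB : nat) (r x : R) :
  exists i : Z, 0 <= (x - r) / step nB - IZR i < 1.
Proof.
  destruct (archimed ((x - r) / step nB)) as [H1 H2].
  exists (up ((x - r) / step nB) - 1)%Z. rewrite minus_IZR. lra.
Qed.

(** * Local estimates for splines in terms of coefficient increments *)

Section SplineIncrements.

Variables (G : contour) (m nB : nat) (a r D : R) (c : nat -> C).
Hypothesis HK : spline_kernel (Bspline m) a.
Hypothesis HnB : (4 <= nB)%nat.
Hypothesis Hr : 0 <= r < step nB.
Hypothesis HD : forall z, Cmod (Cminus (periodic_coef nB c (z + 1)) (periodic_coef nB c z)) <= D.

Let ch := periodic_coef nB c.

(** [D] is here the bound on consecutive increments. The four coefficients active on cell [i] are at
    most two steps away from [ch i]. *)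
Lemma coef_increments (i : Z) :
  Cmod (Cminus (ch (i - 1)) (ch i)) <= 2 * D /\
  Cmod (Cminus (ch i) (ch i)) <= 2 * D /\
  Cmod (Cminus (ch (i + 1)) (ch i)) <= 2 * D /\
  Cmod (Cminus (ch (i + 2)) (ch i)) <= 2 * D.
Proof.
  pose proof (HD i) as H1. pose proof (HD (i - 1)) as H2. pose proof (HD (i + 1)) as H3.
  fold ch in H1, H2, H3.
  replace (i - 1 + 1)%Z with i in H2 by lia. replace (i + 1 + 1)%Z with (i + 2)%Z in H3 by lia.
  pose proof (Cmod_ge_0 (Cminus (ch (i + 1)) (ch i))) as H0.
  repeat split.
  - rewrite Cmod_minus_sym. lra.
  - replace (Cminus (ch i) (ch i)) with (RtoC 0) by ring. rewrite Cmod_0. lra.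
  - lra.
  - pose proof (Cmod_minus_triangle (ch (i + 2)) (ch (i + 1)) (ch i)). lra.
Qed.

(** By the partition of unity the deviation from [ch i] is a sum of four coefficient differences
    weighted by kernel values, and 768 is [4 * 2 * 96]. *)
Lemma spline_minus_coef (x : R) (i : Z) :
  0 <= (x - r) / step nB - IZR i <= 1 ->
  Cmod (Cminus (spline G m nB r c (pt G x)) (ch i)) <= 768 * D.
Proof.
  intros Hu. rewrite (spline_local G m nB a r c x i HK HnB Hr Hu). fold ch.
  set (u := (x - r) / step nB - IZR i) in *.
  pose proof (kernel_unity _ _ HK u Hu) as Hun.
  apply (f_equal RtoC) in Hun. rewrite !RtoC_plus in Hun.
  replace (ch i) with (Cmult (RtoC 1) (ch i)) at 2 by ring.
  rewrite <- Hun at 1.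
  match goal with |- Cmod ?z <= _ => replace z with
    (Cplus (Cplus (Cplus
      (Cmult (Cminus (ch (i - 1)) (ch i)) (RtoC (Bspline m (u + 1))))
      (Cmult (Cminus (ch i) (ch i)) (RtoC (Bspline m u))))
      (Cmult (Cminus (ch (i + 1)) (ch i)) (RtoC (Bspline m (u - 1)))))
      (Cmult (Cminus (ch (i + 2)) (ch i)) (RtoC (Bspline m (u - 2))))) by ring end.
  destruct (coef_increments i) as (H1 & H2 & H3 & H4).
  replace (768 * D) with (4 * (2 * D * 96)) by ring.
  apply Cmod_sum4_le; rewrite Cmod_mult, Cmod_R;
    (apply Rmult_le_compat; [apply Cmod_ge_0|apply Rabs_pos|assumption|
     exact (kernel_bound _ _ _ HK)]).
Qed.

Lemma spline_cell_lipschitz (x y : R) (i : Z) :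
  0 <= (x - r) / step nB - IZR i <= 1 -> 0 <= (y - r) / step nB - IZR i <= 1 ->
  Cmod (Cminus (spline G m nB r c (pt G x)) (spline G m nB r c (pt G y)))
    <= 192 * D * (Rabs (x - y) / step nB).
Proof.
  intros Hu Hv. pose proof (step_pos nB HnB) as Hh.
  rewrite (spline_local G m nB a r c x i HK HnB Hr Hu).
  rewrite (spline_local G m nB a r c y i HK HnB Hr Hv). fold ch.
  assert (Euv : Rabs (x - y) / step nB =
     Rabs ((x - r) / step nB - IZR i - ((y - r) / step nB - IZR i))).
  { replace ((x - r) / step nB - IZR i - ((y - r) / step nB - IZR i))
      with ((x - y) / step nB) by (field; lra).
    unfold Rdiv. rewrite Rabs_mult, (Rabs_pos_eq (/ step nB)); [reflexivity|].
    left. now apply Rinv_0_lt_compat. }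
  rewrite Euv. clear Euv.
  set (u := (x - r) / step nB - IZR i) in *. set (v := (y - r) / step nB - IZR i) in *.
  pose proof (kernel_unity _ _ HK u Hu) as Hun. pose proof (kernel_unity _ _ HK v Hv) as Hvn.
  assert (Huv := f_equal RtoC (eq_trans Hun (eq_sym Hvn))).
  rewrite !RtoC_plus in Huv.
  (* The increments of the four kernel values sum to zero, so [ch i] can be subtracted from every
     coefficient. The bound then involves coefficient increments only; 192 is [4 * 2 * 24]. *)
  assert (Hz : Cmult (ch i) (Cminus
    (Cplus (Cplus (Cplus (RtoC (Bspline m (u + 1))) (RtoC (Bspline m u)))
       (RtoC (Bspline m (u - 1)))) (RtoC (Bspline m (u - 2))))
    (Cplus (Cplus (Cplus (RtoC (Bspline m (v + 1))) (RtoC (Bspline m v)))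
       (RtoC (Bspline m (v - 1)))) (RtoC (Bspline m (v - 2))))) = RtoC 0)
    by (rewrite Huv; ring).
  match goal with |- Cmod ?z <= _ => rewrite <- (Cplus_0_r z) end.
  replace (RtoC 0) with (Copp (RtoC 0)) by ring. rewrite <- Hz.
  match goal with |- Cmod ?z <= _ => replace z with
    (Cplus (Cplus (Cplus
      (Cmult (Cminus (ch (i - 1)) (ch i)) (RtoC (Bspline m (u + 1) - Bspline m (v + 1))))
      (Cmult (Cminus (ch i) (ch i)) (RtoC (Bspline m u - Bspline m v))))
      (Cmult (Cminus (ch (i + 1)) (ch i)) (RtoC (Bspline m (u - 1) - Bspline m (v - 1)))))
      (Cmult (Cminus (ch (i + 2)) (ch i)) (RtoC (Bspline m (u - 2) - Bspline m (v - 2)))))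
    by (rewrite !RtoC_minus; ring) end.
  destruct (coef_increments i) as (H1 & H2 & H3 & H4).
  replace (192 * D * Rabs (u - v)) with (4 * (2 * D * (24 * Rabs (u - v)))) by ring.
  assert (Hl : forall q, Rabs (Bspline m (u + q) - Bspline m (v + q)) <= 24 * Rabs (u - v)).
  { intros q. replace (u - v) with (u + q - (v + q)) by ring. apply (kernel_lip _ _ HK). }
  apply Cmod_sum4_le; rewrite Cmod_mult, Cmod_R;
    (apply Rmult_le_compat; [apply Cmod_ge_0|apply Rabs_pos|assumption|]).
  - apply Hl.
  - apply (kernel_lip _ _ HK).
  - apply Hl.
  - apply Hl.
Qed.

(** Two points at most one step apart lie in one cell or in two adjacent cells. In the second case
    the common node [b] lies between them, and the two bounds, linear in the length, add up without
    loss. *)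
Lemma spline_step_lipschitz (x y : R) :
  Rabs (x - y) <= step nB ->
  Cmod (Cminus (spline G m nB r c (pt G x)) (spline G m nB r c (pt G y)))
    <= 192 * D * (Rabs (x - y) / step nB).
Proof.
  pose proof (step_pos nB HnB) as Hh.
  assert (Hord : forall x y, x <= y -> y - x <= step nB ->
    Cmod (Cminus (spline G m nB r c (pt G x)) (spline G m nB r c (pt G y)))
    <= 192 * D * (Rabs (x - y) / step nB)).
  { clear x y. intros x y Hxy Hd. destruct (cell_exists nB r x) as [i Hi].
    set (p := (x - r) / step nB) in *. set (q := (y - r) / step nB).
    assert (Hpq : p <= q <= p + 1).
    { assert (Ex : x - r = p * step nB) by (unfold p; field; lra).
      assert (Ey : y - r = q * step nB) by (unfold q; field; lra).
      split; apply Rmult_le_reg_r with (step nB); nra. }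
    destruct (Rle_lt_dec q (IZR i + 1)) as [Hq|Hq].
    - apply (spline_cell_lipschitz x y i); fold p q; lra.
    - set (b := r + IZR (i + 1) * step nB).
      assert (Eb : (b - r) / step nB = IZR i + 1)
        by (unfold b; rewrite plus_IZR; field; lra).
      assert (Hxb : x <= b).
      { assert (Ex : x - r = p * step nB) by (unfold p; field; lra).
        assert (b - r = (IZR i + 1) * step nB) by (rewrite <- Eb; field; lra). nra. }
      assert (Hby : b <= y).
      { assert (Ey : y - r = q * step nB) by (unfold q; field; lra).
        assert (b - r = (IZR i + 1) * step nB) by (rewrite <- Eb; field; lra). nra. }
      eapply Rle_trans; [apply (Cmod_minus_triangle _ (spline G m nB r c (pt G b)))|].
      replace (Rabs (x - y) / step nB) with (Rabs (x - b) / step nB + Rabs (b - y) / step nB).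
      2: { rewrite !Rabs_left1 by lra. field. lra. }
      rewrite Rmult_plus_distr_l. apply Rplus_le_compat.
      + apply (spline_cell_lipschitz x b i); rewrite ?Eb; fold p; lra.
      + apply (spline_cell_lipschitz b y (i + 1)); rewrite ?Eb, plus_IZR; fold q; lra. }
  intros Hd. destruct (Rle_lt_dec x y) as [H|H].
  - apply Hord; [exact H|]. rewrite Rabs_left1 in Hd; lra.
  - rewrite Cmod_minus_sym, Rabs_minus_sym. apply Hord; [lra|].
    rewrite Rabs_pos_eq in Hd; lra.
Qed.

End SplineIncrements.

(** Regularity is measured in the real parameter, over all of [R] and hence across the cut;
    [holder_X] makes the passage to [arc_dist]. *)
Definition holder (G : contour) (mu L : R) (g : Gamma G -> C) : Prop :=
  forall x y, Cmod (Cminus (g (pt G x)) (g (pt G y))) <= L * hpow (Rabs (x - y)) mu.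

(** A qualitative statement: the constant grows like [1/h] and serves only to place splines in the
    function space. Beyond one step the supremum bound is enough. *)
Lemma in_S_holder (G : contour) (m nB : nat) (a r : R) (s : Gamma G -> C) :
  spline_kernel (Bspline m) a -> (4 <= nB)%nat -> 0 <= r < step nB ->
  in_S G m nB r s -> exists L, holder G 1 L s.
Proof.
  intros HK HnB Hr Hs. apply in_S_iff in Hs. destruct Hs as [c ->].
  pose proof (step_pos nB HnB) as Hh.
  destruct (periodic_coef_bound nB c HnB) as [B [HB0 HB]].
  assert (HD : forall z, Cmod (Cminus (periodic_coef nB c (z + 1)) (periodic_coef nB c z))
     <= 2 * B).
  { intros z. unfold Cminus. eapply Rle_trans; [apply Cmod_triangle|].
    rewrite Cmod_opp. pose proof (HB z). pose proof (HB (z + 1)%Z). lra. }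
  exists (4000 * B / step nB). intros x y. rewrite hpow_1 by apply Rabs_pos.
  pose proof (Rabs_pos (x - y)) as Ha.
  destruct (Rle_lt_dec (Rabs (x - y)) (step nB)) as [H|H].
  - eapply Rle_trans; [apply (spline_step_lipschitz G m nB a r (2 * B)); assumption|].
    assert (0 <= B * (Rabs (x - y) / step nB)).
    { apply Rmult_le_pos; [exact HB0|]. unfold Rdiv. apply Rmult_le_pos; [lra|].
      left; now apply Rinv_0_lt_compat. }
    replace (4000 * B / step nB * Rabs (x - y)) with (4000 * (B * (Rabs (x - y) / step nB)))
      by (field; lra). lra.
  - assert (Hs : forall z, Cmod (spline G m nB r c (pt G z)) <= 1600 * B).
    { intros z. destruct (cell_exists nB r z) as [i Hi].
      assert (Hc := spline_minus_coef G m nB a r (2 * B) c HK HnB Hr HD z i ltac:(lra)).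
      replace (spline G m nB r c (pt G z)) with (Cplus (Cminus (spline G m nB r c (pt G z))
         (periodic_coef nB c i)) (periodic_coef nB c i)) by ring.
      eapply Rle_trans; [apply Cmod_triangle|]. pose proof (HB i). lra. }
    apply Rle_trans with (3200 * B).
    { unfold Cminus. eapply Rle_trans; [apply Cmod_triangle|].
      rewrite Cmod_opp. pose proof (Hs x). pose proof (Hs y). lra. }
    replace (4000 * B / step nB * Rabs (x - y)) with (4000 * (B * (Rabs (x - y) / step nB)))
      by (field; lra).
    assert (1 <= Rabs (x - y) / step nB).
    { apply Rmult_le_reg_r with (step nB); [lra|]. unfold Rdiv.
      rewrite Rmult_assoc, Rinv_l; lra. }
    nra.
Qed.

(** * Interpolation of Hoelder functions, uniformly in the mesh *)

Section InterpolationError.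

Variables (G : contour) (m nB : nat) (a r mu L : R) (g : Gamma G -> C).
Hypothesis HK : spline_kernel (Bspline m) a.
Hypothesis HnB : (4 <= nB)%nat.
Hypothesis Hr : 0 <= r < step nB.
Hypothesis Hmu : 0 < mu <= 1.
Hypothesis Hg : holder G mu L g.

Lemma holder_const_nonneg : 0 <= L.
Proof.
  pose proof (Hg 0 1) as H.
  pose proof (Cmod_ge_0 (Cminus (g (pt G 0)) (g (pt G 1)))) as H0.
  assert (Hp : 0 < hpow (Rabs (0 - 1)) mu) by (apply hpow_pos, Rabs_pos_lt; lra).
  apply Rmult_le_reg_r with (hpow (Rabs (0 - 1)) mu); lra.
Qed.

(* Increments of the coefficients satisfy the same diagonally dominant system,
   with the increments of the data on the right. *)
Lemma P_op_increments :
  exists c, P_op G m nB r g = spline G m nB r c /\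
    (forall z, Cmod (Cminus (periodic_coef nB c (z + 1)) (periodic_coef nB c z))
       <= 3 * (L * hpow (step nB) mu)) /\
    (forall z, Cmod (Cminus (periodic_coef nB c z) (g (pt G (r + IZR z * step nB))))
       <= L * hpow (step nB) mu).
Proof.
  pose proof (step_pos nB HnB) as Hh.
  destruct (P_op_spec G m nB a r g HK HnB Hr) as [H1 H2].
  apply in_S_iff in H1. destruct H1 as [c Hc]. rewrite Hc in H2.
  assert (Hn : forall z, Cplus (Cmult (RtoC a) (Cplus (periodic_coef nB c (z - 1)) (periodic_coef nB c (z + 1))))
          (Cmult (RtoC (1 - 2 * a)) (periodic_coef nB c z)) = g (pt G (r + IZR z * step nB))).
  { intros z. rewrite <- (spline_node G m nB a r c z HK HnB Hr), node_mod by exact HnB.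
    apply H2. pose proof (Z.mod_pos_bound z (Z.of_nat nB)). lia. }
  assert (HD : forall z, Cmod (Cminus (periodic_coef nB c (z + 1)) (periodic_coef nB c z))
       <= 3 * (L * hpow (step nB) mu)).
  { destruct (periodic_coef_bound nB c HnB) as [B [HB0 HB]].
    apply (tridiagonal_bound a (2 * B)); [apply (kernel_small _ _ HK)| |].
    - intros z. unfold Cminus. eapply Rle_trans; [apply Cmod_triangle|].
      rewrite Cmod_opp. pose proof (HB z). pose proof (HB (z + 1)%Z). lra.
    - intros z. pose proof (Hg (r + IZR (z + 1) * step nB) (r + IZR z * step nB)) as H.
      replace (r + IZR (z + 1) * step nB - (r + IZR z * step nB)) with (step nB) in H
        by (rewrite plus_IZR; ring).
      rewrite (Rabs_pos_eq (step nB)) in H by lra.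
      rewrite <- !Hn in H. eapply Rle_trans; [|exact H]. right. f_equal.
      replace (z - 1 + 1)%Z with z by lia. replace (z + 1 - 1)%Z with z by lia. ring. }
  exists c. split; [exact Hc|]. split; [exact HD|].
  intros z. rewrite <- Hn. pose proof (kernel_small _ _ HK) as Ha.
  (* Coefficient minus nodal value is [a] times a second difference of coefficients, hence at most
     [1/6] of two increments of size 3. *)
  match goal with |- Cmod ?w <= _ => replace w with (Cmult (RtoC a)
     (Cminus (Cminus (periodic_coef nB c z) (periodic_coef nB c (z - 1)))
             (Cminus (periodic_coef nB c (z + 1)) (periodic_coef nB c z)))) end.
  2: { rewrite RtoC_minus, RtoC_mult. ring. }
  rewrite Cmod_mult, Cmod_R, Rabs_pos_eq by lra.
  pose proof (HD z) as D1. pose proof (HD (z - 1)%Z) as D2.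
  replace (z - 1 + 1)%Z with z in D2 by lia.
  set (A := Cminus (periodic_coef nB c z) (periodic_coef nB c (z - 1))) in *.
  set (B := Cminus (periodic_coef nB c (z + 1)) (periodic_coef nB c z)) in *.
  assert (Cmod (Cminus A B) <= 6 * (L * hpow (step nB) mu)).
  { unfold Cminus at 1. eapply Rle_trans; [apply Cmod_triangle|]. rewrite Cmod_opp. lra. }
  pose proof (Cmod_ge_0 (Cminus A B)).
  apply Rle_trans with (1 / 6 * (6 * (L * hpow (step nB) mu))); [|lra].
  apply Rmult_le_compat; lra.
Qed.

(** The comparison passes through the coefficient and the datum at the left node of the cell:
    [768 * 3 + 1 + 1], rounded up. *)
Lemma P_op_error (x : R) :
  Cmod (Cminus (P_op G m nB r g (pt G x)) (g (pt G x)))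
    <= 3000 * (L * hpow (step nB) mu).
Proof.
  pose proof (step_pos nB HnB) as Hh. pose proof holder_const_nonneg as HL.
  destruct P_op_increments as (c & -> & HD & Hc).
  destruct (cell_exists nB r x) as [i Hi].
  assert (H1 := spline_minus_coef G m nB a r _ c HK HnB Hr HD x i ltac:(lra)).
  specialize (Hc i). pose proof (Hg (r + IZR i * step nB) x) as H2.
  set (node := r + IZR i * step nB) in *.
  assert (H3 : hpow (Rabs (node - x)) mu <= hpow (step nB) mu).
  { apply hpow_le; [lra|]. set (p := (x - r) / step nB) in *.
    assert (Ex : x - r = p * step nB) by (unfold p; field; lra).
    unfold node. apply Rabs_le. nra. }
  pose proof (Cmod_minus_triangle (spline G m nB r c (pt G x)) (periodic_coef nB c i) (g (pt G x))).
  pose proof (Cmod_minus_triangle (periodic_coef nB c i) (g (pt G node)) (g (pt G x))).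
  assert (L * hpow (Rabs (node - x)) mu <= L * hpow (step nB) mu)
    by (apply Rmult_le_compat_l; assumption).
  pose proof (hpow_nonneg (step nB) mu).
  assert (0 <= L * hpow (step nB) mu) by (now apply Rmult_le_pos). lra.
Qed.

(** Two scales. Within one step the local Lipschitz bound is [576 L h^mu q] with
    [q = |x - y| / h <= 1], and [q <= q^mu]. Beyond one step, the Hoelder bound of [g] and two
    interpolation errors suffice, as [h^mu <= |x - y|^mu]. *)
Lemma P_op_holder : holder G mu (7000 * L) (P_op G m nB r g).
Proof.
  intros x y. pose proof (step_pos nB HnB) as Hh. pose proof holder_const_nonneg as HL.
  pose proof (Rabs_pos (x - y)) as Ha.
  destruct (Rle_lt_dec (Rabs (x - y)) (step nB)) as [H|H].
  - destruct P_op_increments as (c & -> & HD & _).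
    eapply Rle_trans; [apply (spline_step_lipschitz G m nB a r _ c HK HnB Hr HD x y H)|].
    set (q := Rabs (x - y) / step nB).
    assert (Eq : Rabs (x - y) = q * step nB) by (unfold q; field; lra).
    assert (Hq : 0 <= q <= 1).
    { split; apply Rmult_le_reg_r with (step nB); lra. }
    rewrite Eq, hpow_mult by lra.
    pose proof (hpow_ge_id q mu Hq ltac:(lra)) as H1.
    pose proof (hpow_nonneg (step nB) mu) as H2.
    assert (H3 : L * hpow (step nB) mu * q <= L * hpow (step nB) mu * hpow q mu).
    { apply Rmult_le_compat_l; [now apply Rmult_le_pos|exact H1]. }
    assert (0 <= L * hpow (step nB) mu * q).
    { apply Rmult_le_pos; [now apply Rmult_le_pos|lra]. }
    nra.
  - pose proof (P_op_error x) as H1. pose proof (P_op_error y) as H2.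
    rewrite Cmod_minus_sym in H2. pose proof (Hg x y) as H3.
    pose proof (Cmod_minus_triangle (P_op G m nB r g (pt G x)) (g (pt G x)) (P_op G m nB r g (pt G y))).
    pose proof (Cmod_minus_triangle (g (pt G x)) (g (pt G y)) (P_op G m nB r g (pt G y))).
    assert (L * hpow (step nB) mu <= L * hpow (Rabs (x - y)) mu).
    { apply Rmult_le_compat_l; [exact HL|]. apply hpow_le; lra. }
    pose proof (hpow_nonneg (step nB) mu).
    assert (0 <= L * hpow (step nB) mu) by (now apply Rmult_le_pos). lra.
Qed.

End InterpolationError.

(** * Metric geometry of the contour *)

Lemma Cmod_norm_R (z : C) : @norm R_AbsRing C_R_NormedModule z = Cmod z.
Proof. symmetry. apply Cmod_norm. Qed.

Lemma filterlim_C_iff (T : Type) (F : (T -> Prop) -> Prop) (FF : Filter F)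
    (f : T -> C) (l : C) :
  filterlim f F (locally l) <->
  forall e, 0 < e -> F (fun x => Cmod (Cminus (f x) l) < e).
Proof.
  rewrite (@filterlim_locally_ball_norm R_AbsRing T C_R_NormedModule F FF f l).
  split.
  - intros H e He. apply (filter_imp _ _ (fun x Hx => eq_ind _ (fun r => r < e) Hx _
        (Cmod_norm_R _)) (H (mkposreal e He))).
  - intros H e. apply (filter_imp (fun x => Cmod (Cminus (f x) l) < e)).
    + intros x Hx. unfold ball_norm. rewrite Cmod_norm_R. exact Hx.
    + apply H. apply cond_pos.
Qed.

Lemma lim_minus_iff (G : contour) (v : Gamma G -> C) (x : R) (l : C) :
  lim_minus G v x l <-> forall e, 0 < e -> exists d, 0 < d /\
    forall y, x - d < y < x -> Cmod (Cminus (v (pt G y)) l) < e.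
Proof.
  unfold lim_minus. rewrite (filterlim_C_iff _ (at_left x) _). split.
  - intros H e He. destruct (H e He) as [d Hd]. exists d. split; [apply cond_pos|].
    intros y Hy. apply Hd; [|lra]. apply Rabs_lt_between'. lra.
  - intros H e He. destruct (H e He) as (d & Hd & Hy). exists (mkposreal d Hd).
    intros y H1 H2. apply Hy. apply Rabs_lt_between' in H1. simpl in H1. lra.
Qed.

Lemma lim_plus_iff (G : contour) (v : Gamma G -> C) (x : R) (l : C) :
  lim_plus G v x l <-> forall e, 0 < e -> exists d, 0 < d /\
    forall y, x < y < x + d -> Cmod (Cminus (v (pt G y)) l) < e.
Proof.
  unfold lim_plus. rewrite (filterlim_C_iff _ (at_right x) _). split.
  - intros H e He. destruct (H e He) as [d Hd]. exists d. split; [apply cond_pos|].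
    intros y Hy. apply Hd; [|lra]. apply Rabs_lt_between'. lra.
  - intros H e He. destruct (H e He) as (d & Hd & Hy). exists (mkposreal d Hd).
    intros y H1 H2. apply Hy. apply Rabs_lt_between' in H1. simpl in H1. lra.
Qed.

Lemma continuous_C_iff (f : R -> C) (x : R) :
  continuous f x <-> forall e, 0 < e -> exists d, 0 < d /\
    forall y, Rabs (y - x) < d -> Cmod (Cminus (f y) (f x)) < e.
Proof.
  unfold continuous. rewrite (filterlim_C_iff _ (locally x) _). split.
  - intros H e He. destruct (H e He) as [d Hd]. exists d. split; [apply cond_pos|].
    intros y Hy. now apply Hd.
  - intros H e He. destruct (H e He) as (d & Hd & Hy). exists (mkposreal d Hd).
    intros y H1. now apply Hy.
Qed.

Lemma continuous_Cmod (f : R -> C) (x : R) :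
  continuous f x -> continuous (fun y => Cmod (f y)) x.
Proof.
  intros H. apply (continuous_ext (fun y => @norm R_AbsRing C_R_NormedModule (f y))).
  - intros y. apply Cmod_norm_R.
  - apply (continuous_comp f (@norm R_AbsRing C_R_NormedModule)); [exact H|].
    exact (@filterlim_norm R_AbsRing C_R_NormedModule (f x)).
Qed.

Lemma gam_continuous (G : contour) (x : R) : continuous (gam G) x.
Proof.
  apply (@ex_derive_continuous R_AbsRing C_R_NormedModule). exists (dgam G x).
  apply gam_deriv.
Qed.

Lemma dgam_continuous (G : contour) (x : R) : continuous (dgam G) x.
Proof.
  apply (@ex_derive_continuous R_AbsRing C_R_NormedModule). exists (d2gam G x).
  apply dgam_deriv.
Qed.

Lemma dgam_bounds (G : contour) : exists c L, 0 < c /\ 0 < L /\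
  forall x, -2 * PI <= x <= 4 * PI -> c <= Cmod (dgam G x) <= L.
Proof.
  pose proof PI_RGT_0.
  assert (Hc : forall x, continuity_pt (fun y => Cmod (dgam G y)) x).
  { intros x. apply continuity_pt_filterlim. apply continuous_Cmod, dgam_continuous. }
  destruct (continuity_ab_min (fun y => Cmod (dgam G y)) (-2 * PI) (4 * PI)) as (p & Hp & _);
    [lra|intros; apply Hc|].
  destruct (continuity_ab_maj (fun y => Cmod (dgam G y)) (-2 * PI) (4 * PI)) as (q & Hq & _);
    [lra|intros; apply Hc|].
  assert (Hpos : forall x, 0 < Cmod (dgam G x)) by (intros; apply Cmod_gt_0, gam_reg).
  exists (Cmod (dgam G p)), (Cmod (dgam G q)). repeat split; auto.
Qed.

(** A mean value inequality with a free comparison slope [z]: [z = 0] gives the upper Lipschitz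
    bound, and [z] a value of [dgam] gives the local lower bound. *)
Lemma gam_increment (G : contour) (z : C) (x y e : R) :
  x <= y -> (forall t, x <= t <= y -> Cmod (Cminus (dgam G t) z) <= e) ->
  Cmod (Cminus (Cminus (gam G y) (gam G x)) (Cmult (RtoC (y - x)) z)) <= (y - x) * e.
Proof.
  intros Hxy He.
  assert (H1 : @is_RInt C_R_NormedModule (dgam G) x y (Cminus (gam G y) (gam G x))).
  { apply (@is_RInt_derive C_R_CompleteNormedModule).
    - intros t _. apply gam_deriv.
    - intros t _. apply dgam_continuous. }
  pose proof (@is_RInt_minus C_R_NormedModule _ _ _ _ _ _ H1
    (@is_RInt_const C_R_NormedModule x y z)) as H2.
  pose proof (@norm_RInt_le_const C_R_NormedModule _ _ _ _ e Hxy
    (fun t Ht => eq_ind _ (fun r => r <= e) (He t Ht) _ (eq_sym (Cmod_norm_R _))) H2) as H3.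
  rewrite Cmod_norm_R in H3. eapply Rle_trans; [|exact H3]. right.
  f_equal. unfold minus, plus, opp, scal; simpl.
  unfold prod_scal, prod_plus, prod_opp, scal; simpl. unfold mult, plus, opp; simpl.
  destruct (gam G y), (gam G x), z. unfold Cminus, Cplus, Copp, Cmult, RtoC; simpl.
  f_equal; ring.
Qed.

Lemma gam_lipschitz (G : contour) : exists L, 0 < L /\
  forall x y, Cmod (Cminus (gam G x) (gam G y)) <= L * Rabs (x - y).
Proof.
  destruct (dgam_bounds G) as (c & L & _ & HL & Hb). exists L. split; [exact HL|].
  pose proof PI_RGT_0 as HPI.
  assert (H0 : forall x y, -2 * PI <= x -> x <= y -> y <= 4 * PI ->
     Cmod (Cminus (gam G y) (gam G x)) <= L * (y - x)).
  { intros x y H1 H2 H3. pose proof (gam_increment G (RtoC 0) x y L H2) as H.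
    replace (Cminus (Cminus (gam G y) (gam G x)) (Cmult (RtoC (y - x)) (RtoC 0)))
      with (Cminus (gam G y) (gam G x)) in H by ring.
    rewrite Rmult_comm. apply H. intros t Ht.
    replace (Cminus (dgam G t) (RtoC 0)) with (dgam G t) by ring. apply Hb. lra. }
  assert (H1 : forall x y, x <= y -> Cmod (Cminus (gam G y) (gam G x)) <= L * (y - x)).
  (* Both points are moved into [[0, 4 PI)]; [y] loses [l >= 0] additional periods, which only
     shortens [y - x]. *)
  { intros x y Hxy. destruct (mod_2PI x) as [k Hk]. destruct (mod_2PI (y - x)) as [l Hl].
    rewrite <- (gam_period_Z G x (- k)), <- (gam_period_Z G y (- k - l)).
    rewrite minus_IZR, opp_IZR.
    eapply Rle_trans; [apply H0; lra|]. apply Rmult_le_compat_l; [lra|].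
    assert (0 <= IZR l).
    { apply IZR_le. assert (H2 : IZR l > -1) by nra. apply lt_IZR in H2. lia. }
    nra. }
  intros x y. destruct (Rle_lt_dec x y) as [H|H].
  - rewrite Cmod_minus_sym, Rabs_minus_sym, Rabs_pos_eq by lra. now apply H1.
  - rewrite Rabs_pos_eq by lra. apply H1. lra.
Qed.

Lemma gam_inj_near (G : contour) (x y : R) :
  Rabs (x - y) < 2 * PI -> gam G x = gam G y -> x = y.
Proof.
  intros Hxy E. apply Rabs_lt_between in Hxy.
  destruct (mod_2PI x) as [k Hk]. destruct (mod_2PI y) as [l Hl].
  assert (E' : x - IZR k * (2 * PI) = y - IZR l * (2 * PI)).
  { apply (gam_inj G); [exact Hk|exact Hl|].
    rewrite <- (gam_period_Z G _ k), <- (gam_period_Z G (y - _) l).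
    replace (x - IZR k * (2 * PI) + IZR k * (2 * PI)) with x by ring.
    replace (y - IZR l * (2 * PI) + IZR l * (2 * PI)) with y by ring. exact E. }
  pose proof PI_RGT_0.
  assert (k = l).
  { assert (H1 : IZR (k - l) < 1) by (rewrite minus_IZR; nra).
    assert (H2 : -1 < IZR (k - l)) by (rewrite minus_IZR; nra).
    apply lt_IZR in H1. apply lt_IZR in H2. lia. }
  subst l. lra.
Qed.

(** On the diagonal the bound comes from [dgam u <> 0], off it from injectivity, which keeps the
    chord away from zero. The same [d] is radius and constant, so that it can act as the gauge of a
    compactness argument. *)
Lemma gam_lower_local (G : contour) (u v : R) :
  Rabs (u - v) < 2 * PI -> exists d, 0 < d /\
    forall x y, Rabs (x - u) < d -> Rabs (y - v) < d ->
      d * Rabs (x - y) <= Cmod (Cminus (gam G x) (gam G y)).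
Proof.
  intros Huv. destruct (Req_dec u v) as [<-|Hne].
  - assert (Hc : 0 < Cmod (dgam G u)) by (apply Cmod_gt_0, gam_reg).
    set (c := Cmod (dgam G u)) in *.
    destruct (proj1 (continuous_C_iff _ _) (dgam_continuous G u) (c / 2)) as (d & Hd & H);
      [lra|].
    exists (Rmin d (c / 2)). split; [apply Rmin_pos; lra|].
    assert (Hord : forall x y, Rabs (x - u) < d -> Rabs (y - u) < d -> x <= y ->
      c / 2 * (y - x) <= Cmod (Cminus (gam G y) (gam G x))).
    { intros x y Hx Hy Hxy. apply Rabs_lt_between in Hx. apply Rabs_lt_between in Hy.
      pose proof (gam_increment G (dgam G u) x y (c / 2) Hxy) as Hi.
      assert (Hi' : forall t, x <= t <= y -> Cmod (Cminus (dgam G t) (dgam G u)) <= c / 2).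
      { intros t Ht. left. apply H. apply Rabs_lt_between. lra. }
      specialize (Hi Hi').
      assert (E : Cmod (Cmult (RtoC (y - x)) (dgam G u)) = (y - x) * c).
      { rewrite Cmod_mult, Cmod_R, Rabs_pos_eq by lra. reflexivity. }
      pose proof (Cmod_triangle (Cminus (gam G y) (gam G x))
        (Copp (Cminus (Cminus (gam G y) (gam G x)) (Cmult (RtoC (y - x)) (dgam G u))))) as Ht.
      rewrite Cmod_opp in Ht.
      replace (Cplus (Cminus (gam G y) (gam G x))
        (Copp (Cminus (Cminus (gam G y) (gam G x)) (Cmult (RtoC (y - x)) (dgam G u)))))
        with (Cmult (RtoC (y - x)) (dgam G u)) in Ht by ring.
      rewrite E in Ht. lra. }
    pose proof (Rmin_l d (c / 2)) as M1. pose proof (Rmin_r d (c / 2)) as M2.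
    intros x y Hx Hy.
    apply Rle_trans with (c / 2 * Rabs (x - y));
      [apply Rmult_le_compat_r; [apply Rabs_pos|lra]|].
    destruct (Rle_lt_dec x y) as [Hxy|Hxy].
    + rewrite Cmod_minus_sym, Rabs_minus_sym, Rabs_pos_eq by lra. apply Hord; lra.
    + rewrite Rabs_pos_eq by lra. apply Hord; lra.
  - assert (He : 0 < Cmod (Cminus (gam G u) (gam G v))).
    { apply Cmod_gt_0. intros E. apply Hne, (gam_inj_near G u v Huv).
      replace (gam G u) with (Cplus (Cminus (gam G u) (gam G v)) (gam G v)) by ring.
      rewrite E. ring. }
    set (e := Cmod (Cminus (gam G u) (gam G v))) in *.
    destruct (gam_lipschitz G) as (L & HL & Hlip). pose proof PI_RGT_0.
    (* With [d <= e / (4L)] each end of the chord moves by at most [e/4], leaving [e/2]; the other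
       two bounds give [|x - y| <= 2 PI + 2] and so [d |x - y| <= e/2]. *)
    set (d := Rmin 1 (Rmin (e / (4 * L)) (e / (2 * (2 * PI + 2))))).
    assert (Hd : 0 < d).
    { unfold d. repeat apply Rmin_pos; try lra; apply Rdiv_lt_0_compat; lra. }
    assert (D1 : d <= 1) by apply Rmin_l.
    assert (D2 : d <= e / (4 * L)) by (eapply Rle_trans; [apply Rmin_r|apply Rmin_l]).
    assert (D3 : d <= e / (2 * (2 * PI + 2)))
      by (eapply Rle_trans; [apply Rmin_r|apply Rmin_r]).
    exists d. split; [exact Hd|]. intros x y Hx Hy.
    apply Rmult_le_compat_r with (r := 4 * L) in D2; [|lra].
    replace (e / (4 * L) * (4 * L)) with e in D2 by (field; lra).
    apply Rmult_le_compat_r with (r := 2 * (2 * PI + 2)) in D3; [|lra].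
    replace (e / (2 * (2 * PI + 2)) * (2 * (2 * PI + 2))) with e in D3 by (field; lra).
    pose proof (Hlip u x) as L1. pose proof (Hlip y v) as L2.
    rewrite Rabs_minus_sym in L1.
    assert (L * Rabs (x - u) <= L * d) by (apply Rmult_le_compat_l; lra).
    assert (L * Rabs (y - v) <= L * d) by (apply Rmult_le_compat_l; lra).
    pose proof (Cmod_minus_triangle (gam G u) (gam G x) (gam G v)) as T1. fold e in T1.
    pose proof (Cmod_minus_triangle (gam G x) (gam G y) (gam G v)) as T2.
    assert (Rabs (x - y) <= 2 * PI + 2).
    { apply Rabs_lt_between in Hx. apply Rabs_lt_between in Hy.
      apply Rabs_lt_between in Huv. apply Rabs_le. lra. }
    assert (d * Rabs (x - y) <= d * (2 * PI + 2)) by (apply Rmult_le_compat_l; lra).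
    lra.
Qed.

(** A chord-arc inequality, from the local bounds by compactness of the square. Over a full period
    it fails, since the ends meet on the curve; it therefore covers the completed arcs only when
    there are at least two of them. *)
Lemma gam_lower (G : contour) (a b : R) :
  b - a < 2 * PI -> exists c, 0 < c /\
    forall x y, a <= x <= b -> a <= y <= b ->
      c * Rabs (x - y) <= Cmod (Cminus (gam G x) (gam G y)).
Proof.
  intros Hab.
  assert (H : forall u v, exists d : posreal, a <= u <= b -> a <= v <= b ->
    forall x y, Rabs (x - u) < d -> Rabs (y - v) < d ->
      d * Rabs (x - y) <= Cmod (Cminus (gam G x) (gam G y))).
  { intros u v. destruct (Rlt_dec (Rabs (u - v)) (2 * PI)) as [Huv|Huv].
    - destruct (gam_lower_local G u v Huv) as (d & Hd & H). exists (mkposreal d Hd).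
      intros _ _. exact H.
    - exists (mkposreal 1 Rlt_0_1). intros Hu Hv. exfalso. apply Huv.
      apply Rabs_lt_between. lra. }
  set (delta := fun u v => proj1_sig (constructive_indefinite_description _ (H u v))).
  destruct (compactness_value_2d a b a b delta) as [d Hd].
  exists d. split; [apply cond_pos|]. intros x y Hx Hy.
  (* The compactness lemma provides the covering pair under a double negation, hence the proof by
     contradiction. *)
  destruct (Rle_lt_dec (d * Rabs (x - y)) (Cmod (Cminus (gam G x) (gam G y)))) as [|Hlt];
    [assumption|].
  exfalso. apply (Hd x y Hx Hy). intros (u & v & Hu & Hv & H1 & H2 & H3).
  assert (H4 : delta u v * Rabs (x - y) <= Cmod (Cminus (gam G x) (gam G y)))
    by exact (proj2_sig (constructive_indefinite_description _ (H u v)) Hu Hv x y H1 H2).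
  pose proof (Rabs_pos (x - y)).
  assert (d * Rabs (x - y) <= delta u v * Rabs (x - y)) by (apply Rmult_le_compat_r; lra).
  lra.
Qed.

Lemma thd_le (D : nodes) (i j : nat) :
  (1 <= i)%nat -> (i <= j)%nat -> (j <= nd D)%nat -> thd D i <= thd D j.
Proof.
  intros H1 H2 H3. destruct (Nat.eq_dec i j) as [-> |]; [lra|].
  left. apply (thd_incr D); lia.
Qed.

Lemma arc_bounds (D : nodes) (j : nat) : (1 <= j <= nd D)%nat ->
  0 < thd D j /\ thd D j < arc_end D j /\ arc_end D j <= thd D j + 2 * PI /\
  arc_end D j < 4 * PI /\ (nd D <> 1%nat -> arc_end D j < thd D j + 2 * PI).
Proof.
  intros Hj. pose proof (nd_pos D) as Hn. pose proof PI_RGT_0.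
  pose proof (thd_range D j Hj). pose proof (thd_range D 1 ltac:(lia)).
  unfold arc_end. destruct (Nat.eqb_spec j (nd D)) as [E|E].
  - subst j. pose proof (thd_le D 1 (nd D) ltac:(lia) ltac:(lia) ltac:(lia)).
    repeat split; try lra. intros Hne.
    pose proof (thd_incr D 1 (nd D) ltac:(lia) ltac:(lia) ltac:(lia)). lra.
  - pose proof (thd_range D (S j) ltac:(lia)).
    pose proof (thd_incr D j (S j) ltac:(lia) ltac:(lia) ltac:(lia)).
    repeat split; lra.
Qed.

Lemma finite_positive_min (n : nat) (P : nat -> R -> Prop) :
  (forall j c d, P j c -> 0 < d <= c -> P j d) ->
  (forall j, (1 <= j <= n)%nat -> exists c, 0 < c /\ P j c) ->
  exists c, 0 < c /\ forall j, (1 <= j <= n)%nat -> P j c.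
Proof.
  intros Hmono. induction n as [|n IH]; intros H.
  - exists 1. split; [lra|]. intros; lia.
  - destruct IH as (c & Hc & HP); [intros; apply H; lia|].
    destruct (H (S n) ltac:(lia)) as (d & Hd & HPd).
    exists (Rmin c d). pose proof (Rmin_l c d). pose proof (Rmin_r c d).
    assert (0 < Rmin c d) by (apply Rmin_pos; lra).
    split; [assumption|]. intros j Hj. destruct (Nat.eq_dec j (S n)) as [-> |].
    + apply (Hmono _ d); [exact HPd|lra].
    + apply (Hmono _ c); [apply HP; lia|lra].
Qed.

Lemma arc_length_bounds (G : contour) : exists c L, 0 < c /\ 0 < L /\
  forall x y, 0 <= x <= 4 * PI -> 0 <= y <= 4 * PI ->
    c * Rabs (x - y) <= RInt (fun z => Cmod (dgam G z)) (Rmin x y) (Rmax x y)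
      <= L * Rabs (x - y).
Proof.
  destruct (dgam_bounds G) as (c & L & Hc & HL & Hb). exists c, L.
  split; [exact Hc|]. split; [exact HL|]. intros x y Hx Hy. pose proof PI_RGT_0.
  assert (Hm : Rmin x y <= Rmax x y) by (eapply Rle_trans; [apply Rmin_l|apply Rmax_l]).
  assert (Ha : Rabs (x - y) = Rmax x y - Rmin x y).
  { unfold Rmax, Rmin. destruct (Rle_dec x y).
    - rewrite Rabs_minus_sym, Rabs_pos_eq; lra.
    - rewrite Rabs_pos_eq; lra. }
  assert (Hin : forall z, Rmin x y < z < Rmax x y -> -2 * PI <= z <= 4 * PI).
  { intros z Hz. revert Hz. unfold Rmin, Rmax. destruct (Rle_dec x y); lra. }
  assert (Hex : ex_RInt (fun z => Cmod (dgam G z)) (Rmin x y) (Rmax x y)).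
  { apply (@ex_RInt_continuous R_CompleteNormedModule). intros z _.
    apply continuous_Cmod, dgam_continuous. }
  rewrite Ha. split.
  - replace (c * (Rmax x y - Rmin x y)) with (RInt (fun _ => c) (Rmin x y) (Rmax x y)).
    + apply RInt_le; [exact Hm|apply ex_RInt_const|exact Hex|]. intros z Hz. apply Hb; auto.
    + rewrite RInt_const. unfold scal; simpl. unfold mult; simpl. ring.
  - replace (L * (Rmax x y - Rmin x y)) with (RInt (fun _ => L) (Rmin x y) (Rmax x y)).
    + apply RInt_le; [exact Hm|exact Hex|apply ex_RInt_const|]. intros z Hz. apply Hb; auto.
    + rewrite RInt_const. unfold scal; simpl. unfold mult; simpl. ring.
Qed.

(** With several nodes this is the chord-arc inequality. With one node the arc spans a whole period,
    [arc_dist] is arc length, and the positive minimum of [|dgam|] gives the bound. *)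
Lemma arc_dist_lower (G : contour) (D : nodes) : exists c, 0 < c /\
  forall j, (1 <= j <= nd D)%nat -> forall x y, in_arc D j x -> in_arc D j y ->
    c * Rabs (x - y) <= arc_dist G D x y.
Proof.
  apply (finite_positive_min (nd D) (fun j c => forall x y, in_arc D j x -> in_arc D j y ->
    c * Rabs (x - y) <= arc_dist G D x y)).
  { intros j c d H Hd x y Hx Hy. eapply Rle_trans; [|apply (H x y Hx Hy)].
    apply Rmult_le_compat_r; [apply Rabs_pos|lra]. }
  intros j Hj. destruct (arc_bounds D j Hj) as (B1 & B2 & B3 & B4 & B5).
  unfold arc_dist, in_arc. destruct (Nat.eqb_spec (nd D) 1) as [E|E].
  - destruct (arc_length_bounds G) as (c & L & Hc & HL & Hb). exists c.
    split; [exact Hc|]. intros x y Hx Hy. apply Hb; lra.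
  - destruct (gam_lower G (thd D j) (arc_end D j)) as (c & Hc & H); [specialize (B5 E); lra|].
    exists c. split; [exact Hc|]. exact H.
Qed.

Lemma arc_dist_upper (G : contour) (D : nodes) : exists L, 0 < L /\
  forall j, (1 <= j <= nd D)%nat -> forall x y, in_arc D j x -> in_arc D j y ->
    arc_dist G D x y <= L * Rabs (x - y).
Proof.
  unfold arc_dist. destruct (Nat.eqb_spec (nd D) 1) as [E|E].
  - destruct (arc_length_bounds G) as (c & L & Hc & HL & Hb). exists L.
    split; [exact HL|]. intros j Hj x y Hx Hy.
    destruct (arc_bounds D j Hj) as (B1 & B2 & B3 & B4 & B5).
    unfold in_arc in *. apply Hb; lra.
  - destruct (gam_lipschitz G) as (L & HL & H). exists L. split; [exact HL|].
    intros j _ x y _ _. apply H.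
Qed.

(** * The space [X] and its norm *)

Lemma lim_plus_unique (G : contour) (v : Gamma G -> C) (x : R) (l l' : C) :
  lim_plus G v x l -> lim_plus G v x l' -> l = l'.
Proof.
  apply (@filterlim_locally_unique R R_AbsRing C_R_NormedModule (at_right x) _).
Qed.

Lemma lim_minus_unique (G : contour) (v : Gamma G -> C) (x : R) (l l' : C) :
  lim_minus G v x l -> lim_minus G v x l' -> l = l'.
Proof.
  apply (@filterlim_locally_unique R R_AbsRing C_R_NormedModule (at_left x) _).
Qed.

Lemma val_plus_eq (G : contour) (v : Gamma G -> C) (x : R) (l : C) :
  lim_plus G v x l -> val_plus G v x = l.
Proof.
  intros H. apply (lim_plus_unique G v x); [|exact H].
  unfold val_plus. apply epsilon_spec. now exists l.
Qed.

Lemma val_minus_eq (G : contour) (v : Gamma G -> C) (x : R) (l : C) :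
  lim_minus G v x l -> val_minus G v x = l.
Proof.
  intros H. apply (lim_minus_unique G v x); [|exact H].
  unfold val_minus. apply epsilon_spec. now exists l.
Qed.

Lemma Cmod_minus_plus_le (x y x' y' : C) :
  Cmod (Cminus (Cplus x y) (Cplus x' y')) <= Cmod (Cminus x x') + Cmod (Cminus y y').
Proof.
  replace (Cminus (Cplus x y) (Cplus x' y')) with (Cplus (Cminus x x') (Cminus y y')) by ring.
  apply Cmod_triangle.
Qed.

Lemma Cmod_minus_scal (a x x' : C) :
  Cmod (Cminus (Cmult a x) (Cmult a x')) = Cmod a * Cmod (Cminus x x').
Proof. rewrite <- Cmod_mult. f_equal. ring. Qed.

Lemma lim_plus_plus (G : contour) (v w : Gamma G -> C) (x : R) (l l' : C) :
  lim_plus G v x l -> lim_plus G w x l' ->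
  lim_plus G (fun t => Cplus (v t) (w t)) x (Cplus l l').
Proof.
  intros H1 H2. apply lim_plus_iff. intros e He.
  destruct (proj1 (lim_plus_iff _ _ _ _) H1 (e / 2)) as (d1 & P1 & D1); [lra|].
  destruct (proj1 (lim_plus_iff _ _ _ _) H2 (e / 2)) as (d2 & P2 & D2); [lra|].
  pose proof (Rmin_l d1 d2). pose proof (Rmin_r d1 d2).
  exists (Rmin d1 d2). split; [now apply Rmin_pos|]. intros y Hy.
  eapply Rle_lt_trans; [apply Cmod_minus_plus_le|].
  specialize (D1 y ltac:(lra)). specialize (D2 y ltac:(lra)). lra.
Qed.

Lemma lim_minus_plus (G : contour) (v w : Gamma G -> C) (x : R) (l l' : C) :
  lim_minus G v x l -> lim_minus G w x l' ->
  lim_minus G (fun t => Cplus (v t) (w t)) x (Cplus l l').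
Proof.
  intros H1 H2. apply lim_minus_iff. intros e He.
  destruct (proj1 (lim_minus_iff _ _ _ _) H1 (e / 2)) as (d1 & P1 & D1); [lra|].
  destruct (proj1 (lim_minus_iff _ _ _ _) H2 (e / 2)) as (d2 & P2 & D2); [lra|].
  pose proof (Rmin_l d1 d2). pose proof (Rmin_r d1 d2).
  exists (Rmin d1 d2). split; [now apply Rmin_pos|]. intros y Hy.
  eapply Rle_lt_trans; [apply Cmod_minus_plus_le|].
  specialize (D1 y ltac:(lra)). specialize (D2 y ltac:(lra)). lra.
Qed.

Lemma scal_small (a : C) (e : R) : 0 < e -> exists e', 0 < e' /\
  forall z, Cmod z < e' -> Cmod a * Cmod z < e.
Proof.
  intros He. pose proof (Cmod_ge_0 a). exists (e / (Cmod a + 1)).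
  split; [apply Rdiv_lt_0_compat; lra|]. intros z Hz.
  apply Rmult_lt_compat_r with (r := Cmod a + 1) in Hz; [|lra].
  replace (e / (Cmod a + 1) * (Cmod a + 1)) with e in Hz by (field; lra).
  pose proof (Cmod_ge_0 z). nra.
Qed.

Lemma lim_plus_scal (G : contour) (a : C) (v : Gamma G -> C) (x : R) (l : C) :
  lim_plus G v x l -> lim_plus G (fun t => Cmult a (v t)) x (Cmult a l).
Proof.
  intros H1. apply lim_plus_iff. intros e He.
  destruct (scal_small a e He) as (e' & He' & Ha).
  destruct (proj1 (lim_plus_iff _ _ _ _) H1 e' He') as (d1 & P1 & D1).
  exists d1. split; [exact P1|]. intros y Hy. rewrite Cmod_minus_scal. auto.
Qed.

Lemma lim_minus_scal (G : contour) (a : C) (v : Gamma G -> C) (x : R) (l : C) :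
  lim_minus G v x l -> lim_minus G (fun t => Cmult a (v t)) x (Cmult a l).
Proof.
  intros H1. apply lim_minus_iff. intros e He.
  destruct (scal_small a e He) as (e' & He' & Ha).
  destruct (proj1 (lim_minus_iff _ _ _ _) H1 e' He') as (d1 & P1 & D1).
  exists d1. split; [exact P1|]. intros y Hy. rewrite Cmod_minus_scal. auto.
Qed.

Lemma in_X_plus (G : contour) (D : nodes) (s : R) (v w : Gamma G -> C) :
  in_X G D s v -> in_X G D s w -> in_X G D s (fun t => Cplus (v t) (w t)).
Proof.
  intros [V1 V2] [W1 W2]. split; intros j Hj.
  - destruct (V1 j Hj) as [A1 [l L1]]. destruct (W1 j Hj) as [A2 [l' L2]].
    split; [now apply (lim_minus_plus G v w)|]. exists (Cplus l l').
    now apply lim_plus_plus.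
  - destruct (V2 j Hj) as [M HM]. destruct (W2 j Hj) as [M' HM'].
    exists (M + M'). intros x y Hx Hy.
    eapply Rle_trans; [apply Cmod_minus_plus_le|].
    specialize (HM x y Hx Hy). specialize (HM' x y Hx Hy). lra.
Qed.

Lemma in_X_scal (G : contour) (D : nodes) (s : R) (a : C) (v : Gamma G -> C) :
  in_X G D s v -> in_X G D s (fun t => Cmult a (v t)).
Proof.
  intros [V1 V2]. split; intros j Hj.
  - destruct (V1 j Hj) as [A1 [l L1]].
    split; [now apply (lim_minus_scal G a v)|]. exists (Cmult a l).
    now apply lim_plus_scal.
  - destruct (V2 j Hj) as [M HM].
    exists (Cmod a * M). intros x y Hx Hy. rewrite Cmod_minus_scal, Rmult_assoc.
    apply Rmult_le_compat_l; [apply Cmod_ge_0|now apply HM].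
Qed.

Lemma arc_val_inside (G : contour) (D : nodes) (v : Gamma G -> C) (j : nat) (x : R) :
  thd D j < x < arc_end D j -> arc_val G D v j x = v (pt G x).
Proof.
  intros H. unfold arc_val. destruct (Req_EM_T x (thd D j)); [lra|].
  destruct (Req_EM_T x (arc_end D j)); [lra|reflexivity].
Qed.

Lemma arc_val_start (G : contour) (D : nodes) (s : R) (v : Gamma G -> C) (j : nat) :
  (1 <= j <= nd D)%nat -> in_X G D s v -> lim_plus G v (thd D j) (arc_val G D v j (thd D j)).
Proof.
  intros Hj [V1 _]. destruct (V1 j Hj) as [_ [l Hl]]. unfold arc_val.
  destruct (Req_EM_T (thd D j) (thd D j)); [|easy]. now rewrite (val_plus_eq G v _ l).
Qed.

Lemma lim_minus_arc_end (G : contour) (D : nodes) (s : R) (v : Gamma G -> C) (j : nat) :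
  (1 <= j <= nd D)%nat -> in_X G D s v ->
  lim_minus G v (arc_end D j) (v (pt G (arc_end D j))).
Proof.
  intros Hj [V1 _]. unfold arc_end. destruct (Nat.eqb_spec j (nd D)) as [E|E].
  - rewrite pt_period. destruct (V1 1%nat ltac:(lia)) as [H _].
    apply lim_minus_iff. intros e He.
    destruct (proj1 (lim_minus_iff _ _ _ _) H e He) as (d & Hd & Hy).
    exists d. split; [exact Hd|]. intros y Hyd.
    replace y with (y - 2 * PI + 2 * PI) by ring. rewrite pt_period. apply Hy. lra.
  - apply V1. lia.
Qed.

(** Functions are represented by incoming values, so only the left end of a completed arc carries a
    value that [v] does not already have there. *)
Lemma arc_val_left (G : contour) (D : nodes) (s : R) (v : Gamma G -> C) (j : nat) (x : R) :
  (1 <= j <= nd D)%nat -> in_X G D s v -> thd D j < x <= arc_end D j ->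
  arc_val G D v j x = v (pt G x).
Proof.
  intros Hj Hv Hx. unfold arc_val. destruct (Req_EM_T x (thd D j)); [lra|].
  destruct (Req_EM_T x (arc_end D j)) as [-> |]; [|reflexivity].
  apply val_minus_eq. now apply (lim_minus_arc_end G D s).
Qed.

(** At the left end the value is a choice made by [epsilon]; it is additive because the limits exist
    and are unique. *)
Lemma arc_val_plus (G : contour) (D : nodes) (s : R) (v w : Gamma G -> C) (j : nat) (x : R) :
  (1 <= j <= nd D)%nat -> in_X G D s v -> in_X G D s w -> in_arc D j x ->
  arc_val G D (fun t => Cplus (v t) (w t)) j x
    = Cplus (arc_val G D v j x) (arc_val G D w j x).
Proof.
  intros Hj Hv Hw Hx. destruct (Req_dec x (thd D j)) as [-> |Hne].
  - apply (lim_plus_unique G (fun t => Cplus (v t) (w t)) (thd D j)).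
    + apply (arc_val_start G D s); [exact Hj|now apply in_X_plus].
    + apply lim_plus_plus; now apply (arc_val_start G D s).
  - unfold in_arc in Hx. rewrite !(arc_val_left G D s); try lra; try easy.
    now apply in_X_plus.
Qed.

Lemma arc_val_scal (G : contour) (D : nodes) (s : R) (a : C) (v : Gamma G -> C) (j : nat) (x : R) :
  (1 <= j <= nd D)%nat -> in_X G D s v -> in_arc D j x ->
  arc_val G D (fun t => Cmult a (v t)) j x = Cmult a (arc_val G D v j x).
Proof.
  intros Hj Hv Hx. destruct (Req_dec x (thd D j)) as [-> |Hne].
  - apply (lim_plus_unique G (fun t => Cmult a (v t)) (thd D j)).
    + apply (arc_val_start G D s); [exact Hj|now apply in_X_scal].
    + apply lim_plus_scal; now apply (arc_val_start G D s).
  - unfold in_arc in Hx. rewrite !(arc_val_left G D s); try lra; try easy.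
    now apply in_X_scal.
Qed.

(** An endpoint is replaced by an interior point close in value and not beyond the midpoint of [x]
    and [y]. Distances then do not increase, and the error [e] is arbitrary. *)
Lemma holder_closure (f : R -> C) (a b M s : R) :
  a < b -> 0 <= M -> 0 <= s ->
  (forall x y, a < x < b -> a < y < b ->
     Cmod (Cminus (f x) (f y)) <= M * hpow (Rabs (x - y)) s) ->
  (forall e, 0 < e -> exists d, 0 < d /\
     forall y, a < y < a + d -> Cmod (Cminus (f y) (f a)) < e) ->
  (forall e, 0 < e -> exists d, 0 < d /\
     forall y, b - d < y < b -> Cmod (Cminus (f y) (f b)) < e) ->
  forall x y, a <= x <= b -> a <= y <= b ->
    Cmod (Cminus (f x) (f y)) <= M * hpow (Rabs (x - y)) s.
Proof.
  intros Hab HM Hs Hin Ha Hb.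
  assert (Hord : forall x y, a <= x -> x < y -> y <= b ->
    Cmod (Cminus (f x) (f y)) <= M * hpow (Rabs (x - y)) s).
  { intros x y Hx Hxy Hy. apply le_epsilon. intros e He.
    assert (Hx' : exists x', a < x' < b /\ x <= x' <= (x + y) / 2 /\
       Cmod (Cminus (f x) (f x')) <= e / 2).
    { destruct (Rle_lt_or_eq_dec a x Hx) as [H|H].
      - exists x. repeat split; try lra.
        replace (Cminus (f x) (f x)) with (RtoC 0) by ring. rewrite Cmod_0. lra.
      - subst x. destruct (Ha (e / 2)) as (d & Hd & H); [lra|].
        pose proof (Rmin_l (d / 2) ((y - a) / 2)). pose proof (Rmin_r (d / 2) ((y - a) / 2)).
        assert (0 < Rmin (d / 2) ((y - a) / 2)) by (apply Rmin_pos; lra).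
        exists (a + Rmin (d / 2) ((y - a) / 2)). repeat split; try lra.
        rewrite Cmod_minus_sym. left. apply H. lra. }
    assert (Hy' : exists y', a < y' < b /\ (x + y) / 2 <= y' <= y /\
       Cmod (Cminus (f y') (f y)) <= e / 2).
    { destruct (Rle_lt_or_eq_dec y b Hy) as [H|H].
      - exists y. repeat split; try lra.
        replace (Cminus (f y) (f y)) with (RtoC 0) by ring. rewrite Cmod_0. lra.
      - subst y. destruct (Hb (e / 2)) as (d & Hd & H); [lra|].
        pose proof (Rmin_l (d / 2) ((b - x) / 2)). pose proof (Rmin_r (d / 2) ((b - x) / 2)).
        assert (0 < Rmin (d / 2) ((b - x) / 2)) by (apply Rmin_pos; lra).
        exists (b - Rmin (d / 2) ((b - x) / 2)). repeat split; try lra.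
        left. apply H. lra. }
    destruct Hx' as (x' & X1 & X2 & X3). destruct Hy' as (y' & Y1 & Y2 & Y3).
    pose proof (Cmod_minus_triangle (f x) (f x') (f y)).
    pose proof (Cmod_minus_triangle (f x') (f y') (f y)).
    specialize (Hin x' y' X1 Y1).
    assert (M * hpow (Rabs (x' - y')) s <= M * hpow (Rabs (x - y)) s).
    { apply Rmult_le_compat_l; [exact HM|]. apply hpow_le; [exact Hs|].
      rewrite !Rabs_left1; lra. }
    lra. }
  intros x y Hx Hy. destruct (Rtotal_order x y) as [H|[-> |H]].
  - apply Hord; lra.
  - replace (Cminus (f y) (f y)) with (RtoC 0) by ring. rewrite Cmod_0.
    apply Rmult_le_pos; [exact HM|apply hpow_nonneg].
  - rewrite Cmod_minus_sym, Rabs_minus_sym. apply Hord; lra.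
Qed.

Lemma arc_val_holder (G : contour) (D : nodes) (s : R) (v : Gamma G -> C) (j : nat) :
  0 < s -> (1 <= j <= nd D)%nat -> in_X G D s v ->
  exists M, 0 <= M /\ forall x y, in_arc D j x -> in_arc D j y ->
    Cmod (Cminus (arc_val G D v j x) (arc_val G D v j y)) <= M * hpow (Rabs (x - y)) s.
Proof.
  intros Hs Hj Hv. destruct (arc_bounds D j Hj) as (B1 & B2 & B3 & B4 & _).
  destruct (proj2 Hv j Hj) as [M HM]. destruct (arc_dist_upper G D) as (L & HL & HLd).
  assert (HM0 : 0 <= Rabs M * hpow L s)
    by (apply Rmult_le_pos; [apply Rabs_pos|apply hpow_nonneg]).
  exists (Rabs M * hpow L s). split; [exact HM0|].
  apply (holder_closure (arc_val G D v j)); [exact B2|exact HM0|lra| | |].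
  - intros x y Hx Hy. rewrite !arc_val_inside by assumption.
    eapply Rle_trans; [apply HM; assumption|].
    apply Rle_trans with (Rabs M * hpow (L * Rabs (x - y)) s).
    + apply Rle_trans with (Rabs M * hpow (arc_dist G D x y) s).
      * apply Rmult_le_compat_r; [apply hpow_nonneg|apply Rle_abs].
      * apply Rmult_le_compat_l; [apply Rabs_pos|]. apply hpow_le; [lra|].
        apply (HLd j Hj); unfold in_arc; lra.
    + rewrite hpow_mult by (try apply Rabs_pos; lra). lra.
  - intros e He.
    destruct (proj1 (lim_plus_iff _ _ _ _) (arc_val_start G D s v j Hj Hv) e He)
      as (d & Hd & H).
    pose proof (Rmin_l d (arc_end D j - thd D j)). pose proof (Rmin_r d (arc_end D j - thd D j)).
    exists (Rmin d (arc_end D j - thd D j)). split; [apply Rmin_pos; lra|].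
    intros y Hy. rewrite (arc_val_inside G D v j y) by lra. apply H. lra.
  - intros e He.
    destruct (proj1 (lim_minus_iff _ _ _ _) (lim_minus_arc_end G D s v j Hj Hv) e He)
      as (d & Hd & H).
    pose proof (Rmin_l d (arc_end D j - thd D j)). pose proof (Rmin_r d (arc_end D j - thd D j)).
    exists (Rmin d (arc_end D j - thd D j)). split; [apply Rmin_pos; lra|].
    intros y Hy. rewrite (arc_val_inside G D v j y) by lra.
    rewrite (arc_val_left G D s v j (arc_end D j)) by (try assumption; lra).
    apply H. lra.
Qed.

(** [0 <= B] covers the empty set, whose supremum is minus infinity and is read as 0 by [real]. *)
Lemma Lub_real_le (E : R -> Prop) (B : R) :
  0 <= B -> (forall r, E r -> r <= B) -> real (Lub_Rbar E) <= B.
Proof.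
  intros HB H. destruct (Lub_Rbar_correct E) as [_ Hl].
  specialize (Hl (Finite B) (fun r Hr => H r Hr)).
  destruct (Lub_Rbar E) as [l| |]; simpl in *; [exact Hl|destruct Hl|exact HB].
Qed.

Lemma Lub_real_ge (E : R -> Prop) (B r : R) :
  (forall r, E r -> r <= B) -> E r -> r <= real (Lub_Rbar E).
Proof.
  intros H Hr. destruct (Lub_Rbar_correct E) as [Hu Hl].
  specialize (Hl (Finite B) (fun r Hr => H r Hr)). specialize (Hu r Hr).
  destruct (Lub_Rbar E) as [l| |]; simpl in *; [exact Hu|destruct Hl|destruct Hu].
Qed.

(** Bounds in product form, without suprema or quotients and with [x = y] allowed. The norm is
    handled through this predicate, translated in both directions by [X_norm_le] and
    [X_norm_arc_bound]. *)
Definition arc_bound (G : contour) (D : nodes) (s : R) (v : Gamma G -> C) (j : nat)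
    (S H : R) : Prop :=
  (forall x, in_arc D j x -> Cmod (arc_val G D v j x) <= S) /\
  (forall x y, in_arc D j x -> in_arc D j y ->
     Cmod (Cminus (arc_val G D v j x) (arc_val G D v j y)) <= H * hpow (arc_dist G D x y) s).

Lemma X_norm_le (G : contour) (D : nodes) (s B : R) (v : Gamma G -> C) :
  0 <= B ->
  (forall j, (1 <= j <= nd D)%nat ->
     exists S H, 0 <= S /\ 0 <= H /\ S + H <= B /\ arc_bound G D s v j S H) ->
  X_norm G D s v <= B.
Proof.
  intros HB H. destruct (arc_dist_lower G D) as (c & Hc & Hlow).
  assert (Hterm : forall j, (1 <= j <= nd D)%nat ->
    real (arc_sup G D v j) + real (arc_semi G D s v j) <= B).
  { intros j Hj. destruct (H j Hj) as (S & K & HS & HK & HSK & H1 & H2).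
    assert (real (arc_sup G D v j) <= S).
    { apply Lub_real_le; [exact HS|]. intros r (x & Hx & ->). now apply H1. }
    assert (real (arc_semi G D s v j) <= K).
    { apply Lub_real_le; [exact HK|]. intros r (x & y & Hx & Hy & Hxy & ->).
      assert (0 < hpow (arc_dist G D x y) s).
      { apply hpow_pos. eapply Rlt_le_trans; [|apply (Hlow j Hj x y Hx Hy)].
        apply Rmult_lt_0_compat; [exact Hc|]. apply Rabs_pos_lt. lra. }
      apply Rmult_le_reg_r with (hpow (arc_dist G D x y) s); [assumption|].
      unfold Rdiv. rewrite Rmult_assoc, Rinv_l, Rmult_1_r by lra. now apply H2. }
    lra. }
  unfold X_norm.
  assert (Hseq : forall l, (forall j, In j l -> (1 <= j <= nd D)%nat) ->
    fold_right Rmax 0 (map (fun j => real (arc_sup G D v j) + real (arc_semi G D s v j)) l)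
      <= B).
  { induction l as [|j l IH]; intros Hl; simpl; [exact HB|].
    apply Rmax_lub; [apply Hterm, Hl; now left|apply IH; intros; apply Hl; now right]. }
  apply Hseq. intros j Hj. apply in_seq in Hj. lia.
Qed.

Lemma X_norm_nonneg (G : contour) (D : nodes) (s : R) (v : Gamma G -> C) :
  0 <= X_norm G D s v.
Proof.
  unfold X_norm. induction (seq 1 (nd D)); simpl; [lra|].
  eapply Rle_trans; [|apply Rmax_r]. assumption.
Qed.

(** The witnesses are the suprema themselves. Since [real] sends infinity to 0, both sets must first
    be bounded, and this is where [in_X] enters, through [arc_val_holder]. *)
Lemma X_norm_arc_bound (G : contour) (D : nodes) (s : R) (v : Gamma G -> C) (j : nat) :
  0 < s -> in_X G D s v -> (1 <= j <= nd D)%nat ->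
  exists S H, 0 <= S /\ 0 <= H /\ S + H <= X_norm G D s v /\ arc_bound G D s v j S H.
Proof.
  intros Hs Hv Hj. destruct (arc_bounds D j Hj) as (B1 & B2 & B3 & B4 & _).
  destruct (arc_val_holder G D s v j Hs Hj Hv) as (M & HM & Hhol).
  destruct (arc_dist_lower G D) as (c & Hc & Hlow).
  assert (Hpos : forall x y, in_arc D j x -> in_arc D j y -> x <> y ->
     0 < hpow (arc_dist G D x y) s).
  { intros x y Hx Hy Hxy. apply hpow_pos.
    eapply Rlt_le_trans; [|apply (Hlow j Hj x y Hx Hy)].
    apply Rmult_lt_0_compat; [exact Hc|]. apply Rabs_pos_lt. lra. }
  assert (Hin1 : in_arc D j (thd D j)) by (unfold in_arc; lra).
  assert (Hin2 : in_arc D j (arc_end D j)) by (unfold in_arc; lra).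
  assert (Hsup : forall x, in_arc D j x -> Cmod (arc_val G D v j x) <= real (arc_sup G D v j)).
  { intros x Hx. apply (Lub_real_ge _
      (Cmod (arc_val G D v j (thd D j)) + M * hpow (2 * PI) s)); [|now exists x].
    intros r (y & Hy & ->).
    pose proof (Hhol y (thd D j) Hy Hin1) as H1.
    assert (H2 : M * hpow (Rabs (y - thd D j)) s <= M * hpow (2 * PI) s).
    { apply Rmult_le_compat_l; [exact HM|]. apply hpow_le; [lra|].
      unfold in_arc in Hy. rewrite Rabs_pos_eq; lra. }
    replace (arc_val G D v j y) with
      (Cplus (Cminus (arc_val G D v j y) (arc_val G D v j (thd D j)))
             (arc_val G D v j (thd D j))) by ring.
    eapply Rle_trans; [apply Cmod_triangle|]. lra. }
  assert (Hsemi : forall x y, in_arc D j x -> in_arc D j y -> x <> y ->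
     Cmod (Cminus (arc_val G D v j x) (arc_val G D v j y)) / hpow (arc_dist G D x y) s
       <= real (arc_semi G D s v j)).
  { intros x y Hx Hy Hxy. apply (Lub_real_ge _ (M * hpow (/ c) s)); [|now exists x, y].
    intros r (x' & y' & Hx' & Hy' & Hxy' & ->). specialize (Hpos x' y' Hx' Hy' Hxy').
    apply Rmult_le_reg_r with (hpow (arc_dist G D x' y') s); [exact Hpos|].
    unfold Rdiv. rewrite Rmult_assoc, Rinv_l, Rmult_1_r by lra.
    eapply Rle_trans; [apply Hhol; assumption|].
    rewrite Rmult_assoc. apply Rmult_le_compat_l; [exact HM|].
    pose proof (Hlow j Hj x' y' Hx' Hy') as Hl. pose proof (Rabs_pos (x' - y')).
    assert (Hci : 0 < / c) by now apply Rinv_0_lt_compat.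
    assert (0 <= arc_dist G D x' y').
    { eapply Rle_trans; [|exact Hl]. apply Rmult_le_pos; lra. }
    rewrite <- hpow_mult by lra. apply hpow_le; [lra|].
    replace (Rabs (x' - y')) with (/ c * (c * Rabs (x' - y'))) by (field; lra).
    apply Rmult_le_compat_l; lra. }
  exists (real (arc_sup G D v j)), (real (arc_semi G D s v j)). repeat split.
  - eapply Rle_trans; [apply Cmod_ge_0|apply (Hsup _ Hin1)].
  - eapply Rle_trans; [|apply (Hsemi _ _ Hin1 Hin2); lra].
    unfold Rdiv. apply Rmult_le_pos; [apply Cmod_ge_0|].
    left. apply Rinv_0_lt_compat, Hpos; try assumption. lra.
  - unfold X_norm. assert (Hj' : In j (seq 1 (nd D))) by (apply in_seq; lia).
    induction (seq 1 (nd D)) as [|i l IH]; simpl in *; [easy|].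
    destruct Hj' as [<-|Hj']; [apply Rmax_l|].
    eapply Rle_trans; [now apply IH|apply Rmax_r].
  - exact Hsup.
  - intros x y Hx Hy. destruct (Req_dec x y) as [<-|Hxy].
    + replace (Cminus (arc_val G D v j x) (arc_val G D v j x)) with (RtoC 0) by ring.
      rewrite Cmod_0. apply Rmult_le_pos; [|apply hpow_nonneg].
      eapply Rle_trans; [|apply (Hsemi _ _ Hin1 Hin2); lra].
      unfold Rdiv. apply Rmult_le_pos; [apply Cmod_ge_0|].
      left. apply Rinv_0_lt_compat, Hpos; try assumption. lra.
    + specialize (Hsemi x y Hx Hy Hxy). specialize (Hpos x y Hx Hy Hxy).
      apply Rmult_le_compat_r with (r := hpow (arc_dist G D x y) s) in Hsemi; [|lra].
      unfold Rdiv in Hsemi. rewrite Rmult_assoc, Rinv_l, Rmult_1_r in Hsemi by lra.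
      exact Hsemi.
Qed.

Lemma X_norm_plus (G : contour) (D : nodes) (s : R) (v w : Gamma G -> C) :
  0 < s -> in_X G D s v -> in_X G D s w ->
  X_norm G D s (fun t => Cplus (v t) (w t)) <= X_norm G D s v + X_norm G D s w.
Proof.
  intros Hs Hv Hw. apply X_norm_le.
  - pose proof (X_norm_nonneg G D s v). pose proof (X_norm_nonneg G D s w). lra.
  - intros j Hj.
    destruct (X_norm_arc_bound G D s v j Hs Hv Hj) as (S1 & H1 & P1 & Q1 & E1 & A1 & B1).
    destruct (X_norm_arc_bound G D s w j Hs Hw Hj) as (S2 & H2 & P2 & Q2 & E2 & A2 & B2).
    exists (S1 + S2), (H1 + H2). repeat split; try lra.
    + intros x Hx. rewrite (arc_val_plus G D s) by assumption.
      eapply Rle_trans; [apply Cmod_triangle|]. apply Rplus_le_compat; auto.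
    + intros x y Hx Hy. rewrite !(arc_val_plus G D s) by assumption.
      eapply Rle_trans; [apply Cmod_minus_plus_le|].
      rewrite Rmult_plus_distr_r. apply Rplus_le_compat; auto.
Qed.

Lemma X_norm_scal (G : contour) (D : nodes) (s : R) (a : C) (v : Gamma G -> C) :
  0 < s -> in_X G D s v ->
  X_norm G D s (fun t => Cmult a (v t)) <= Cmod a * X_norm G D s v.
Proof.
  intros Hs Hv. pose proof (Cmod_ge_0 a) as Ha. apply X_norm_le.
  - apply Rmult_le_pos; [exact Ha|apply X_norm_nonneg].
  - intros j Hj.
    destruct (X_norm_arc_bound G D s v j Hs Hv Hj) as (S1 & H1 & P1 & Q1 & E1 & A1 & B1).
    exists (Cmod a * S1), (Cmod a * H1). repeat split.
    + now apply Rmult_le_pos.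
    + now apply Rmult_le_pos.
    + rewrite <- Rmult_plus_distr_l. now apply Rmult_le_compat_l.
    + intros x Hx. rewrite (arc_val_scal G D s) by assumption. rewrite Cmod_mult.
      apply Rmult_le_compat_l; auto.
    + intros x y Hx Hy. rewrite !(arc_val_scal G D s) by assumption.
      rewrite Cmod_minus_scal, Rmult_assoc. apply Rmult_le_compat_l; auto.
Qed.

(** Arcs are taken closed at their incoming end, so a discontinuity point belongs to the arc that
    ends there. Parameters up to [thd D 1] are advanced by one period, as the last arc runs through
    the cut. *)
Lemma arc_cover (G : contour) (D : nodes) (t : Gamma G) :
  exists j x, (1 <= j <= nd D)%nat /\ thd D j < x <= arc_end D j /\ pt G x = t.
Proof.
  pose proof (nd_pos D) as Hn. pose proof PI_RGT_0.
  assert (Hx : exists x, thd D 1 < x <= thd D 1 + 2 * PI /\ pt G x = t).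
  { destruct (pt_surj_range G t) as (x & Hx & <-).
    pose proof (thd_range D 1 ltac:(lia)). destruct (Rlt_le_dec (thd D 1) x) as [H1|H1].
    - exists x. split; [lra|reflexivity].
    - exists (x + 2 * PI). split; [lra|apply pt_period]. }
  destruct Hx as (x & Hx & Et).
  destruct (Rlt_le_dec (thd D (nd D)) x) as [H1|H1].
  { exists (nd D), x. split; [lia|]. unfold arc_end. rewrite Nat.eqb_refl. split; [lra|easy]. }
  assert (Hind : forall n, (1 <= n <= nd D)%nat -> x <= thd D n ->
     exists j, (1 <= j < n)%nat /\ thd D j < x <= thd D (S j)).
  { induction n as [|n IH]; intros Hn' Hxn; [lia|].
    destruct n as [|n]; [lra|].
    destruct (Rle_lt_dec x (thd D (S n))) as [H2|H2].
    - destruct (IH ltac:(lia) H2) as (j & Hj & Hxj). exists j. split; [lia|exact Hxj].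
    - exists (S n). split; [lia|lra]. }
  destruct (Hind (nd D) ltac:(lia) H1) as (j & Hj & Hxj).
  exists j, x. split; [lia|]. unfold arc_end. destruct (Nat.eqb_spec j (nd D)); [lia|].
  split; [exact Hxj|exact Et].
Qed.

Lemma Cmod_le_X_norm (G : contour) (D : nodes) (s : R) (v : Gamma G -> C) (t : Gamma G) :
  0 < s -> in_X G D s v -> Cmod (v t) <= X_norm G D s v.
Proof.
  intros Hs Hv. destruct (arc_cover G D t) as (j & x & Hj & Hx & <-).
  destruct (X_norm_arc_bound G D s v j Hs Hv Hj) as (S1 & H1 & P1 & Q1 & E1 & A1 & B1).
  rewrite <- (arc_val_left G D s v j x Hj Hv Hx).
  specialize (A1 x ltac:(unfold in_arc; lra)). lra.
Qed.

Lemma holder_limits (G : contour) (mu L : R) (g : Gamma G -> C) (x : R) :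
  0 < mu -> holder G mu L g ->
  lim_minus G g x (g (pt G x)) /\ lim_plus G g x (g (pt G x)).
Proof.
  intros Hmu Hg.
  assert (Hc : forall e, 0 < e -> exists d, 0 < d /\ forall y, Rabs (y - x) < d ->
     Cmod (Cminus (g (pt G y)) (g (pt G x))) < e).
  { intros e He. pose proof (Rabs_pos L).
    destruct (hpow_small mu (e / (2 * (Rabs L + 1))) Hmu) as (d & Hd & H1);
      [apply Rdiv_lt_0_compat; lra|].
    exists d. split; [exact Hd|]. intros y Hy.
    eapply Rle_lt_trans; [apply Hg|].
    specialize (H1 (Rabs (y - x)) ltac:(lra)).
    pose proof (hpow_nonneg (Rabs (y - x)) mu) as H2.
    assert (L * hpow (Rabs (y - x)) mu <= (Rabs L + 1) * hpow (Rabs (y - x)) mu).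
    { apply Rmult_le_compat_r; [exact H2|]. pose proof (Rle_abs L). lra. }
    apply Rmult_le_compat_l with (r := Rabs L + 1) in H1; [|lra].
    replace ((Rabs L + 1) * (e / (2 * (Rabs L + 1)))) with (e / 2) in H1 by (field; lra).
    lra. }
  split; [apply lim_minus_iff|apply lim_plus_iff]; intros e He;
    destruct (Hc e He) as (d & Hd & H1); exists d; (split; [exact Hd|]);
    intros y Hy; apply H1; apply Rabs_lt_between; lra.
Qed.

Lemma holder_arc_val (G : contour) (D : nodes) (mu L : R) (g : Gamma G -> C) (j : nat) (x : R) :
  0 < mu -> holder G mu L g -> arc_val G D g j x = g (pt G x).
Proof.
  intros Hmu Hg. destruct (holder_limits G mu L g x Hmu Hg) as [H1 H2]. unfold arc_val.
  rewrite (val_plus_eq _ _ _ _ H2), (val_minus_eq _ _ _ _ H1).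
  destruct (Req_EM_T x (thd D j)); [reflexivity|].
  destruct (Req_EM_T x (arc_end D j)); reflexivity.
Qed.

(** [K] collects two losses, the lowering of the exponent over a length [2 PI] and the change from
    the parameter to [arc_dist]. It is chosen before [g], hence is the same for all meshes. *)
Lemma holder_X (G : contour) (D : nodes) (mu s : R) :
  0 < s <= mu -> exists K, 0 <= K /\ forall (L S : R) (g : Gamma G -> C),
    0 <= L -> 0 <= S -> holder G mu L g -> (forall t, Cmod (g t) <= S) ->
    in_X G D s g /\ X_norm G D s g <= S + K * L.
Proof.
  intros Hs. destruct (arc_dist_lower G D) as (c & Hc & Hlow). pose proof PI_RGT_0.
  set (K := hpow (2 * PI) (mu - s) * hpow (/ c) s).
  assert (HK : 0 <= K) by (apply Rmult_le_pos; apply hpow_nonneg).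
  exists K. split; [exact HK|]. intros L S g HL HS Hg Hb.
  assert (Hci : 0 < / c) by now apply Rinv_0_lt_compat.
  assert (Hhol : forall j, (1 <= j <= nd D)%nat -> forall x y, in_arc D j x -> in_arc D j y ->
    Cmod (Cminus (g (pt G x)) (g (pt G y))) <= K * L * hpow (arc_dist G D x y) s).
  { intros j Hj x y Hx Hy. destruct (arc_bounds D j Hj) as (B1 & B2 & B3 & B4 & _).
    eapply Rle_trans; [apply Hg|]. rewrite (Rmult_comm K L), Rmult_assoc.
    apply Rmult_le_compat_l; [exact HL|].
    assert (Rabs (x - y) <= 2 * PI) by (unfold in_arc in *; apply Rabs_le; lra).
    eapply Rle_trans; [apply (hpow_lower_exponent _ (2 * PI) mu s); lra|].
    unfold K. rewrite Rmult_assoc. apply Rmult_le_compat_l; [apply hpow_nonneg|].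
    pose proof (Hlow j Hj x y Hx Hy) as Hl. pose proof (Rabs_pos (x - y)).
    assert (0 <= arc_dist G D x y).
    { eapply Rle_trans; [|exact Hl]. apply Rmult_le_pos; lra. }
    rewrite <- hpow_mult by lra. apply hpow_le; [lra|].
    replace (Rabs (x - y)) with (/ c * (c * Rabs (x - y))) by (field; lra).
    apply Rmult_le_compat_l; lra. }
  split.
  - split; intros j Hj.
    + destruct (holder_limits G mu L g (thd D j) ltac:(lra) Hg) as [H1 H2].
      split; [exact H1|]. eexists; exact H2.
    + exists (K * L). intros x y Hx Hy. apply (Hhol j Hj); unfold in_arc; lra.
  - assert (0 <= K * L) by now apply Rmult_le_pos.
    apply X_norm_le; [lra|]. intros j Hj. exists S, (K * L).
    split; [exact HS|]. split; [assumption|]. split; [lra|]. split.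
    + intros x _. rewrite (holder_arc_val G D mu L) by (try assumption; lra). apply Hb.
    + intros x y Hx Hy. rewrite !(holder_arc_val G D mu L) by (try assumption; lra).
      now apply (Hhol j Hj).
Qed.

(** * The integral operator *)

Lemma continuous_Cmult (f g : R -> C) (x : R) :
  continuous f x -> continuous g x -> continuous (fun y => Cmult (f y) (g y)) x.
Proof.
  intros Hf Hg. apply continuous_C_iff. intros e He.
  pose proof (Cmod_ge_0 (f x)) as Hfx. pose proof (Cmod_ge_0 (g x)) as Hgx.
  set (M := Cmod (f x) + Cmod (g x) + 1).
  assert (Hd : 0 < e / (2 * M)) by (apply Rdiv_lt_0_compat; unfold M; lra).
  destruct (proj1 (continuous_C_iff f x) Hf _ Hd) as (d1 & P1 & D1).
  assert (Hd' : 0 < Rmin 1 (e / (2 * M))) by (apply Rmin_pos; lra).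
  destruct (proj1 (continuous_C_iff g x) Hg _ Hd') as (d2 & P2 & D2).
  pose proof (Rmin_l d1 d2). pose proof (Rmin_r d1 d2).
  exists (Rmin d1 d2). split; [now apply Rmin_pos|]. intros y Hy.
  specialize (D1 y ltac:(lra)). specialize (D2 y ltac:(lra)).
  pose proof (Rmin_l 1 (e / (2 * M))). pose proof (Rmin_r 1 (e / (2 * M))).
  replace (Cminus (Cmult (f y) (g y)) (Cmult (f x) (g x))) with
    (Cplus (Cmult (Cminus (f y) (f x)) (g y)) (Cmult (f x) (Cminus (g y) (g x)))) by ring.
  eapply Rle_lt_trans; [apply Cmod_triangle|]. rewrite !Cmod_mult.
  assert (Hgy : Cmod (g y) <= M).
  { replace (g y) with (Cplus (Cminus (g y) (g x)) (g x)) by ring.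
    eapply Rle_trans; [apply Cmod_triangle|]. unfold M. lra. }
  assert (E1 : Cmod (Cminus (f y) (f x)) * Cmod (g y) <= e / (2 * M) * M).
  { apply Rmult_le_compat; try apply Cmod_ge_0; lra. }
  assert (E2 : Cmod (f x) * Cmod (Cminus (g y) (g x)) <= Cmod (f x) * (e / (2 * M)))
    by (apply Rmult_le_compat_l; lra).
  assert (E3 : e / (2 * M) * M = e / 2) by (field; unfold M; lra).
  assert (E4 : Cmod (f x) * (e / (2 * M)) < e / 2).
  { rewrite <- E3, (Rmult_comm (e / (2 * M))). apply Rmult_lt_compat_r; [lra|].
    unfold M. lra. }
  lra.
Qed.

Lemma intC_le (f : R -> C) (M : R) :
  @ex_RInt C_R_NormedModule f 0 (2 * PI) ->
  (forall x, 0 <= x <= 2 * PI -> Cmod (f x) <= M) ->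
  Cmod (intC f 0 (2 * PI)) <= 2 * PI * M.
Proof.
  intros Hex H. pose proof PI_RGT_0. unfold intC.
  pose proof (@RInt_correct C_R_CompleteNormedModule f 0 (2 * PI) Hex) as Hi.
  assert (Hn : forall x, 0 <= x <= 2 * PI -> @norm R_AbsRing C_R_NormedModule (f x) <= M)
    by (intros x Hx; rewrite Cmod_norm_R; now apply H).
  pose proof (@norm_RInt_le_const C_R_NormedModule f 0 (2 * PI) _ M ltac:(lra) Hn Hi) as Hl.
  rewrite Cmod_norm_R in Hl. rewrite Rminus_0_r in Hl. exact Hl.
Qed.

(** The real normed module scales by real numbers only; a complex factor mixes real and imaginary
    parts, so the integral is treated componentwise. *)
Lemma is_RInt_Cmult (f : R -> C) (a b : R) (c l : C) :
  @is_RInt C_R_NormedModule f a b l ->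
  @is_RInt C_R_NormedModule (fun x => Cmult c (f x)) a b (Cmult c l).
Proof.
  intros H.
  pose proof (is_RInt_fct_extend_fst f a b l H) as H1.
  pose proof (is_RInt_fct_extend_snd f a b l H) as H2.
  apply (is_RInt_fct_extend_pair (fun x => Cmult c (f x)) a b (fst (Cmult c l)) (snd (Cmult c l))).
  - exact (is_RInt_minus _ _ _ _ _ _ (is_RInt_scal _ _ _ (fst c) _ H1)
            (is_RInt_scal _ _ _ (snd c) _ H2)).
  - exact (is_RInt_plus _ _ _ _ _ _ (is_RInt_scal _ _ _ (fst c) _ H2)
            (is_RInt_scal _ _ _ (snd c) _ H1)).
Qed.

Lemma kernel_continuous (G : contour) (mu : R) (k : Gamma G -> Gamma G -> C) (t : Gamma G) (x : R) :
  kernel_regular G mu k -> continuous (fun y => k t (pt G y)) x.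
Proof.
  intros (M0 & Mmu & omega & Hom & _ & _ & Hk). apply continuous_C_iff. intros e He.
  assert (Hloc : exists d, 0 < d /\ forall r, 0 < r < d -> omega r < e).
  { apply (filterlim_locally omega 0) with (eps := mkposreal e He) in Hom.
    destruct Hom as [d Hd]. exists d. split; [apply cond_pos|]. intros r Hr.
    assert (Hb : ball 0 e (omega r)).
    { apply Hd; [|lra]. apply Rabs_lt_between'. lra. }
    apply Rabs_lt_between' in Hb. lra. }
  destruct Hloc as (d & Hd & Hsm).
  destruct (proj1 (continuous_C_iff _ _) (gam_continuous G x) d Hd) as (d' & Hd' & H).
  exists d'. split; [exact Hd'|]. intros y Hy. specialize (H y Hy).
  (* [omega] tends to 0 from the right, and its value at 0 is arbitrary; coincident points are
     therefore treated apart. *)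
  destruct (Req_dec (Defs.dist G (pt G y) (pt G x)) 0) as [E|E].
  - assert (Ept : pt G y = pt G x).
    { apply pt_eq. unfold Defs.dist in E. simpl in E. apply Cmod_eq_0 in E.
      replace (gam G y) with (Cplus (Cminus (gam G y) (gam G x)) (gam G x)) by ring.
      rewrite E. ring. }
    rewrite Ept. replace (Cminus (k t (pt G x)) (k t (pt G x))) with (RtoC 0) by ring.
    now rewrite Cmod_0.
  - eapply Rle_lt_trans; [apply Hk|]. apply Hsm.
    unfold Defs.dist in *. simpl in *.
    pose proof (Cmod_ge_0 (Cminus (gam G y) (gam G x))). lra.
Qed.

(** The lateral limits at both ends allow a continuous extension to [R], which reduces integrability
    over an arc to the continuous case; the values of [v] at the ends do not affect the integral. *)
Lemma arc_extension (G : contour) (D : nodes) (s : R) (v : Gamma G -> C) (j : nat) :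
  0 < s -> (1 <= j <= nd D)%nat -> in_X G D s v ->
  exists f : R -> C, (forall x, continuous f x) /\
    forall x, thd D j < x < arc_end D j -> f x = v (pt G x).
Proof.
  intros Hs Hj Hv. destruct (arc_bounds D j Hj) as (B1 & B2 & B3 & B4 & _).
  destruct (arc_val_holder G D s v j Hs Hj Hv) as (M & HM & Hhol).
  destruct (@C0_extension_lt C_UniformSpace (fun x => v (pt G x))
     (arc_val G D v j (thd D j)) (v (pt G (arc_end D j))) (thd D j) (arc_end D j) B2)
    as (f & F1 & F2 & _).
  - intros x Hx. apply (continuous_C_iff (fun x => v (pt G x)) x). intros e He.
    destruct (hpow_small s (e / (2 * (M + 1))) Hs) as (d & Hd & H1);
      [apply Rdiv_lt_0_compat; lra|].
    set (d' := Rmin d (Rmin (x - thd D j) (arc_end D j - x))).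
    assert (Hd1 : d' <= d) by apply Rmin_l.
    assert (Hd2 : d' <= x - thd D j) by (eapply Rle_trans; [apply Rmin_r|apply Rmin_l]).
    assert (Hd3 : d' <= arc_end D j - x) by (eapply Rle_trans; [apply Rmin_r|apply Rmin_r]).
    exists d'. split; [unfold d'; repeat apply Rmin_pos; lra|]. intros y Hy.
    apply Rabs_lt_between in Hy as Hy'.
    rewrite <- (arc_val_inside G D v j y), <- (arc_val_inside G D v j x) by lra.
    eapply Rle_lt_trans; [apply Hhol; unfold in_arc; lra|].
    specialize (H1 (Rabs (y - x)) ltac:(lra)).
    pose proof (hpow_nonneg (Rabs (y - x)) s).
    apply Rmult_le_compat_l with (r := M + 1) in H1; [|lra].
    replace ((M + 1) * (e / (2 * (M + 1)))) with (e / 2) in H1 by (field; lra).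
    lra.
  - exact (arc_val_start G D s v j Hj Hv).
  - exact (lim_minus_arc_end G D s v j Hj Hv).
  - exists f. split; [exact F1|exact F2].
Qed.

Definition K_integrand (G : contour) (k : Gamma G -> Gamma G -> C) (v : Gamma G -> C)
    (t : Gamma G) (x : R) : C :=
  Cmult (Cmult (k t (pt G x)) (v (pt G x))) (dgam G x).

Lemma K_integrand_ex_RInt_piece (G : contour) (mu : R) (k : Gamma G -> Gamma G -> C)
    (v : Gamma G -> C) (t : Gamma G) (f : R -> C) (a b : R) :
  kernel_regular G mu k -> a <= b -> (forall x, continuous f x) ->
  (forall x, a < x < b -> f x = v (pt G x)) ->
  @ex_RInt C_R_NormedModule (K_integrand G k v t) a b.
Proof.
  intros Hk Hab Hf Hfv.
  apply (ex_RInt_ext (fun x => Cmult (Cmult (k t (pt G x)) (f x)) (dgam G x))).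
  - rewrite Rmin_left, Rmax_right by exact Hab. intros x Hx. unfold K_integrand.
    now rewrite Hfv.
  - apply (@ex_RInt_continuous C_R_CompleteNormedModule). intros x _.
    apply continuous_Cmult; [|apply dgam_continuous].
    apply continuous_Cmult; [|apply Hf]. now apply (kernel_continuous G mu).
Qed.

Lemma K_integrand_ex_RInt (G : contour) (D : nodes) (s mu : R) (k : Gamma G -> Gamma G -> C)
    (v : Gamma G -> C) (t : Gamma G) :
  0 < s -> kernel_regular G mu k -> in_X G D s v ->
  @ex_RInt C_R_NormedModule (K_integrand G k v t) 0 (2 * PI).
Proof.
  intros Hs Hk Hv. pose proof (nd_pos D) as Hn. pose proof PI_RGT_0.
  pose proof (thd_range D 1 ltac:(lia)) as R1.
  pose proof (thd_range D (nd D) ltac:(lia)) as Rn.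
  assert (Harcs : forall n, (1 <= n <= nd D)%nat ->
     @ex_RInt C_R_NormedModule (K_integrand G k v t) (thd D 1) (thd D n)).
  { induction n as [|n IH]; intros Hn'; [lia|].
    destruct n as [|n]; [apply ex_RInt_point|].
    apply ex_RInt_Chasles with (thd D (S n)); [apply IH; lia|].
    destruct (arc_extension G D s v (S n) Hs ltac:(lia) Hv) as (f & Hf & Hfv).
    apply (K_integrand_ex_RInt_piece G mu k v t f); try assumption.
    - left. apply (thd_incr D); lia.
    - intros x Hx. apply Hfv. unfold arc_end.
      destruct (Nat.eqb_spec (S n) (nd D)); [lia|exact Hx]. }
  destruct (arc_extension G D s v (nd D) Hs ltac:(lia) Hv) as (f & Hf & Hfv).
  unfold arc_end in Hfv. rewrite Nat.eqb_refl in Hfv.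
  (* The last arc is split by the cut: its part over [[0, thd D 1]] is reached by adding one period,
     the rest is [[thd D (nd D), 2 PI]]. *)
  apply ex_RInt_Chasles with (thd D 1).
  - apply (K_integrand_ex_RInt_piece G mu k v t (fun x => f (x + 2 * PI)));
      [exact Hk|lra| |].
    + intros x. apply (continuous_comp (fun y => y + 2 * PI) f); [|apply Hf].
      apply (continuous_plus (V := R_NormedModule) (fun y => y) (fun _ => 2 * PI));
        [apply continuous_id|apply continuous_const].
    + intros x Hx. rewrite Hfv by lra. now rewrite pt_period.
  - apply ex_RInt_Chasles with (thd D (nd D)); [apply Harcs; lia|].
    apply (K_integrand_ex_RInt_piece G mu k v t f); [exact Hk|lra|exact Hf|].
    intros x Hx. apply Hfv. lra.
Qed.

Lemma K_op_plus (G : contour) (D : nodes) (s mu : R) (k : Gamma G -> Gamma G -> C)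
    (v w : Gamma G -> C) :
  0 < s -> kernel_regular G mu k -> in_X G D s v -> in_X G D s w ->
  K_op G k (fun t => Cplus (v t) (w t)) = fun t => Cplus (K_op G k v t) (K_op G k w t).
Proof.
  intros Hs Hk Hv Hw. apply functional_extensionality. intros t. unfold K_op, intC.
  pose proof (K_integrand_ex_RInt G D s mu k v t Hs Hk Hv) as E1.
  pose proof (K_integrand_ex_RInt G D s mu k w t Hs Hk Hw) as E2.
  refine (eq_trans _ (@RInt_plus C_R_CompleteNormedModule _ _ _ _ E1 E2)).
  apply (@RInt_ext C_R_CompleteNormedModule). intros x _.
  change (Cmult (Cmult (k t (pt G x)) (Cplus (v (pt G x)) (w (pt G x)))) (dgam G x)
    = Cplus (K_integrand G k v t x) (K_integrand G k w t x)).
  unfold K_integrand. ring.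
Qed.

Lemma K_op_scal (G : contour) (D : nodes) (s mu : R) (k : Gamma G -> Gamma G -> C)
    (a : C) (v : Gamma G -> C) :
  0 < s -> kernel_regular G mu k -> in_X G D s v ->
  K_op G k (fun t => Cmult a (v t)) = fun t => Cmult a (K_op G k v t).
Proof.
  intros Hs Hk Hv. apply functional_extensionality. intros t. unfold K_op, intC.
  pose proof (K_integrand_ex_RInt G D s mu k v t Hs Hk Hv) as E1.
  apply (@RInt_correct C_R_CompleteNormedModule) in E1.
  apply (@is_RInt_unique C_R_CompleteNormedModule).
  apply (is_RInt_ext (fun x => Cmult a (K_integrand G k v t x))).
  - intros x _. unfold K_integrand.
    match goal with |- ?x = ?y => change (@eq C x y) end. ring.
  - now apply is_RInt_Cmult.
Qed.

(** The smoothing estimate behind all compactness: differences of [K v] involve only differences of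
    the kernel in its first variable, so the supremum of [|v|] is the only information about [v] on
    the right. [CK] adds the constants of both bounds to have a single one. *)
Lemma K_op_bounds (G : contour) (D : nodes) (s mu : R) (k : Gamma G -> Gamma G -> C) :
  0 < s -> 0 < mu -> kernel_regular G mu k ->
  exists CK, 0 <= CK /\ forall (v : Gamma G -> C) (S : R),
    in_X G D s v -> (forall t, Cmod (v t) <= S) ->
    (forall t, Cmod (K_op G k v t) <= CK * S) /\ holder G mu (CK * S) (K_op G k v).
Proof.
  intros Hs Hmu Hk. pose proof Hk as (M0 & Mmu & omega & _ & HM0 & HMmu & _).
  destruct (dgam_bounds G) as (c & L & Hc & HL & Hb).
  destruct (gam_lipschitz G) as (Lg & HLg & Hlip). pose proof PI_RGT_0 as HPI.
  assert (HM0' : 0 <= M0) by (eapply Rle_trans; [apply Cmod_ge_0|apply (HM0 (pt G 0) (pt G 0))]).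
  (* [Mmu] comes without a sign, hence the absolute value; [hpow Lg mu] converts chord distance into
     parameter distance. *)
  set (Q := Rabs Mmu * hpow Lg mu).
  assert (HQ : 0 <= Q) by (apply Rmult_le_pos; [apply Rabs_pos|apply hpow_nonneg]).
  assert (HA : 0 <= 2 * PI * M0 * L) by (repeat first [lra | apply Rmult_le_pos]).
  assert (HB : 0 <= 2 * PI * Q * L) by (repeat first [lra | apply Rmult_le_pos]).
  exists (2 * PI * M0 * L + 2 * PI * Q * L). split; [lra|]. intros v S Hv HS.
  assert (HS0 : 0 <= S) by (eapply Rle_trans; [apply Cmod_ge_0|apply (HS (pt G 0))]).
  split.
  - intros t. apply Rle_trans with (2 * PI * (M0 * S * L)).
    + apply intC_le; [now apply (K_integrand_ex_RInt G D s mu)|]. intros x Hx.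
      rewrite !Cmod_mult. apply Rmult_le_compat; try apply Cmod_ge_0.
      * apply Rmult_le_pos; apply Cmod_ge_0.
      * apply Rmult_le_compat; auto using Cmod_ge_0.
      * apply Hb. lra.
    + assert (0 <= 2 * PI * Q * L * S) by now apply Rmult_le_pos. lra.
  - intros x y. unfold K_op, intC.
    pose proof (K_integrand_ex_RInt G D s mu k v (pt G x) Hs Hk Hv) as E1.
    pose proof (K_integrand_ex_RInt G D s mu k v (pt G y) Hs Hk Hv) as E2.
    pose proof (@RInt_minus C_R_CompleteNormedModule _ _ _ _ E1 E2) as Ed.
    change (Cmod (@minus C_R_CompleteNormedModule
      (@RInt C_R_CompleteNormedModule (K_integrand G k v (pt G x)) 0 (2 * PI))
      (@RInt C_R_CompleteNormedModule (K_integrand G k v (pt G y)) 0 (2 * PI)))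
      <= (2 * PI * M0 * L + 2 * PI * Q * L) * S * hpow (Rabs (x - y)) mu).
    rewrite <- Ed.
    set (h := hpow (Rabs (x - y)) mu). pose proof (hpow_nonneg (Rabs (x - y)) mu) as Hh.
    fold h in Hh.
    apply Rle_trans with (2 * PI * (Q * h * S * L)).
    + apply intC_le; [now apply (@ex_RInt_minus C_R_NormedModule)|]. intros z Hz.
      change (Cmod (Cminus (K_integrand G k v (pt G x) z) (K_integrand G k v (pt G y) z))
        <= Q * h * S * L).
      unfold K_integrand.
      replace (Cminus (Cmult (Cmult (k (pt G x) (pt G z)) (v (pt G z))) (dgam G z))
                 (Cmult (Cmult (k (pt G y) (pt G z)) (v (pt G z))) (dgam G z)))
        with (Cmult (Cmult (Cminus (k (pt G x) (pt G z)) (k (pt G y) (pt G z))) (v (pt G z)))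
                 (dgam G z)) by ring.
      rewrite !Cmod_mult. apply Rmult_le_compat; try apply Cmod_ge_0.
      * apply Rmult_le_pos; apply Cmod_ge_0.
      * apply Rmult_le_compat; try apply Cmod_ge_0; [|apply HS].
        eapply Rle_trans; [apply HMmu|]. unfold Q, h. rewrite Rmult_assoc.
        rewrite <- hpow_mult by (try apply Rabs_pos; lra).
        apply Rle_trans with (Rabs Mmu * hpow (Defs.dist G (pt G x) (pt G y)) mu).
        -- apply Rmult_le_compat_r; [apply hpow_nonneg|apply Rle_abs].
        -- apply Rmult_le_compat_l; [apply Rabs_pos|]. apply hpow_le; [lra|]. apply Hlip.
      * apply Hb. lra.
    + assert (0 <= 2 * PI * M0 * L * S * h) by (repeat first [lra | apply Rmult_le_pos]). lra.
Qed.

(** * Stability *)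

Lemma contour_net (G : contour) (d : R) : 0 < d ->
  exists l : list (Gamma G), forall t, exists t', In t' l /\
    exists x y, t = pt G x /\ t' = pt G y /\ Rabs (x - y) <= d.
Proof.
  intros Hd. pose proof PI_RGT_0 as HPI.
  destruct (INR_archimed d (2 * PI) Hd) as [N HN]. set (n := (N + 4)%nat).
  assert (Hn : (4 <= n)%nat) by (unfold n; lia).
  pose proof (step_pos n Hn) as Hh. pose proof (step_mul n Hn) as Hm.
  assert (HnN : INR N <= INR n) by (apply le_INR; unfold n; lia).
  assert (Hsd : step n <= d).
  { apply Rmult_le_reg_l with (INR n); [apply lt_0_INR; lia|]. rewrite Hm.
    apply Rle_trans with (INR N * d); [lra|]. apply Rmult_le_compat_r; lra. }
  exists (map (fun i => pt G (INR i * step n)) (seq 0 n)). intros t.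
  destruct (pt_surj_range G t) as (x & Hx & <-).
  destruct (cell_exists n 0 x) as [i Hi]. rewrite Rminus_0_r in Hi.
  set (p := x / step n) in *. assert (Ex : x = p * step n) by (unfold p; field; lra).
  assert (H1 : -1 < IZR i).
  { assert (0 <= p) by (apply Rmult_le_reg_r with (step n); lra). lra. }
  assert (H2 : IZR i < IZR (Z.of_nat n)).
  { rewrite <- INR_IZR_INZ. assert (p < INR n) by (apply Rmult_lt_reg_r with (step n); lra).
    lra. }
  apply lt_IZR in H1. apply lt_IZR in H2.
  exists (pt G (INR (Z.to_nat i) * step n)). split.
  - apply in_map_iff. exists (Z.to_nat i). split; [reflexivity|]. apply in_seq. lia.
  - exists x, (INR (Z.to_nat i) * step n). split; [reflexivity|]. split; [reflexivity|].
    rewrite INR_IZR_INZ, Z2Nat.id by lia. rewrite Rabs_pos_eq by nra. nra.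
Qed.

Lemma holder_ascoli (G : contour) (mu B L : R) (F : nat -> Gamma G -> C) :
  0 < mu -> 0 <= L -> (forall n t, Cmod (F n t) <= B) -> (forall n, holder G mu L (F n)) ->
  exists (phi : nat -> nat) (w : Gamma G -> C),
    (forall n, (n <= phi n)%nat) /\ holder G mu L w /\
    forall e, 0 < e -> exists N, forall n, (N <= n)%nat ->
      forall t, Cmod (Cminus (F (phi n) t) (w t)) <= e.
Proof.
  intros Hmu HL HB HF. destruct (arzela_ascoli (Gamma G) F B HB) as (phi & w & Hphi & Hw).
  - intros e He. destruct (hpow_small mu (e / (L + 1)) Hmu) as (d & Hd & Hsm);
      [apply Rdiv_lt_0_compat; lra|].
    destruct (contour_net G d Hd) as [l Hl]. exists l. intros t.
    destruct (Hl t) as (t' & Ht' & x & y & -> & -> & Hxy). exists (pt G y).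
    split; [exact Ht'|]. intros n. eapply Rle_trans; [apply HF|].
    specialize (Hsm _ Hxy). pose proof (hpow_nonneg (Rabs (x - y)) mu).
    apply Rmult_le_compat_l with (r := L + 1) in Hsm; [|lra].
    replace ((L + 1) * (e / (L + 1))) with e in Hsm by (field; lra). lra.
  - exists phi, w. split; [exact Hphi|]. split; [|exact Hw].
    intros x y. apply le_epsilon. intros e He.
    destruct (Hw (e / 2)) as [N HN]; [lra|].
    pose proof (HN N (Nat.le_refl N) (pt G x)) as H1. rewrite Cmod_minus_sym in H1.
    pose proof (HN N (Nat.le_refl N) (pt G y)) as H2.
    pose proof (HF (phi N) x y) as H3.
    pose proof (Cmod_minus_triangle (w (pt G x)) (F (phi N) (pt G x)) (w (pt G y))).
    pose proof (Cmod_minus_triangle (F (phi N) (pt G x)) (F (phi N) (pt G y)) (w (pt G y))).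
    lra.
Qed.

(** From the supremum norm into the full norm, uniformly in the mesh and the phase. This gain is
    what lifts supremum-norm stability to the space itself. *)
Lemma P_op_K_op_bound (G : contour) (D : nodes) (s mu : R) (k : Gamma G -> Gamma G -> C)
    (m : nat) (a : R) :
  0 < s < mu -> mu <= 1 -> kernel_regular G mu k -> spline_kernel (Bspline m) a ->
  exists CP, 0 <= CP /\ forall nB r v S,
    (4 <= nB)%nat -> 0 <= r < step nB -> in_X G D s v -> (forall t, Cmod (v t) <= S) ->
    in_X G D s (P_op G m nB r (K_op G k v)) /\
    X_norm G D s (P_op G m nB r (K_op G k v)) <= CP * S.
Proof.
  intros Hs Hmu Hk HK. pose proof PI_RGT_0 as HPI.
  destruct (K_op_bounds G D s mu k ltac:(lra) ltac:(lra) Hk) as (CK & HCK & HKb).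
  destruct (holder_X G D mu s ltac:(lra)) as (KX & HKX & HX).
  pose proof (hpow_nonneg (2 * PI) mu) as Hp.
  assert (HCh : 0 <= CK * hpow (2 * PI) mu) by now apply Rmult_le_pos.
  assert (HKC : 0 <= KX * CK) by now apply Rmult_le_pos.
  exists (CK + 3000 * (CK * hpow (2 * PI) mu) + 7000 * (KX * CK)).
  split; [lra|]. intros nB r v S HnB Hr Hv HS.
  destruct (HKb v S Hv HS) as [Hb Hh].
  assert (HS0 : 0 <= S) by (eapply Rle_trans; [apply Cmod_ge_0|apply (HS (pt G 0))]).
  assert (HCS : 0 <= CK * S) by now apply Rmult_le_pos.
  assert (Hstep : step nB <= 2 * PI).
  { rewrite <- (step_mul nB HnB). pose proof (step_pos nB HnB).
    assert (1 <= INR nB) by (apply (le_INR 1); lia). nra. }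
  destruct (HX (7000 * (CK * S)) (CK * S + 3000 * (CK * S * hpow (2 * PI) mu))
              (P_op G m nB r (K_op G k v))) as [H1 H2].
  - lra.
  - assert (0 <= CK * S * hpow (2 * PI) mu) by now apply Rmult_le_pos. lra.
  - apply (P_op_holder G m nB a r mu (CK * S) (K_op G k v) HK HnB Hr); [lra|exact Hh].
  - intros t. destruct (pt_surj G t) as [x <-].
    pose proof (P_op_error G m nB a r mu (CK * S) (K_op G k v) HK HnB Hr ltac:(lra) Hh x) as He.
    assert (CK * S * hpow (step nB) mu <= CK * S * hpow (2 * PI) mu).
    { apply Rmult_le_compat_l; [exact HCS|]. apply hpow_le; lra. }
    specialize (Hb (pt G x)).
    replace (P_op G m nB r (K_op G k v) (pt G x)) with
      (Cplus (Cminus (P_op G m nB r (K_op G k v) (pt G x)) (K_op G k v (pt G x)))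
             (K_op G k v (pt G x))) by ring.
    eapply Rle_trans; [apply Cmod_triangle|]. lra.
  - split; [exact H1|]. eapply Rle_trans; [exact H2|]. right. ring.
Qed.

Section Stability.

Variables (G : contour) (D : nodes) (beta mu : R) (k : Gamma G -> Gamma G -> C) (lam : C)
  (m : nat) (a : R) (rho : nat -> R).
Hypothesis Hbeta : 0 < beta < mu.
Hypothesis Hmu : mu <= 1.
Hypothesis Hk : kernel_regular G mu k.
Hypothesis HK : spline_kernel (Bspline m) a.
Hypothesis Hrho : forall nB, (4 <= nB)%nat -> 0 <= rho nB < step nB.

Let Ah (nB : nat) := Ah_op G k lam m nB (rho nB).
Let P (nB : nat) := P_op G m nB (rho nB).

Lemma Ah_op_plus (nB : nat) (v w : Gamma G -> C) :
  (4 <= nB)%nat -> in_X G D beta v -> in_X G D beta w ->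
  Ah nB (fun t => Cplus (v t) (w t)) = fun t => Cplus (Ah nB v t) (Ah nB w t).
Proof.
  intros HnB Hv Hw. apply functional_extensionality. intros t. unfold Ah, Ah_op.
  rewrite (K_op_plus G D beta mu k v w) by (try assumption; lra).
  rewrite (P_op_plus G m nB a (rho nB)) by auto. ring.
Qed.

Lemma Ah_op_scal (nB : nat) (b : C) (v : Gamma G -> C) :
  (4 <= nB)%nat -> in_X G D beta v ->
  Ah nB (fun t => Cmult b (v t)) = fun t => Cmult b (Ah nB v t).
Proof.
  intros HnB Hv. apply functional_extensionality. intros t. unfold Ah, Ah_op.
  rewrite (K_op_scal G D beta mu k b v) by (try assumption; lra).
  rewrite (P_op_scal G m nB a (rho nB)) by auto. ring.
Qed.

Lemma Ah_op_fixed_point (nB : nat) (v : Gamma G -> C) :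
  v = fun t => Cplus (Ah nB v t) (Cmult lam (P nB (K_op G k v) t)).
Proof. apply functional_extensionality. intros t. unfold Ah, Ah_op, P. ring. Qed.

Hypothesis Hker : forall v, in_X G D beta v ->
  (forall t, A_op G k lam v t = RtoC 0) -> forall t, v t = RtoC 0.

(** Compactness is applied to the images [K_op G k (v n)], since the [v n] themselves may jump;
    convergence of a subsequence of [v n] is then read off the fixed-point identity. *)
Lemma discrete_limit_zero (v : nat -> Gamma G -> C) (nB : nat -> nat) :
  (forall n, (4 <= nB n)%nat /\ step (nB n) <= / (INR n + 1) /\ in_X G D beta (v n) /\
     (forall t, Cmod (v n t) <= 1) /\ (forall t, Cmod (Ah (nB n) (v n) t) <= / (INR n + 1))) ->
  exists n, forall t, Cmod (v n t) <= 1 / 2.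
Proof.
  intros H.
  destruct (K_op_bounds G D beta mu k ltac:(lra) ltac:(lra) Hk) as (CK & HCK & HKb).
  set (F := fun n => K_op G k (v n)).
  assert (HFb : forall n t, Cmod (F n t) <= CK).
  { intros n t. destruct (H n) as (_ & _ & H1 & H2 & _).
    rewrite <- (Rmult_1_r CK). now apply HKb. }
  assert (HFh : forall n, holder G mu CK (F n)).
  { intros n. destruct (H n) as (_ & _ & H1 & H2 & _).
    rewrite <- (Rmult_1_r CK). now apply HKb. }
  destruct (holder_ascoli G mu CK CK F ltac:(lra) HCK HFb HFh) as (phi & w & Hphi & Hwh & Hw).
  set (u := fun t => Cmult lam (w t)).
  assert (HuX : in_X G D beta u).
  { apply in_X_scal. destruct (holder_X G D mu beta ltac:(lra)) as (KX & _ & HX).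
    apply (HX CK (CK + 1) w HCK ltac:(lra) Hwh). intros t.
    destruct (Hw 1 Rlt_0_1) as [N HN]. specialize (HN N (Nat.le_refl N) t).
    rewrite Cmod_minus_sym in HN. specialize (HFb (phi N) t).
    replace (w t) with (Cplus (Cminus (w t) (F (phi N) t)) (F (phi N) t)) by ring.
    eapply Rle_trans; [apply Cmod_triangle|]. lra. }
  pose proof (Cmod_ge_0 lam) as Hlam.
  assert (Hconv : forall e, 0 < e -> exists N, forall n, (N <= n)%nat -> forall t,
     Cmod (Cminus (v (phi n) t) (u t)) <= e).
  (* Half of [e] is for the residual [Ah v]. The other half is [(|lam| + 1) * 2 e1], one [e1] for
     the interpolation error and one for the distance from [K v] to [w]; the [+ 1] covers
     [lam = 0]. *)
  { intros e He. set (e1 := e / (2 * (Cmod lam + 1) * 2)).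
    assert (He1 : 0 < e1) by (apply Rdiv_lt_0_compat; lra).
    destruct (Hw e1 He1) as [N1 H1].
    destruct (inv_succ_small (e / 2)) as [N2 H2]; [lra|].
    destruct (hpow_small mu (e1 / (3000 * (CK + 1)))) as (d & Hd & H3);
      [lra|apply Rdiv_lt_0_compat; lra|].
    destruct (inv_succ_small d Hd) as [N3 H4].
    exists (Nat.max N1 (Nat.max N2 N3)). intros n Hn t.
    specialize (H1 n ltac:(lia) t). pose proof (Hphi n) as Hpn.
    specialize (H2 (phi n) ltac:(lia)). specialize (H4 (phi n) ltac:(lia)).
    destruct (H (phi n)) as (B1 & B2 & B3 & B4 & B5).
    specialize (H3 (step (nB (phi n))) ltac:(lra)). specialize (B5 t).
    destruct (pt_surj G t) as [x <-].
    pose proof (P_op_error G m _ a _ mu CK _ HK B1 (Hrho _ B1) ltac:(lra) (HFh (phi n)) x) as E.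
    fold (P (nB (phi n))) in E.
    rewrite (Ah_op_fixed_point (nB (phi n)) (v (phi n))).
    fold (F (phi n)). unfold u.
    set (p := P (nB (phi n)) (F (phi n)) (pt G x)) in *. set (q := F (phi n) (pt G x)) in *.
    replace (Cminus (Cplus (Ah (nB (phi n)) (v (phi n)) (pt G x)) (Cmult lam p))
        (Cmult lam (w (pt G x))))
      with (Cplus (Ah (nB (phi n)) (v (phi n)) (pt G x)) (Cmult lam (Cminus p (w (pt G x)))))
      by ring.
    eapply Rle_trans; [apply Cmod_triangle|]. rewrite Cmod_mult.
    pose proof (Cmod_minus_triangle p q (w (pt G x))) as T.
    assert (E2 : 3000 * (CK * hpow (step (nB (phi n))) mu) <= e1).
    { pose proof (hpow_nonneg (step (nB (phi n))) mu).
      apply Rmult_le_compat_l with (r := 3000 * (CK + 1)) in H3; [|lra].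
      replace (3000 * (CK + 1) * (e1 / (3000 * (CK + 1)))) with e1 in H3 by (field; lra).
      lra. }
    assert (E3 : Cmod lam * Cmod (Cminus p (w (pt G x))) <= (Cmod lam + 1) * (2 * e1)).
    { apply Rmult_le_compat; try apply Cmod_ge_0; lra. }
    assert (E4 : (Cmod lam + 1) * (2 * e1) = e / 2) by (unfold e1; field; lra).
    lra. }
  (* [A u = lam (w - K u)], and [w - K u = (w - K v) + K (v - u)] for every [v] of the subsequence.
     Both terms tend to 0, the second because [K] is bounded in the supremum norm. *)
  assert (HA : forall t, A_op G k lam u t = RtoC 0).
  { intros t. apply Cmod_eq_0. apply Rle_antisym; [|apply Cmod_ge_0].
    apply le_epsilon. intros e He. rewrite Rplus_0_l.
    set (e1 := e / ((Cmod lam + 1) * (1 + CK))).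
    assert (He1 : 0 < e1).
    { apply Rdiv_lt_0_compat; [lra|]. apply Rmult_lt_0_compat; lra. }
    destruct (Hw e1 He1) as [N1 H1]. destruct (Hconv e1 He1) as [N2 H2].
    set (n := Nat.max N1 N2). specialize (H1 n ltac:(lia) t).
    specialize (H2 n ltac:(lia)). destruct (H (phi n)) as (_ & _ & B3 & _ & _).
    assert (HdX : in_X G D beta (fun t => Cplus (v (phi n) t) (Cmult (RtoC (-1)) (u t))))
      by (apply in_X_plus; [exact B3|now apply in_X_scal]).
    destruct (HKb _ e1 HdX) as [Hd _].
    { intros t'. replace (Cplus (v (phi n) t') (Cmult (RtoC (-1)) (u t')))
        with (Cminus (v (phi n) t') (u t')) by ring. apply H2. }
    specialize (Hd t).
    rewrite (K_op_plus G D beta mu k (v (phi n)) (fun t => Cmult (RtoC (-1)) (u t))) in Hd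
      by (try assumption; try lra; now apply in_X_scal).
    rewrite (K_op_scal G D beta mu k (RtoC (-1)) u) in Hd by (try assumption; lra).
    change (K_op G k (v (phi n)) t) with (F (phi n) t) in Hd.
    unfold A_op. unfold u at 1.
    replace (Cminus (Cmult lam (w t)) (Cmult lam (K_op G k u t))) with
      (Cmult lam (Cplus (Cminus (w t) (F (phi n) t))
         (Cplus (F (phi n) t) (Cmult (RtoC (-1)) (K_op G k u t))))) by ring.
    rewrite Cmod_mult.
    match goal with |- _ * Cmod (Cplus ?x ?y) <= _ => pose proof (Cmod_triangle x y) as T end.
    rewrite (Cmod_minus_sym (w t)) in T.
    apply Rle_trans with ((Cmod lam + 1) * (e1 + CK * e1)).
    - apply Rmult_le_compat; try apply Cmod_ge_0; lra.
    - right. unfold e1. field. split; lra. }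
  pose proof (Hker u HuX HA) as Hu0.
  destruct (Hconv (1 / 2)) as [N HN]; [lra|]. exists (phi N). intros t.
  specialize (HN N (Nat.le_refl N) t). rewrite Hu0 in HN.
  now replace (Cminus (v (phi N) t) (RtoC 0)) with (v (phi N) t) in HN by ring.
Qed.

(** A single [d] bounds mesh and residual, so that its failure at [d = 1/(n+1)] for every [n] gives
    exactly the sequences excluded by [discrete_limit_zero]. *)
Lemma sup_norm_contraction : exists d, 0 < d /\ forall nB v,
  (4 <= nB)%nat -> step nB <= d -> in_X G D beta v -> (forall t, Cmod (v t) <= 1) ->
  (forall t, Cmod (Ah nB v t) <= d) -> forall t, Cmod (v t) <= 1 / 2.
Proof.
  apply Classical_Prop.NNPP. intros Hno.
  assert (Hex : forall n : nat, exists p : nat * (Gamma G -> C),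
     ((4 <= fst p)%nat /\ step (fst p) <= / (INR n + 1) /\ in_X G D beta (snd p) /\
     (forall t, Cmod (snd p t) <= 1) /\
     (forall t, Cmod (Ah (fst p) (snd p) t) <= / (INR n + 1))) /\
     exists t, 1 / 2 < Cmod (snd p t)).
  { intros n. apply Classical_Prop.NNPP. intros Hn. apply Hno. exists (/ (INR n + 1)).
    split; [apply Rinv_0_lt_compat; pose proof (pos_INR n); lra|].
    intros nB v H1 H2 H3 H4 H5 t. apply Rnot_lt_le. intros H6. apply Hn.
    exists (nB, v). split; [|now exists t]. simpl. auto. }
  set (p := fun n => proj1_sig (constructive_indefinite_description _ (Hex n))).
  assert (Hp := fun n => proj2_sig (constructive_indefinite_description _ (Hex n))).
  destruct (discrete_limit_zero (fun n => snd (p n)) (fun n => fst (p n))) as [n Hn].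
  - intros n. apply Hp.
  - destruct (Hp n) as [_ [t Ht]]. specialize (Hn t). unfold p in Hn. lra.
Qed.

(** Let [M] bound [|v|]. If [M > e/d], then [v/M] has residual at most [e/M <= d], whence
    [|v| <= M/2]; in either case [|v| <= M/2 + e/d]. [bounded_contraction] concludes, with the norm
    of [v] as a priori bound. *)
Lemma sup_norm_stability : exists h0 C0, 0 < h0 /\ 0 <= C0 /\ forall nB v e,
  (4 <= nB)%nat -> step nB <= h0 -> in_X G D beta v ->
  (forall t, Cmod (Ah nB v t) <= e) -> forall t, Cmod (v t) <= C0 * e.
Proof.
  destruct sup_norm_contraction as (d & Hd & Hc).
  exists d, (2 / d). split; [exact Hd|].
  split; [left; apply Rdiv_lt_0_compat; lra|].
  intros nB v e HnB Hstep Hv He t.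
  assert (He0 : 0 <= e) by (eapply Rle_trans; [apply Cmod_ge_0|apply (He t)]).
  replace (2 / d * e) with (e / d / (1 - 1 / 2)) by (field; lra).
  apply (bounded_contraction v (X_norm G D beta v) (1 / 2)); [lra| |].
  - intros t'. apply Cmod_le_X_norm; [lra|exact Hv].
  - clear t. intros M HM t.
    assert (HM0 : 0 <= M) by (eapply Rle_trans; [apply Cmod_ge_0|apply (HM t)]).
    assert (Hed : 0 <= e / d) by (unfold Rdiv; apply Rmult_le_pos; [lra|]; left; now apply Rinv_0_lt_compat).
    destruct (Rle_lt_dec M (e / d)) as [H|H]; [specialize (HM t); lra|].
    assert (HMp : 0 < M) by lra.
    assert (HcM : Cmod (RtoC (/ M)) = / M).
    { rewrite Cmod_R. apply Rabs_pos_eq. left. now apply Rinv_0_lt_compat. }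
    assert (HMi : 0 < / M) by now apply Rinv_0_lt_compat.
    assert (Hs := Hc nB (fun t => Cmult (RtoC (/ M)) (v t)) HnB Hstep
                     (in_X_scal _ _ _ _ _ Hv)).
    rewrite Ah_op_scal in Hs by assumption.
    specialize (Hs ltac:(intros t'; rewrite Cmod_mult, HcM; apply Rmult_le_reg_l with M;
       [lra|]; rewrite <- Rmult_assoc, Rinv_r, Rmult_1_l, Rmult_1_r by lra; apply HM)).
    assert (HeM : e <= d * M).
    { apply Rmult_le_reg_r with (/ d); [now apply Rinv_0_lt_compat|].
      replace (d * M * / d) with M by (field; lra). unfold Rdiv in H. lra. }
    specialize (Hs ltac:(intros t'; rewrite Cmod_mult, HcM; apply Rmult_le_reg_l with M;
       [lra|]; rewrite <- Rmult_assoc, Rinv_r, Rmult_1_l by lra;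
       specialize (He t'); lra) t).
    rewrite Cmod_mult, HcM in Hs. apply Rmult_le_compat_l with (r := M) in Hs; [|lra].
    rewrite <- Rmult_assoc, Rinv_r, Rmult_1_l in Hs by lra. lra.
Qed.

End Stability.

(** * Solvability *)

Lemma csum_single (f : nat -> C) (n j : nat) :
  (j < n)%nat -> (forall i, (i < n)%nat -> i <> j -> f i = RtoC 0) -> csum f n = f j.
Proof.
  induction n as [|n IH]; intros Hj H; [lia|]. rewrite csum_S.
  destruct (Nat.eq_dec j n) as [-> |Hne].
  - rewrite csum_zero by (intros i Hi; apply H; lia). ring.
  - rewrite IH, (H n) by (try lia; intros i Hi; apply H; lia). ring.
Qed.

Lemma B_fun_in_S (G : contour) (m nB : nat) (r : R) (j : nat) :
  (j < nB)%nat -> in_S G m nB r (fun t => RtoC (B_fun G m nB r (S j) t)).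
Proof.
  intros Hj. exists (fun i => if Nat.eq_dec i (S j) then RtoC 1 else RtoC 0).
  intros t. rewrite sum_n_m_csum, (csum_single _ nB j Hj).
  - destruct (Nat.eq_dec (S j) (S j)); [ring|easy].
  - intros i _ Hne. destruct (Nat.eq_dec (S i) (S j)); [lia|ring].
Qed.

Lemma in_X_zero (G : contour) (D : nodes) (s : R) (v : Gamma G -> C) :
  in_X G D s v -> in_X G D s (fun _ => RtoC 0).
Proof.
  intros Hv. apply (in_X_scal G D s (RtoC 0)) in Hv.
  replace (fun _ : Gamma G => RtoC 0) with (fun t => Cmult (RtoC 0) (v t)); [exact Hv|].
  apply functional_extensionality. intros t. ring.
Qed.

Lemma csum_in_X (G : contour) (D : nodes) (s : R) (c : nat -> C) (b : nat -> Gamma G -> C)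
    (n : nat) :
  (0 < n)%nat -> (forall j, (j < n)%nat -> in_X G D s (b j)) ->
  in_X G D s (fun t => csum (fun j => Cmult (b j t) (c j)) n).
Proof.
  intros Hn Hb. assert (H0 := in_X_zero G D s _ (Hb O Hn)). clear Hn.
  induction n as [|n IH]; [exact H0|].
  apply (in_X_plus G D s (fun t => csum (fun j => Cmult (b j t) (c j)) n)).
  - apply IH. intros j Hj. apply Hb. lia.
  - replace (fun t => Cmult (b n t) (c n)) with (fun t => Cmult (c n) (b n t)).
    + apply in_X_scal, Hb. lia.
    + apply functional_extensionality. intros t. ring.
Qed.

Lemma A_op_csum (G : contour) (D : nodes) (s mu : R) (k : Gamma G -> Gamma G -> C) (lam : C)
    (c : nat -> C) (b : nat -> Gamma G -> C) (n : nat) (t : Gamma G) :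
  0 < s -> kernel_regular G mu k -> (0 < n)%nat -> (forall j, (j < n)%nat -> in_X G D s (b j)) ->
  A_op G k lam (fun t => csum (fun j => Cmult (b j t) (c j)) n) t
    = csum (fun j => Cmult (A_op G k lam (b j) t) (c j)) n.
Proof.
  intros Hs Hk Hn Hb.
  assert (Hlast : forall p, (p < n)%nat ->
     K_op G k (fun t => Cmult (b p t) (c p)) t = Cmult (K_op G k (b p) t) (c p)).
  { intros p Hp.
    replace (fun t => Cmult (b p t) (c p)) with (fun t => Cmult (c p) (b p t))
      by (apply functional_extensionality; intros; ring).
    rewrite (K_op_scal G D s mu) by auto. ring. }
  (* The induction starts from one term, which avoids applying [K] to the zero function. *)
  assert (HKs : forall p, (1 <= p <= n)%nat ->
     K_op G k (fun t => csum (fun j => Cmult (b j t) (c j)) p) t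
       = csum (fun j => Cmult (K_op G k (b j) t) (c j)) p).
  { induction p as [|p IH]; intros Hp; [lia|]. destruct p as [|p].
    - simpl. rewrite <- (Hlast O) by lia.
      replace (fun t => Cplus (RtoC 0) (Cmult (b O t) (c O))) with (fun t => Cmult (b O t) (c O))
        by (apply functional_extensionality; intros; ring). ring.
    - assert (E := K_op_plus G D s mu k
        (fun t => csum (fun j => Cmult (b j t) (c j)) (S p))
        (fun t => Cmult (b (S p) t) (c (S p))) Hs Hk).
      rewrite (csum_S _ (S p)), <- IH, <- (Hlast (S p)) by lia.
      apply (f_equal (fun f => f t)) in E; [exact E| |].
      + apply csum_in_X; [lia|]. intros j Hj. apply Hb. lia.
      + replace (fun t => Cmult (b (S p) t) (c (S p))) with (fun t => Cmult (c (S p)) (b (S p) t))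
          by (apply functional_extensionality; intros; ring).
        apply in_X_scal, Hb. lia. }
  unfold A_op at 1. rewrite HKs by lia.
  replace (csum (fun j => Cmult (A_op G k lam (b j) t) (c j)) n) with
    (csum (fun j => Cplus (Cmult (b j t) (c j))
       (Cmult (Copp lam) (Cmult (K_op G k (b j) t) (c j)))) n).
  - rewrite csum_plus, csum_scal. ring.
  - apply csum_ext. intros j _. unfold A_op. ring.
Qed.

Section Solvability.

Variables (G : contour) (D : nodes) (beta mu : R) (k : Gamma G -> Gamma G -> C) (lam : C)
  (m nB : nat) (a r C0 : R).
Hypothesis Hbeta : 0 < beta < mu.
Hypothesis Hmu : mu <= 1.
Hypothesis Hk : kernel_regular G mu k.
Hypothesis HK : spline_kernel (Bspline m) a.
Hypothesis HnB : (4 <= nB)%nat.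
Hypothesis Hr : 0 <= r < step nB.
Hypothesis Hstab : forall v e, in_X G D beta v ->
  (forall t, Cmod (Ah_op G k lam m nB r v t) <= e) -> forall t, Cmod (v t) <= C0 * e.

Let Ah := Ah_op G k lam m nB r.

Lemma in_S_in_X (s : Gamma G -> C) : in_S G m nB r s -> in_X G D beta s.
Proof.
  intros Hs. destruct (in_S_holder G m nB a r s HK HnB Hr Hs) as [L HL].
  destruct (holder_X G D 1 beta ltac:(lra)) as (KX & _ & HX).
  assert (HL0 : 0 <= L).
  { apply (holder_const_nonneg G 1 L s HL). }
  assert (Hb : forall t, Cmod (s t) <= Cmod (s (pt G 0)) + L * (2 * PI)).
  { intros t. destruct (pt_surj_range G t) as (x & Hx & <-).
    pose proof (HL x 0) as H. rewrite hpow_1 in H by apply Rabs_pos.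
    rewrite Rminus_0_r, Rabs_pos_eq in H by lra.
    assert (L * x <= L * (2 * PI)) by (apply Rmult_le_compat_l; lra).
    replace (s (pt G x)) with (Cplus (Cminus (s (pt G x)) (s (pt G 0))) (s (pt G 0))) by ring.
    eapply Rle_trans; [apply Cmod_triangle|]. lra. }
  apply (HX L (Cmod (s (pt G 0)) + L * (2 * PI)) s HL0); [|exact HL|exact Hb].
  eapply Rle_trans; [apply Cmod_ge_0|apply (Hb (pt G 0))].
Qed.

Lemma Ah_op_in_S (s : Gamma G -> C) : in_S G m nB r s -> in_S G m nB r (Ah s).
Proof.
  intros Hs. unfold Ah, Ah_op.
  replace (fun t => Cminus (s t) (Cmult lam (P_op G m nB r (K_op G k s) t))) with
    (fun t => Cplus (s t) (Cmult (Copp lam) (P_op G m nB r (K_op G k s) t)))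
    by (apply functional_extensionality; intros; ring).
  apply in_S_plus; [exact Hs|]. apply in_S_scal.
  apply (P_op_spec G m nB a r _ HK HnB Hr).
Qed.

Lemma Ah_op_nodal (v : Gamma G -> C) (i : nat) :
  (1 <= i <= nB)%nat -> Ah v (t_B G nB r i) = A_op G k lam v (t_B G nB r i).
Proof.
  intros Hi. unfold Ah, Ah_op, A_op.
  now rewrite (proj2 (P_op_spec G m nB a r (K_op G k v) HK HnB Hr) i Hi).
Qed.

Lemma Ah_op_eq_zero (v : Gamma G -> C) :
  in_X G D beta v -> (forall t, Ah v t = RtoC 0) -> forall t, v t = RtoC 0.
Proof.
  intros Hv H t. apply Cmod_eq_0. apply Rle_antisym; [|apply Cmod_ge_0].
  rewrite <- (Rmult_0_r C0). apply Hstab; [exact Hv|]. intros t'.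
  fold Ah. rewrite H, Cmod_0. lra.
Qed.

Lemma Ah_op_injective (v w : Gamma G -> C) :
  in_X G D beta v -> in_X G D beta w -> Ah v = Ah w -> v = w.
Proof.
  intros Hv Hw E. apply functional_extensionality. intros t.
  assert (Hw' : in_X G D beta (fun t => Cmult (RtoC (-1)) (w t))) by now apply in_X_scal.
  assert (H : Cplus (v t) (Cmult (RtoC (-1)) (w t)) = RtoC 0).
  { apply (Ah_op_eq_zero (fun t => Cplus (v t) (Cmult (RtoC (-1)) (w t)))).
    - now apply in_X_plus.
    - intros t'. unfold Ah, Ah_op.
      rewrite (K_op_plus G D beta mu k v (fun t => Cmult (RtoC (-1)) (w t)))
        by (try assumption; lra).
      rewrite (K_op_scal G D beta mu k _ w) by (try assumption; lra).
      rewrite (P_op_plus G m nB a r) by assumption.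
      rewrite (P_op_scal G m nB a r) by assumption.
      apply (f_equal (fun f => f t')) in E. unfold Ah, Ah_op in E.
      match goal with |- ?z = _ => replace z with (Cminus
        (Cminus (v t') (Cmult lam (P_op G m nB r (K_op G k v) t')))
        (Cminus (w t') (Cmult lam (P_op G m nB r (K_op G k w) t')))) by ring end.
      rewrite E. ring. }
  replace (v t) with (Cplus (Cplus (v t) (Cmult (RtoC (-1)) (w t))) (w t)) by ring.
  rewrite H. ring.
Qed.

Lemma spline_as_csum (c : nat -> C) :
  spline G m nB r (fun j => c (pred j))
    = fun t => csum (fun j => Cmult (RtoC (B_fun G m nB r (S j) t)) (c j)) nB.
Proof. apply functional_extensionality. intros t. apply spline_csum. Qed.

(** [A_h] maps the spline space into itself, and a spline is determined by its nodal values, at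
    which [A_h] and [A] agree. The equation is thus a square system whose matrix is the collocation
    matrix, and stability makes it injective. *)
Lemma Ah_op_surjective_S (s : Gamma G -> C) :
  in_S G m nB r s -> exists u, in_S G m nB r u /\ Ah u = s.
Proof.
  intros Hs.
  set (b := fun (j : nat) (t : Gamma G) => RtoC (B_fun G m nB r (S j) t)).
  assert (Hb : forall j, (j < nB)%nat -> in_X G D beta (b j))
    by (intros j Hj; now apply in_S_in_X, B_fun_in_S).
  assert (Hsp : forall c, in_S G m nB r (spline G m nB r (fun j => c (pred j))))
    by (intros c; apply in_S_iff; now eexists).
  assert (HA : forall c i, (i < nB)%nat ->
    Ah (spline G m nB r (fun j => c (pred j))) (t_B G nB r (S i))
      = csum (fun j => Cmult (A_op G k lam (b j) (t_B G nB r (S i))) (c j)) nB).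
  { intros c i Hi. rewrite Ah_op_nodal by lia. rewrite spline_as_csum.
    apply (A_op_csum G D beta mu k lam c b); auto; [lra|lia]. }
  destruct (injective_system_solvable nB
     (fun i j => A_op G k lam (b j) (t_B G nB r (S i)))
     (fun i => s (t_B G nB r (S i)))) as [c Hc].
  - intros c Hc j Hj.
    apply (spline_zero G m nB a r (fun j => c (pred j)) HK HnB Hr); [|exact Hj].
    intros i Hi. apply Ah_op_eq_zero; [apply in_S_in_X, Hsp|]. intros t.
    (* The zero spline is represented as [0 * s]. *)
    assert (E : Ah (spline G m nB r (fun j => c (pred j))) = fun t => Cmult (RtoC 0) (s t)).
    { apply (in_S_unique G m nB a r _ _ HK HnB Hr); [apply Ah_op_in_S, Hsp|now apply in_S_scal|].
      intros [|i'] Hi'; [lia|]. rewrite HA, Hc by lia. ring. }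
    rewrite E. ring.
  - exists (spline G m nB r (fun j => c (pred j))). split; [apply Hsp|].
    apply (in_S_unique G m nB a r _ _ HK HnB Hr); [apply Ah_op_in_S, Hsp|exact Hs|].
    intros [|i] Hi; [lia|]. rewrite HA by lia. apply Hc. lia.
Qed.

Lemma Ah_op_surjective (w : Gamma G -> C) :
  in_X G D beta w -> exists v, in_X G D beta v /\ Ah v = w.
Proof.
  intros Hw.
  destruct (Ah_op_surjective_S (P_op G m nB r (K_op G k w))) as (u & Hu & Eu).
  { apply (P_op_spec G m nB a r _ HK HnB Hr). }
  assert (HuX : in_X G D beta u) by now apply in_S_in_X.
  assert (HuX' : in_X G D beta (fun t => Cmult lam (u t))) by now apply in_X_scal.
  exists (fun t => Cplus (w t) (Cmult lam (u t))). split; [now apply in_X_plus|].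
  apply functional_extensionality. intros t.
  apply (f_equal (fun f => f t)) in Eu. unfold Ah, Ah_op in *.
  rewrite (K_op_plus G D beta mu k w (fun t => Cmult lam (u t))) by (try assumption; lra).
  rewrite (K_op_scal G D beta mu k _ u) by (try assumption; lra).
  rewrite (P_op_plus G m nB a r) by assumption.
  rewrite (P_op_scal G m nB a r) by assumption.
  rewrite <- Eu. ring.
Qed.

Lemma Ah_op_solution_in_S (v s : Gamma G -> C) :
  in_S G m nB r s -> Ah v = s -> in_S G m nB r v.
Proof.
  intros Hs E.
  replace v with (fun t => Cplus (s t) (Cmult lam (P_op G m nB r (K_op G k v) t))).
  - apply in_S_plus; [exact Hs|]. apply in_S_scal.
    apply (P_op_spec G m nB a r _ HK HnB Hr).
  - rewrite <- E. symmetry. apply functional_extensionality. intros t.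
    unfold Ah, Ah_op. ring.
Qed.

End Solvability.

Theorem theorem8p2 (G : contour) (D : nodes) (alpha beta mu eta : R)
    (k : Gamma G -> Gamma G -> C) (lam : C) (m : nat) (rho : nat -> R)
    (Hbeta : 0 < beta) (Halpha : beta < alpha) (Hmu : alpha < mu)
    (Hmu1 : mu <= 1)
    (Hk : kernel_regular G mu k)
    (Hker : forall v, in_X G D beta v ->
       (forall t, A_op G k lam v t = RtoC 0) -> forall t, v t = RtoC 0)
    (Hm : m = 2%nat \/ m = 3%nat \/ m = 4%nat)
    (Heta : 0 < eta < 1 / (2 * INR (nd D)))
    (Hrho : forall nB, (4 <= nB)%nat -> admissible_phase D eta nB (rho nB)) :
  exists h0 Clam : R, 0 < h0 /\
    forall nB : nat, (4 <= nB)%nat -> step nB <= h0 ->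
      (exists Ahinv : (Gamma G -> C) -> (Gamma G -> C),
         inverse_on G D beta (Ah_op G k lam m nB (rho nB)) Ahinv /\
         Rbar_le (op_norm G D beta Ahinv) (Finite Clam)) /\
      (forall s, in_S G m nB (rho nB) s ->
         exists v,
           unique (fun v => in_X G D beta v /\
                            Ah_op G k lam m nB (rho nB) v = s) v /\
           in_S G m nB (rho nB) v) /\
      (forall f, in_X G D alpha f ->
         let g := g_data G D k lam f in
         exists u,
           unique (fun u => in_X G D beta u /\
                            Ah_op G k lam m nB (rho nB) u
                              = P_op G m nB (rho nB) g) u /\
           unique (fun u => in_S G m nB (rho nB) u /\
                            forall i, (1 <= i <= nB)%nat ->
                              A_op G k lam u (t_B G nB (rho nB) i)
                                = g (t_B G nB (rho nB) i)) u).
Proof.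
  destruct (Bspline_kernel m Hm) as [a HK]. clear Hm Heta.
  assert (Hr : forall nB, (4 <= nB)%nat -> 0 <= rho nB < step nB)
    by (intros nB HnB; apply (Hrho nB HnB)). clear Hrho.
  assert (Hb : 0 < beta < mu) by lra.
  destruct (sup_norm_stability G D beta mu k lam m a rho Hb Hmu1 Hk HK Hr Hker)
    as (h0 & C0 & Hh0 & HC0 & Hstab).
  destruct (P_op_K_op_bound G D beta mu k m a Hb Hmu1 Hk HK) as (CP & HCP & HPK).
  pose proof (Cmod_ge_0 lam) as Hlam.
  (* In [v = A_h v + lam P_h K v] the last term has norm at most [|lam| CP sup |v|], and [sup |v|]
     is at most [C0] times the norm of [A_h v]. *)
  set (CL := 1 + Cmod lam * (CP * C0)).
  assert (HCL : 0 <= CL).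
  { assert (0 <= Cmod lam * (CP * C0)) by (repeat apply Rmult_le_pos; assumption).
    unfold CL. lra. }
  exists h0, CL. split; [exact Hh0|]. intros nB HnB Hstep.
  set (r := rho nB). assert (Hrr : 0 <= r < step nB) by now apply Hr.
  set (Ah := Ah_op G k lam m nB r).
  assert (Hst : forall v e, in_X G D beta v -> (forall t, Cmod (Ah v t) <= e) ->
     forall t, Cmod (v t) <= C0 * e) by (intros v e; now apply Hstab).
  assert (HPX : forall v, in_X G D beta v -> in_X G D beta
      (fun t => Cmult lam (P_op G m nB r (K_op G k v) t))).
  { intros v Hv. apply in_X_scal, (HPK nB r v (X_norm G D beta v) HnB Hrr Hv).
    intros t. apply Cmod_le_X_norm; [lra|exact Hv]. }
  assert (HAX : forall v, in_X G D beta v -> in_X G D beta (Ah v)).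
  { intros v Hv.
    replace (Ah v) with (fun t => Cplus (v t) (Cmult (RtoC (-1))
      (Cmult lam (P_op G m nB r (K_op G k v) t))))
      by (apply functional_extensionality; intros t; unfold Ah, Ah_op; ring).
    apply in_X_plus; [exact Hv|]. apply in_X_scal. now apply HPX. }
  assert (HPN : forall v S, in_X G D beta v -> (forall t, Cmod (v t) <= S) ->
     X_norm G D beta (fun t => Cmult lam (P_op G m nB r (K_op G k v) t))
       <= Cmod lam * (CP * S)).
  { intros v S Hv HS. destruct (HPK nB r v S HnB Hrr Hv HS) as [H1 H2].
    eapply Rle_trans; [apply X_norm_scal; [lra|exact H1]|].
    now apply Rmult_le_compat_l. }
  assert (Hinv : forall v, in_X G D beta v -> X_norm G D beta v <= CL * X_norm G D beta (Ah v)).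
  { intros v Hv. set (q := X_norm G D beta (Ah v)).
    assert (Hs : forall t, Cmod (v t) <= C0 * q).
    { apply Hst; [exact Hv|]. intros t. apply Cmod_le_X_norm; [lra|now apply HAX]. }
    specialize (HPN v _ Hv Hs).
    rewrite (Ah_op_fixed_point G k lam m rho nB v) at 1. fold r. fold Ah.
    eapply Rle_trans; [apply X_norm_plus; [lra|now apply HAX|now apply HPX]|].
    fold q. unfold CL. lra. }
  assert (HinjX : forall v w, in_X G D beta v -> in_X G D beta w -> Ah v = Ah w -> v = w)
    by exact (Ah_op_injective G D beta mu k lam m nB a r C0 Hb Hk HK HnB Hrr Hst).
  assert (HsurX : forall w, in_X G D beta w -> exists v, in_X G D beta v /\ Ah v = w)
    by exact (Ah_op_surjective G D beta mu k lam m nB a r C0 Hb Hmu1 Hk HK HnB Hrr Hst).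
  assert (HSX : forall s, in_S G m nB r s -> in_X G D beta s)
    by exact (in_S_in_X G D beta mu m nB a r Hb Hmu1 HK HnB Hrr).
  assert (HSsol : forall v s, in_S G m nB r s -> Ah v = s -> in_S G m nB r v)
    by exact (Ah_op_solution_in_S G k lam m nB a r HK HnB Hrr).
  assert (Hadd : forall v w, in_X G D beta v -> in_X G D beta w ->
     Ah (fun t => Cplus (v t) (w t)) = fun t => Cplus (Ah v t) (Ah w t))
    by (intros v w; exact (Ah_op_plus G D beta mu k lam m a rho Hb Hk HK Hr nB v w HnB)).
  assert (Hhom : forall b v, in_X G D beta v ->
     Ah (fun t => Cmult b (v t)) = fun t => Cmult b (Ah v t))
    by (intros b v; exact (Ah_op_scal G D beta mu k lam m a rho Hb Hk HK Hr nB b v HnB)).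
  split; [|split].
  (* The inverse is chosen pointwise from surjectivity. Its linearity then comes from injectivity:
     both sides of each identity have the same image under [Ah]. *)
  - set (Ai := fun w : Gamma G -> C => epsilon (inhabits w) (fun v => in_X G D beta v /\ Ah v = w)).
    assert (HAi : forall w, in_X G D beta w -> in_X G D beta (Ai w) /\ Ah (Ai w) = w)
      by (intros w Hw; unfold Ai; apply epsilon_spec, HsurX, Hw).
    assert (HAiN : forall w, in_X G D beta w -> X_norm G D beta (Ai w) <= CL * X_norm G D beta w).
    { intros w Hw. destruct (HAi w Hw) as [H1 H2].
      eapply Rle_trans; [now apply Hinv|]. rewrite H2. lra. }
    exists Ai. split; [split; [|split; [|split]]|].
    + split; [exact HAX|]. split; [exact Hadd|]. split; [exact Hhom|].
      exists (1 + Cmod lam * CP). intros v Hv.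
      assert (Hs : forall t, Cmod (v t) <= X_norm G D beta v)
        by (intros t; apply Cmod_le_X_norm; [lra|exact Hv]).
      specialize (HPN v _ Hv Hs).
      replace (Ah v) with (fun t => Cplus (v t) (Cmult (RtoC (-1))
        (Cmult lam (P_op G m nB r (K_op G k v) t))))
        by (apply functional_extensionality; intros t; unfold Ah, Ah_op; ring).
      eapply Rle_trans; [apply X_norm_plus; [lra|exact Hv|now apply in_X_scal, HPX]|].
      pose proof (X_norm_scal G D beta (RtoC (-1)) _ Hbeta (HPX v Hv)) as H1.
      rewrite Cmod_R, Rabs_left1 in H1 by lra. lra.
    + split; [intros w Hw; now apply HAi|]. split; [|split].
      * intros v w Hv Hw. destruct (HAi v Hv) as [V1 V2]. destruct (HAi w Hw) as [W1 W2].
        assert (Hvw : in_X G D beta (fun t => Cplus (v t) (w t))) by now apply in_X_plus.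
        apply HinjX; [now apply HAi|now apply in_X_plus|].
        rewrite Hadd by assumption. rewrite V2, W2. now apply HAi.
      * intros b v Hv. destruct (HAi v Hv) as [V1 V2].
        assert (Hbv : in_X G D beta (fun t => Cmult b (v t))) by now apply in_X_scal.
        apply HinjX; [now apply HAi|now apply in_X_scal|].
        rewrite Hhom by assumption. rewrite V2. now apply HAi.
      * exists CL. exact HAiN.
    + intros v Hv. apply HinjX; [apply HAi, HAX, Hv|exact Hv|]. apply HAi, HAX, Hv.
    + intros v Hv. now apply HAi.
    + apply (proj2 (Lub_Rbar_correct _)). intros x (v & Hv & Hv1 & ->). simpl.
      eapply Rle_trans; [now apply HAiN|].
      rewrite <- (Rmult_1_r CL) at 2. now apply Rmult_le_compat_l.
  - intros s Hs. destruct (HsurX s (HSX s Hs)) as (v & Hv & Ev). exists v. split.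
    + split; [now split|]. intros v' [Hv' Ev']. apply HinjX; try assumption. now rewrite Ev, Ev'.
    + now apply (HSsol v s).
  - intros f _ g. destruct (P_op_spec G m nB a r g HK HnB Hrr) as [Pg1 Pg2].
    destruct (HsurX _ (HSX _ Pg1)) as (u & Hu & Eu).
    (* The link between the two problems: interpolation reproduces nodal values, so the projected
       and the original equation have the same restriction to the nodes. *)
    assert (Hnod : forall w i, (1 <= i <= nB)%nat ->
       Ah w (t_B G nB r i) = A_op G k lam w (t_B G nB r i))
      by exact (Ah_op_nodal G k lam m nB a r HK HnB Hrr).
    exists u. split; split.
    + now split.
    + intros u' [Hu' Eu']. apply HinjX; try assumption. now rewrite Eu, Eu'.
    + split; [now apply (HSsol u _ Pg1)|]. intros i Hi.
      rewrite <- Hnod, Eu by exact Hi. now apply Pg2.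
    (* For a nodal solution [u'] in the spline space, [Ah u'] is a spline with the nodal values of
       [g], hence equals the interpolant of [g]; injectivity identifies [u'] with [u]. *)
    + intros u' [Hu' Eu']. apply HinjX; [exact Hu|now apply HSX|].
      rewrite Eu. apply (P_op_eq G m nB a r _ _ HK HnB Hrr).
      * now apply (Ah_op_in_S G k lam m nB a r HK HnB Hrr).
      * intros i Hi. rewrite Hnod by exact Hi. now apply Eu'.
Qed.
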